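(* Let $n\in\mathbb{N}$, $d\in\mathbb{R}$, $\theta\in\mathbb{R}^n$ with $|\theta|=1$, and let $v\in\mathcal{S}(\mathbb{R}^n)\setminus\{0\}$ with $\operatorname{supp}\hat v\subset B(0,1/20)$. For $d'\in\mathbb{R}$ and $|\theta'|=1$ put $w(\theta',d';x)=\sum_{j=1}^\infty 2^{-jd'}e^{i2^j\theta'\cdot x}v(x)$, and write $w_\theta=w(\theta,d;\cdot)$. Let $\chi\in C^\infty_0(\mathbb{R}^n)$ satisfy $\operatorname{supp}\chi\subset\{\eta\mid\frac34\le|\eta|\le\frac54\}$ and $\chi(\eta)=1$ for $\frac9{10}\le|\eta|\le\frac{11}{10}$, and let $$a_{2\theta}(x,\eta)=\sum_{j=1}^\infty 2^{jd}e^{-i2^jx\cdot 2\theta}\chi(2^{-j}\eta).$$ Then the distribution $w(\theta,d;\cdot)$ is in $H^s(\mathbb{R}^n)$ precisely for $s<d$, and $$a_{2\theta}(x,D)w(\theta,d;x)=w(-\theta,0;x).$$ Moreover, $$\operatorname{WF}(w_\theta)=\mathbb{R}^n\times(\mathbb{R}_+\theta),\qquad \operatorname{WF}(a_{2\theta}(x,D)w(\theta,d;x))=\mathbb{R}^n\times(\mathbb{R}_+(-\theta)),$$ so the wavefront sets of $w_\theta$ and $a_{2\theta}(x,D)w_\theta$ are disjoint.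
   Context: Fourier transform: $\hat u(\xi)=\int e^{-i x\cdot\xi}u(x)\,dx$. $H^s(\mathbb{R}^n)$ is the $L_2$-Sobolev space with norm $\|(1+|\xi|^2)^{s/2}\hat u\|_{L_2}$ (up to a constant), $\mathbb{R}_+=\{t\in\mathbb{R}\mid t>0\}$, and $\operatorname{WF}$ is the ($C^\infty$) wavefront set, a subset of $\mathbb{R}^n\times(\mathbb{R}^n\setminus\{0\})$. The symbol $a_{2\theta}$ satisfies $|D^\alpha_\eta D^\beta_x a_{2\theta}(x,\eta)|\le C_{\alpha,\beta}(1+|\eta|)^{d-|\alpha|+|\beta|}$ for all $\alpha,\beta$ (i.e. it is of type $1,1$ and order $d$). On $\mathcal{S}(\mathbb{R}^n)$, $a_{2\theta}(x,D)u(x)=(2\pi)^{-n}\int e^{i x\cdot\eta}a_{2\theta}(x,\eta)\hat u(\eta)\,d\eta$, and $a_{2\theta}(x,D)$ also denotes the extensions by continuity from $\mathcal{S}(\mathbb{R}^n)$ to bounded operators $H^{s+d}(\mathbb{R}^n)\to H^s(\mathbb{R}^n)$, which exist for every $s\in\mathbb{R}$. The series for $w(\theta',d';\cdot)$ converges in $\mathcal{S}'(\mathbb{R}^n)$. *)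

(* Defs.v *)
From HB Require Import structures.
From mathcomp Require Import all_boot all_order all_algebra.
From mathcomp Require Import all_classical all_reals all_analysis.
From mathcomp Require Import complex.

Set Implicit Arguments.
Unset Strict Implicit.
Unset Printing Implicit Defensive.

Import Order.TTheory GRing.Theory Num.Theory.
Import numFieldNormedType.Exports.
Import ComplexField.Normc.

Local Open Scope classical_set_scope.
Local Open Scope ring_scope.

(* The product (= Borel) sigma-algebra on row vectors. *)
Section measurable_rV.
Context {R : realType} (n : nat).

Let coords : 'I_n -> 'rV[R]_n -> measurableTypeR R := fun i x => x 0 i.

Let rV_set0 : g_sigma_preimage coords set0.
Proof. exact: sigma_algebra0. Qed.

Let rV_setC A : g_sigma_preimage coords A -> g_sigma_preimage coords (~` A).
Proof. exact: sigma_algebraC. Qed.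

Let rV_bigcup (F : _^nat) : (forall i, g_sigma_preimage coords (F i)) ->
  g_sigma_preimage coords (\bigcup_i (F i)).
Proof. exact: sigma_algebra_bigcup. Qed.

HB.instance Definition _ := @isMeasurable.Build default_measure_display
  'rV[R]_n (g_sigma_preimage coords) rV_set0 rV_setC rV_bigcup.

End measurable_rV.

Section lebesgue_rV.
Context {R : realType}.

Lemma measurable_coord n (i : 'I_n) :
  measurable_fun setT (fun x : 'rV[R]_n => x 0 i : measurableTypeR R).
Proof.
move=> _ Y mY; rewrite setTI; apply: sub_sigma_algebra => /=.
rewrite -bigcup_seq/=; exists i => /=; first by rewrite mem_index_enum.
by exists Y => //; rewrite setTI.
Qed.

Lemma measurable_fun_rVP d (T : measurableType d) n (f : T -> 'rV[R]_n) :
  measurable_fun setT f <->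
  forall i, measurable_fun setT (fun x => f x 0 i : measurableTypeR R).
Proof.
split=> [mf i|mf]; first exact: measurableT_comp (measurable_coord i) mf.
move=> _ A mA; rewrite setTI.
pose D : set (set 'rV[R]_n) := [set B | measurable (f @^-1` B)].
apply: (mA D); split.
  split.
  - by rewrite /D /= preimage_set0.
  - by move=> B DB; rewrite /D /= setTD preimage_setC; exact: measurableC.
  - by move=> F DF; rewrite /D /= preimage_bigcup; exact: bigcupT_measurable.
rewrite -bigcup_seq => _ [i _] [Y mY <-].
by rewrite /D /= setTI -[X in measurable X]setTI; exact: mf.
Qed.

Definition consrV n (p : measurableTypeR R * 'rV[R]_n) : 'rV[R]_n.+1 :=
  \row_i if unlift ord0 i is Some j then p.2 0 j else p.1.

Definition unconsrV n (x : 'rV[R]_n.+1) : measurableTypeR R * 'rV[R]_n :=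
  (x 0 ord0, \row_i x 0 (lift ord0 i)).

Lemma consrV0 n p : @consrV n p 0 ord0 = p.1.
Proof. by rewrite mxE unlift_none. Qed.

Lemma consrVS n p i : @consrV n p 0 (lift ord0 i) = p.2 0 i.
Proof. by rewrite mxE liftK. Qed.

Lemma consrVK n : cancel (@consrV n) (@unconsrV n).
Proof.
move=> p; rewrite /unconsrV consrV0 [RHS]surjective_pairing; congr pair.
by apply/rowP => i; rewrite mxE consrVS.
Qed.

Lemma measurable_consrV n : measurable_fun setT (@consrV n).
Proof.
apply/measurable_fun_rVP => i; have [j ->|->] := unliftP ord0 i.
  under eq_fun do rewrite consrVS.
  exact: measurableT_comp (measurable_coord j) measurable_snd.
by under eq_fun do rewrite consrV0; exact: measurable_fst.
Qed.

Lemma measurable_unconsrV n : measurable_fun setT (@unconsrV n).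
Proof.
apply: measurable_fun_pair; first exact: measurable_coord.
apply/measurable_fun_rVP => i.
by under eq_fun do rewrite mxE; exact: measurable_coord.
Qed.

Section lebesgue_step.
Variables (n : nat) (mu : {sigma_finite_measure set 'rV[R]_n -> \bar R}).

Definition lebesgue_step : set 'rV[R]_n.+1 -> \bar R :=
  pushforward (@lebesgue_measure R \x mu)%E (@consrV n).

Let step0 : lebesgue_step set0 = 0%E.
Proof. by rewrite /lebesgue_step /pushforward preimage_set0 measure0. Qed.

Let step_ge0 A : (0 <= lebesgue_step A)%E.
Proof. by rewrite /lebesgue_step /pushforward; apply: measure_ge0. Qed.

Let step_sigma_additive : semi_sigma_additive lebesgue_step.
Proof.
have mc B : measurable B -> measurable (@consrV n @^-1` B).
  by move=> mB; rewrite -[X in measurable X]setTI; exact: measurable_consrV.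
move=> F mF tF mUF; rewrite /lebesgue_step /pushforward preimage_bigcup.
apply: measure_semi_sigma_additive.
- by move=> k; exact: mc.
- apply/trivIsetP => /= i j _ _ ij; rewrite -preimage_setI.
  by move/trivIsetP : tF => /(_ _ _ _ _ ij) ->//; rewrite preimage_set0.
- by rewrite -preimage_bigcup; exact: mc.
Qed.

HB.instance Definition _ := isMeasure.Build _ _ _ lebesgue_step
  step0 step_ge0 step_sigma_additive.

Let step_sigma_finite : sigma_finite setT lebesgue_step.
Proof.
have /sigma_finiteP[G [GT ndG Goo]] := sigma_finiteT (@lebesgue_measure R).
have /sigma_finiteP[H [HT ndH Hoo]] := sigma_finiteT mu.
pose F k := G k `*` H k.
have FT : setT = \bigcup_k F k.
  apply/esym; rewrite -subTset => -[x y] _.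
  have [k _ Gx] : (\bigcup_k G k) x by rewrite -GT.
  have [l _ Hy] : (\bigcup_k H k) y by rewrite -HT.
  exists (maxn k l) => //; split.
    by move: x Gx; exact/subsetPset/ndG/leq_maxl.
  by move: y Hy; exact/subsetPset/ndH/leq_maxr.
have Foo k : measurable (F k) /\ ((@lebesgue_measure R \x mu) (F k) < +oo)%E.
  have [mG Gk] := Goo k; have [mH Hk] := Hoo k.
  split; first exact: measurableX.
  by rewrite product_measure1E// lte_mul_pinfty// ge0_fin_numE.
exists (fun k => @unconsrV n @^-1` F k).
  by rewrite -preimage_bigcup -FT preimage_setT.
move=> k; have [mF Fk] := Foo k; split.
  by rewrite -[X in measurable X]setTI; exact: measurable_unconsrV.
rewrite /lebesgue_step /pushforward -comp_preimage.
rewrite (_ : _ \o _ = id) ?preimage_id//.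
by apply/funext => p /=; rewrite consrVK.
Qed.

HB.instance Definition _ :=
  Measure_isSigmaFinite.Build _ _ _ lebesgue_step step_sigma_finite.

End lebesgue_step.

Fixpoint lebesgue_rV n : {sigma_finite_measure set 'rV[R]_n -> \bar R} :=
  match n with
  | 0 => \d_(0 : 'rV[R]_0)
  | m.+1 => lebesgue_step (lebesgue_rV m)
  end.

End lebesgue_rV.

Section complex_functions.
Context {R : realType} {n : nat}.
Implicit Types (x y xi : 'rV[R]_n) (f : 'rV[R]_n -> R[i]).

(* The library norm on 'rV[R]_n is the sup norm, hence the Euclidean one. *)
Definition dotp x y : R := \sum_i x 0 i * y 0 i.
Definition enorm x : R := Num.sqrt (dotp x x).

(* e^{it} *)
Definition expi (t : R) : R[i] := Complex (cos t) (sin t).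

(* R[i] is not a normed module over R in the library: limits, derivatives and
   integrals of complex-valued functions are taken componentwise. *)
Definition climn (u : nat -> R[i]) : R[i] :=
  Complex (limn (fun N => complex.Re (u N))) (limn (fun N => complex.Im (u N))).

Definition cint f : R[i] :=
  Complex (\int[lebesgue_rV n]_x complex.Re (f x)) (\int[lebesgue_rV n]_x complex.Im (f x)).

Definition partial (i : 'I_n) f : 'rV[R]_n -> R[i] := fun x =>
  Complex ('D_(delta_mx 0 i) (fun y => complex.Re (f y)) x)
          ('D_(delta_mx 0 i) (fun y => complex.Im (f y)) x).

Definition partials (s : seq 'I_n) f := foldr partial f s.

Definition smooth f := forall (s : seq 'I_n) x,
  differentiable (fun y => complex.Re (partials s f y)) x /\
  differentiable (fun y => complex.Im (partials s f y)) x.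

Definition supp f : set 'rV[R]_n := closure [set x | f x != 0].

Definition test_function f := smooth f /\ compact (supp f).

(* sup over |alpha| <= N and x of (1 + |x|)^N |d^alpha f(x)| *)
Definition schwartz_norm (N : nat) f : \bar R :=
  ereal_sup [set ((1 + enorm p.2) ^+ N * normc (partials p.1 f p.2))%:E
            | p in [set p : seq 'I_n * 'rV[R]_n | (size p.1 <= N)%N]].

Definition schwartz f := smooth f /\ forall N, (schwartz_norm N f < +oo)%E.

Definition fourier f : 'rV[R]_n -> R[i] := fun xi =>
  cint (fun x => expi (- dotp x xi) * f x).

End complex_functions.

Section distributions.
Context {R : realType} {n : nat}.

(* A tempered distribution is represented by a functional on all functions of
   which only the values on Schwartz functions matter. *)
Definition functional := ('rV[R]_n -> R[i]) -> R[i].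
Implicit Types (u : functional) (f phi : 'rV[R]_n -> R[i]).

Definition tempered u :=
  (forall (c : R[i]) phi psi, schwartz phi -> schwartz psi ->
     u (fun x => c * phi x + psi x) = c * u phi + u psi) /\
  (exists (N : nat) (C : R), forall phi, schwartz phi ->
     ((normc (u phi))%:E <= C%:E * schwartz_norm N phi)%E).

Definition deq u1 u2 := forall phi, schwartz phi -> u1 phi = u2 phi.

Definition of_fun f : functional := fun phi => cint (fun x => f x * phi x).

Definition dfourier u : functional := fun phi => u (fourier phi).

Definition cmeasurable f :=
  measurable_fun setT (fun x => complex.Re (f x)) /\
  measurable_fun setT (fun x => complex.Im (f x)).

(* || (1 + |xi|^2)^{s/2} u^ ||_{L_2}; the infimum ranges over the
   representatives g of the function u^, and is +oo if u^ is no function. *)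
Definition sobolev_norm (s : R) u : \bar R :=
  ereal_inf [set Lnorm (lebesgue_rV n) 2%:E
      (fun xi => ((1 + enorm xi ^+ 2) `^ (s / 2) * normc (g xi))%:E)
    | g in [set g | cmeasurable g /\ deq (dfourier u) (of_fun g)]].

Definition sobolev (s : R) : set functional :=
  [set u | tempered u /\ (sobolev_norm s u < +oo)%E].

(* The Fourier transform of phi u, of compact support, is the function
   xi |-> u (phi e^{-i x.xi}). *)
Definition microlocally_smooth u (x0 xi0 : 'rV[R]_n) :=
  exists (phi : 'rV[R]_n -> R[i]) (V : set 'rV[R]_n),
    [/\ test_function phi, phi x0 != 0,
        open V /\ V xi0,
        forall (t : R) xi, 0 < t -> V xi -> V (t *: xi)
      & forall N : nat, exists C : R, forall xi, V xi ->
          normc (u (fun x => phi x * expi (- dotp x xi)))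
            <= C * (1 + enorm xi) ^- N].

Definition WF u : set ('rV[R]_n * 'rV[R]_n) :=
  [set p | p.2 != 0 /\ ~ microlocally_smooth u p.1 p.2].

End distributions.
Arguments functional : clear implicits.

Section operators.
Context {R : realType} {n : nat}.

(* a(x,D) on Schwartz functions *)
Definition pseudo_diff (a : 'rV[R]_n -> 'rV[R]_n -> R[i])
    (u : 'rV[R]_n -> R[i]) : 'rV[R]_n -> R[i] := fun x =>
  ((2 * pi) ^- n)%:C%C *
  cint (fun eta => expi (dotp x eta) * a x eta * fourier u eta).

(* A is the extension by continuity of a(x,D) to a bounded linear operator
   from H^{s+d} to H^s (unique by density of the Schwartz functions). *)
Definition continuous_extension (d s : R) (a : 'rV[R]_n -> 'rV[R]_n -> R[i])
    (A : functional R n -> functional R n) :=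
  [/\ forall u, sobolev (s + d) u -> sobolev s (A u),
      forall (c : R[i]) u1 u2, sobolev (s + d) u1 -> sobolev (s + d) u2 ->
        deq (A (fun phi => c * u1 phi + u2 phi))
            (fun phi => c * A u1 phi + A u2 phi),
      exists C : R, forall u, sobolev (s + d) u ->
        (sobolev_norm s (A u) <= C%:E * sobolev_norm (s + d) u)%E
    & forall u, schwartz u -> deq (A (of_fun u)) (of_fun (pseudo_diff a u))].

Definition a2theta (d : R) (theta : 'rV[R]_n) (chi : 'rV[R]_n -> R[i])
    (x eta : 'rV[R]_n) : R[i] :=
  climn (fun N => \sum_(1 <= j < N.+1)
    (2 `^ (j%:R * d))%:C%C * expi (- (2 ^+ j * dotp x (2 *: theta)))
      * chi (2 ^- j *: eta)).

(* w(theta',d';.), the series being summed in the sense of distributions *)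
Definition wdist (v : 'rV[R]_n -> R[i]) (theta' : 'rV[R]_n) (d' : R) :
    functional R n := fun phi =>
  climn (fun N => of_fun (fun x => \sum_(1 <= j < N.+1)
    (2 `^ (- j%:R * d'))%:C%C * expi (2 ^+ j * dotp theta' x) * v x) phi).

(* R_+ theta *)
Definition open_ray (theta : 'rV[R]_n) : set 'rV[R]_n :=
  [set t *: theta | t in [set t : R | 0 < t]].

End operators.

(* Main.v *)
Require Import Defs.
From HB Require Import structures.
From mathcomp Require Import all_boot all_order all_algebra.
From mathcomp Require Import all_classical all_reals all_analysis.
From mathcomp Require Import measurable_realfun complex ring lra.

Set Implicit Arguments.
Unset Strict Implicit.
Unset Printing Implicit Defensive.

Import Order.TTheory GRing.Theory Num.Theory.
Import numFieldNormedType.Exports.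

Local Open Scope classical_set_scope.
Local Open Scope ring_scope.

Import ComplexField.Normc.

(** Everything happens on the Fourier side.  The Fourier transform of
    [w = wdist v theta d] is the sum over [j] of the bumps
    [2^(-jd) fourier v (xi - 2^j theta)].  They live in the balls of radius
    [1/20] around the points [2^j theta], so at most one of them is nonzero at
    a given [xi], and there [1 + |xi|^2] is comparable to [4^j].

    Sobolev regularity.  The squared [H^s] norm of [w] is therefore comparable
    to the sum of [4^(j (s - d))], times the squared [L^2] norm of [fourier v]
    ([mass]), and this is finite exactly for [s < d].  Since a Sobolev norm is
    an infimum over representatives of the Fourier transform, divergence for
    [s >= d] is shown by duality ([sobolev_dual]): testing [w] against the sum
    for [k <= J] of [2^(kd)] times the conjugate of the [k]-th unit bump gives
    [J * mass], while the [H^(-s)] norm of the test function is only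
    [O(sqrt J)].

    Wavefront set.  The Fourier transform of [phi w] is the sum of
    [2^(-jd) F(v phi) (xi - 2^j theta)], with [F(v phi)] rapidly decreasing.
    On a cone that avoids the ray of [theta], the distance from [xi] to
    [2^j theta] is at least a multiple of [|xi| + 2^j], so the whole sum
    decays rapidly.  Conversely, suppose that it decays rapidly on an open
    cone around [theta].  At [xi = 2^k theta + eta] the term [j = k] is
    [2^(-kd) F(v phi) eta] and all other terms are rapidly small in [2^k];
    letting [k] grow gives [F(v phi) eta = 0] for every [eta]
    ([ray_fourier_eq0]).  Then [v phi = 0], so [v] vanishes on a ball, and [v]
    is zero because it is band-limited, hence analytic
    ([bandlimited_unique_continuation]).

    Operator.  Where the [k]-th bump lives, the cut-off [chi (2^(-j) xi)] is
    [1] for [j = k] and [0] otherwise, so the symbol reduces to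
    [2^(kd) e^(-i 2^k x . 2 theta)]: it removes the factor [2^(-kd)] and turns
    the frequency [2^k theta] into [2^k theta - 2 * 2^k theta = - 2^k theta].
    Hence [a(x, D)] maps the partial sums of [w(theta, d)] to those of
    [w(-theta, 0)] ([pseudo_wpart]).  The remainders of the series tend to [0]
    in [H^(s + d)] when [s < 0], that is, when [w] belongs to [H^(s + d)]; so
    the continuity of the extension gives [A w = w(-theta, 0)].  The wavefront
    set of [A w] is then the ray of [-theta], which does not meet that of
    [theta].

    The Fourier analysis behind this is developed from the product kernel
    [e^(- |x_1| - ... - |x_n|)], whose transform is explicit: the inversion
    formula on Schwartz functions, and with it injectivity and surjectivity of
    the Fourier transform, follow by rescaling this kernel. *)

(** * Borel structure and affine substitution on row vectors *)

Section measure_rV.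
Context {R : realType}.

(** An open set is a countable union of boxes with rational centres and sides
    [2/(k+1)], which are balls for the sup norm. *)
Lemma open_measurable_rV n (U : set 'rV[R]_n) : open U -> measurable U.
Proof.
move=> oU.
pose B (p : 'rV[rat]_n * nat) : set 'rV[R]_n :=
  [set x | forall i, ball (ratr (p.1 0 i) : R) p.2.+1%:R^-1 (x 0 i)].
have mB p : measurable (B p).
  have -> : B p = \big[setI/setT]_(i < n)
      ((fun x : 'rV[R]_n => x 0 i : measurableTypeR R) @^-1`
        ball (ratr (p.1 0 i) : R) p.2.+1%:R^-1).
    apply/seteqP; split => [x Bx|x].
      by rewrite -bigcap_seq => i _; exact: Bx.
    by rewrite -bigcap_seq => Bx i; apply: Bx; rewrite /= mem_index_enum.
  apply: bigsetI_measurable => i _; rewrite -[X in measurable X]setTI.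
  by apply: measurable_coord => //; exact: measurable_ball.
have -> : U = \bigcup_(p in [set p | B p `<=` U]) B p.
  apply/seteqP; split => [x Ux|x [p /= BU Bx]]; last exact: BU.
  have [e /= e0 eU] : exists2 e : R, 0 < e & ball x e `<=` U.
    by have /nbhs_ballP[e e0 eU] := oU x Ux; exists e.
  have [k _ ke] : exists2 k : nat, True & k.+1%:R^-1 < e / 2.
    have [k _ /(_ _ (leqnn k)) hk] := near_infty_natSinv_lt (PosNum (divr_gt0 e0 (@ltr0Sn R 1))).
    by exists k.
  have qex i : exists q : rat, ball (x 0 i) k.+1%:R^-1 (ratr q : R).
    have [|y [By [q _ qy]]] := @dense_rat R (ball (x 0 i) (k.+1%:R^-1)) _ (ball_open _ _).
      by exists (x 0 i); exact: ballxx.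
    by exists q; rewrite qy.
  pose q i := xget 0 [set q : rat | ball (x 0 i) k.+1%:R^-1 (ratr q : R)].
  have qP i : ball (x 0 i) k.+1%:R^-1 (ratr (q i) : R).
    by have := qex i; rewrite /q; case: xgetP => [y _ + _//|h [r hr]]; case: (h r).
  exists (\row_i q i, k) => /= [y By|i]; last by rewrite mxE; exact: ball_sym (qP i).
  apply: eU; split=> // a i; rewrite ord1.
  apply: (@le_ball _ _ _ (k.+1%:R^-1 + k.+1%:R^-1)); first by move: ke; move: (k.+1%:R^-1) => r; lra.
  by apply: ball_triangle (qP i) _; have := By i; rewrite /= mxE.
rewrite bigcup_mkcond; apply: countable_bigcupT_measurable => [|p]; first exact: countableP.
by case: ifP => _; [exact: mB|exact: measurable0].
Unshelve. all: by rewrite ?invr_gt0.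
Qed.

Lemma continuous_measurable_rV n (f : 'rV[R]_n -> R) :
  continuous f -> measurable_fun setT (f : _ -> measurableTypeR R).
Proof.
move=> /continuousP cf; apply: (measurability _ (RGenOpens.measurableE R)).
move=> _ [_ [a [b ->] <-]]; rewrite setTI; apply: open_measurable_rV.
exact/cf/interval_open.
Qed.

Lemma ge0_integral_affine1 (a r : R) (f : R -> \bar R) : 0 < r ->
  measurable_fun setT (f : measurableTypeR R -> _) -> (forall x, 0 <= f x)%E ->
  (\int[lebesgue_measure]_x f (a + r * x)%R = (r^-1)%:E * \int[lebesgue_measure]_x f x)%E.
Proof.
move=> r0 mf f0.
pose g (x : measurableTypeR R) : measurableTypeR R := a + r * x.
have mg : measurable_fun setT g.
  apply: measurable_funD => //; exact: measurable_funM.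
have r'0 : 0 <= r^-1 by rewrite invr_ge0 ltW.
pose r' := NngNum r'0.
transitivity (\int[pushforward lebesgue_measure g]_x f x)%E.
  by rewrite ge0_integral_pushforward.
rewrite -(@ge0_integral_mscale _ _ _ (@lebesgue_measure R) _ measurableT r' f)//.
apply: eq_measure_integral => /= A mA _.
pose m : {measure set (measurableTypeR R) -> \bar R} :=
  measure_function_pushforward__canonical__measure_function_Measure
    (@lebesgue_measure R) mg.
suff E : lebesgue_measure A = mscale (NngNum (ltW r0)) m A.
  by rewrite /mscale /= E muleA -EFinM mulVf ?gt_eqF// mul1e.
apply: (@lebesgue_measure_unique _ (mscale (NngNum (ltW r0)) m)) => //= _ [[u v]] _ <-.
rewrite /mscale /= /pushforward.
have -> : g @^-1` `]u, v] =
    `](u - a) / r, (v - a) / r]%classic :> set (measurableTypeR R).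
  apply/seteqP; split => x /=; rewrite !in_itv/= ltr_pdivrMr// ler_pdivlMr//;
    by rewrite ltrBlDl lerBrDl mulrC.
rewrite !lebesgue_measure_itv/= !lte_fin ltr_pM2r ?invr_gt0// ltrD2r.
case: ifP => _; last by rewrite mule0.
by rewrite -EFinM -mulrBl mulrCA divff ?gt_eqF// mulr1 opprB addrA subrK.
Qed.

Lemma ge0_integral_rVS n (f : 'rV[R]_n.+1 -> \bar R) :
  measurable_fun setT f -> (forall x, 0 <= f x)%E ->
  (\int[lebesgue_rV n.+1]_x f x =
   \int[lebesgue_measure]_t \int[lebesgue_rV n]_y f (consrV (t, y)))%E.
Proof.
move=> mf f0.
transitivity (\int[pushforward (@lebesgue_measure R \x lebesgue_rV n) (@consrV R n)]_x f x)%E.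
  by [].
rewrite ge0_integral_pushforward//; last exact: measurable_consrV.
rewrite preimage_setT fubini_tonelli1//.
  apply: measurableT_comp => //; exact: measurable_consrV.
by move=> x; exact: f0.
Qed.

Lemma measurable_affine n (a : 'rV[R]_n) (r : R) :
  measurable_fun setT (fun x : 'rV[R]_n => a + r *: x).
Proof.
apply/measurable_fun_rVP => i; under eq_fun do rewrite !mxE.
apply: measurable_funD => //; apply: measurable_funM => //; exact: measurable_coord.
Qed.

(** By Tonelli and induction on the dimension, one coordinate at a time. *)
Lemma ge0_integral_affine n (a : 'rV[R]_n) (r : R) (f : 'rV[R]_n -> \bar R) :
  0 < r -> measurable_fun setT f -> (forall x, 0 <= f x)%E ->
  (\int[lebesgue_rV n]_x f (a + r *: x)%R =
   (r ^- n)%:E * \int[lebesgue_rV n]_x f x)%E.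
Proof.
move=> r0; elim: n a f => [|n IH] a f mf f0.
  rewrite expr0 invr1 mul1e; apply: eq_integral => x _; congr f.
  by apply/rowP => -[].
rewrite ge0_integral_rVS//; last exact: measurableT_comp mf (measurable_affine _ _).
transitivity (\int[lebesgue_measure]_t
   ((r ^- n)%:E * \int[lebesgue_rV n]_y f (consrV (a ord0 ord0 + r * t, y)%R)))%E.
  apply: eq_integral => t _.
  rewrite -(IH (\row_i a ord0 (lift ord0 i)))//; last first.
    apply: measurableT_comp => //.
    apply: (measurableT_comp (@measurable_consrV R n)).
    by apply: measurable_fun_pair => //.
  apply: eq_integral => y _; congr f; apply/rowP => i.
  have [j ->|->] := unliftP ord0 i; first by rewrite !mxE !liftK !mxE.
  by rewrite !mxE !unlift_none/=.
pose h t := (\int[lebesgue_rV n]_y f (consrV (t, y)))%E.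
have h0 t : (0 <= h t)%E by apply: integral_ge0 => y _.
have mh : measurable_fun setT (h : measurableTypeR R -> _).
  apply: (@measurable_fun_fubini_tonelli_F _ _ _ _ _ (lebesgue_rV n) (f \o (@consrV R n))) => //=.
  by apply: measurableT_comp => //; exact: measurable_consrV.
rewrite ge0_integralZl//=.
- rewrite (ge0_integral_affine1 (a 0 0) r0 mh h0) muleA -EFinM.
  rewrite ge0_integral_rVS//; congr (_%:E * _)%E.
  by rewrite exprS invfM mulrC.
- apply: measurableT_comp mh _.
  by apply: measurable_funD => //; exact: measurable_funM.
- by move=> t _; exact: h0.
- by rewrite lee_fin invr_ge0 exprn_ge0// ltW.
Qed.
End measure_rV.

(** * The transform of the one-dimensional Laplace kernel *)

Section kernel1.
Context {R : realType}.
Implicit Types (x y z t : R).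
Notation mu := (@lebesgue_measure R).

Lemma inv1Dsqr_gt0 x : 0 < (1 + x ^+ 2)^-1.
Proof. by rewrite invr_gt0 ltr_pwDl// sqr_ge0. Qed.

Lemma continuous_inv1Dsqr : continuous (fun x : R => (1 + x ^+ 2)^-1).
Proof.
move=> x; apply: cvgV; first by rewrite gt_eqF// ltr_pwDl// sqr_ge0.
by apply: cvgD; [exact: cvg_cst|exact: exprn_continuous].
Qed.

Lemma integral_inv1Dsqr : (\int[mu]_x ((1 + x ^+ 2)^-1)%:E = pi%:E)%E.
Proof.
rewrite ge0_symfun_integralT.
- rewrite -set_itvcy (@ge0_continuous_FTC2y _ _ (@atan R) 0 (pi / 2)).
  + by rewrite atan0 sube0 -EFinM mulrC divfK.
  + by move=> x _; exact/ltW/inv1Dsqr_gt0.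
  + by apply: continuous_subspaceT; exact: continuous_inv1Dsqr.
  + exact: cvgy_atan.
  + by move=> x _; exact: derivable_atan.
  + by apply: cvg_at_right_filter; exact: continuous_atan.
  + by move=> x _; exact: derive1_atan.
- by move=> x; exact/ltW/inv1Dsqr_gt0.
- exact: continuous_inv1Dsqr.
- by move=> x /=; rewrite sqrrN.
Qed.

(** Adding the constant [1] to the cosine makes the integrand nonnegative, so
    that the fundamental theorem of calculus for nonnegative functions on a
    half-line applies; the contribution of [1] is subtracted afterwards (case
    [z = 0]). *)
Let ker z x : R := expR (- `|x|) * (1 + cos (z * x)).

Let ker_ge0 z x : 0 <= ker z x.
Proof. by rewrite mulr_ge0 ?expR_ge0// -lerBlDl sub0r cos_geN1. Qed.

Let continuous_ker z : continuous (ker z).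
Proof.
move=> x; apply: cvgM.
  apply: continuous_comp; last exact: continuous_expR.
  by apply: cvgN; exact: norm_continuous.
apply: cvgD; first exact: cvg_cst.
apply: continuous_comp; last exact: continuous_cos.
exact: mulrl_continuous.
Qed.

Let prim z x : R := expR (- x) * (- 1 + (z * sin (z * x) - cos (z * x)) / (1 + z ^+ 2)).

Let is_derive_prim z x : is_derive x 1 (prim z) (expR (- x) * (1 + cos (z * x))).
Proof.
have z0 : 1 + z ^+ 2 != 0 by rewrite gt_eqF// ltr_pwDl// sqr_ge0.
have ? : is_derive x 1 (fun y => z * y) z.
  by rewrite -[X in is_derive _ _ _ X]mulr1; exact: is_deriveZ.
have H1 : is_derive x 1 (fun x : R => sin (z * x)) (z * cos (z * x)).
  by apply: is_derive_eq; rewrite mulrC.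
have H2 : is_derive x 1 (fun x : R => cos (z * x)) (- (z * sin (z * x))).
  by apply: is_derive_eq; rewrite mulrC mulrN.
have H3 : is_derive x 1 (fun x : R => expR (- x)) (- expR (- x)).
  apply: is_derive_eq; by rewrite mulrN1.
have H4 : is_derive x 1 (fun x : R => z * sin (z * x)) (z * (z * cos (z * x))).
  exact: is_deriveZ.
have H5 : is_derive x 1 (fun x : R => z * sin (z * x) - cos (z * x))
    (z * (z * cos (z * x)) + z * sin (z * x)).
  by apply: is_derive_eq; rewrite opprK.
have H6 : is_derive x 1
    (fun x : R => (1 + z ^+ 2)^-1 * (z * sin (z * x) - cos (z * x)))
    ((1 + z ^+ 2)^-1 * (z * (z * cos (z * x)) + z * sin (z * x))).
  exact: is_deriveZ.
rewrite /prim; under eq_fun do rewrite [X in _ * (_ + X)]mulrC.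
apply: is_derive_eq; rewrite /GRing.scale/=.
by field.
Qed.

Let cvg_prim z : prim z x @[x --> +oo] --> 0.
Proof.
have z0 : 0 < 1 + z ^+ 2 by rewrite ltr_pwDl// sqr_ge0.
pose C := 1 + (`|z| + 1) / (1 + z ^+ 2).
have C0 : 0 < C by rewrite ltr_pwDl// divr_ge0// ltW.
have B x : `|prim z x| <= expR (- x) * C.
  rewrite normrM ger0_norm ?expR_ge0// ler_wpM2l ?expR_ge0//.
  rewrite (le_trans (ler_normD _ _))// normrN1 lerD2l normrM.
  rewrite normfV (ger0_norm (ltW z0)) ler_pM2r ?invr_gt0//.
  rewrite (le_trans (ler_normB _ _))// lerD ?cos_max//.
  by rewrite normrM ler_piMr// sin_max.
have H : expR (- x) * C @[x --> +oo] --> 0.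
  by rewrite -(mul0r C); apply: cvgM; [exact: cvgr_expR|exact: cvg_cst].
apply/norm_cvg0P; apply: (squeeze_cvgr _ (cvg_cst 0) H).
by apply: nearW => x; rewrite normr_ge0 B.
Qed.

Let integral_ker z : (\int[mu]_x (ker z x)%:E = (2 + 2 / (1 + z ^+ 2))%:E)%E.
Proof.
rewrite ge0_symfun_integralT//; last first.
  by move=> x; rewrite /ker/= normrN mulrN cosN.
have F0 : prim z 0 = - (1 + (1 + z ^+ 2)^-1).
  by rewrite /prim oppr0 expR0 mulr0 sin0 cos0 mulr0 sub0r mul1r mulN1r opprD.
rewrite -set_itvcy.
under eq_integral => x /[1!inE]/= /[1!in_itv]/= /andP[x0 _].
  rewrite /ker ger0_norm//; over.
rewrite (@ge0_continuous_FTC2y _ _ (prim z) 0 0).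
- rewrite F0 sub0e -EFinN opprK -EFinM; congr EFin; ring.
- move=> x x0; by have := ker_ge0 z x; rewrite /ker ger0_norm.
- apply: continuous_subspaceT => x; apply: cvgM.
    apply: continuous_comp; last exact: continuous_expR.
    exact: cvgN.
  apply: cvgD; first exact: cvg_cst.
  apply: continuous_comp; last exact: continuous_cos.
  exact: mulrl_continuous.
- exact: cvg_prim.
- by move=> x _; have [] := is_derive_prim z x.
- apply: cvg_at_right_filter; apply: differentiable_continuous.
  by apply/derivable1_diffP; have [] := is_derive_prim z 0.
- by move=> x _; rewrite derive1E; have [_ ->] := is_derive_prim z x.
Qed.

Lemma integrable_laplace : mu.-integrable setT (EFin \o (fun x : R => expR (- `|x|))).
Proof.
have := integral_ker 0; rewrite expr0n/= addr0 divr1 => H.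
have mk : measurable_fun setT (fun x : measurableTypeR R => expR (- `|x|)).
  apply: continuous_measurable_fun => x.
  apply: continuous_comp; last exact: continuous_expR.
  by apply: cvgN; exact: norm_continuous.
apply/integrableP; split; first exact/measurable_EFinP.
apply: le_lt_trans (ltry (2 + 2)); rewrite -H; apply: ge0_le_integral => //=.
- by apply/measurable_EFinP; apply: measurableT_comp.
- by apply/measurable_EFinP; exact: continuous_measurable_fun.
- move=> x _; rewrite lee_fin ger0_norm ?expR_ge0// /ker mul0r cos0.
  by rewrite ler_peMr ?expR_ge0// lerDl.
Qed.

Lemma integrable_laplaceM (h : R -> R) : continuous h -> (forall x, `|h x| <= 1) ->
  mu.-integrable setT (EFin \o (fun x : R => expR (- `|x|) * h x)).
Proof.
move=> ch h1; apply: le_integrable integrable_laplace => //.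
  apply/measurable_EFinP; apply: measurable_funM.
    by apply/measurable_EFinP; exact: measurable_int integrable_laplace.
  exact: continuous_measurable_fun.
move=> x _ /=; rewrite lee_fin normrM ler_piMr// ?h1//.
Qed.

Let integrable_cos z : mu.-integrable setT (EFin \o (fun x : R => expR (- `|x|) * cos (z * x))).
Proof.
apply: integrable_laplaceM => [x|x]; last exact: cos_max.
by apply: continuous_comp; [exact: mulrl_continuous|exact: continuous_cos].
Qed.

Let RintegralE z : \int[mu]_x expR (- `|x|) + \int[mu]_x (expR (- `|x|) * cos (z * x))
  = 2 + 2 / (1 + z ^+ 2).
Proof.
rewrite -RintegralD//; last exact: integrable_laplace.
have := integral_ker z; rewrite /Rintegral => H.
have -> : 2 + 2 / (1 + z ^+ 2) = fine (2 + 2 / (1 + z ^+ 2))%:E by [].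
rewrite -H; congr fine; apply: eq_integral => x _.
by rewrite /ker mulrDr mulr1.
Qed.

(** [RintegralE] at [z] and at [0] are two equations for this integral and
    that of [expR (- `|x|)]. *)
Lemma Rintegral_laplace_cos z :
  \int[mu]_x (expR (- `|x|) * cos (z * x)) = 2 / (1 + z ^+ 2).
Proof.
have := RintegralE 0; have := RintegralE z.
have -> : \int[mu]_x (expR (- `|x|) * cos (0 * x)) = \int[mu]_x expR (- `|x|).
  by apply: eq_Rintegral => x _; rewrite mul0r cos0 mulr1.
rewrite expr0n/= addr0 divr1; lra.
Qed.

Let ge0_integral_opp (f : R -> \bar R) :
  measurable_fun setT (f : measurableTypeR R -> _) -> (forall x, 0 <= f x)%E ->
  (\int[mu]_x f (- x)%R = \int[mu]_x f x)%E.
Proof.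
move=> mf f0.
pose g (x : measurableTypeR R) : measurableTypeR R := - x.
have mg : measurable_fun setT g by exact: oppr_measurable.
transitivity (\int[pushforward mu g]_x f x)%E.
  by rewrite ge0_integral_pushforward.
pose m : {measure set (measurableTypeR R) -> \bar R} :=
  measure_function_pushforward__canonical__measure_function_Measure mu mg.
apply: (@eq_measure_integral _ _ _ _ mu m) => A mA _.
exact: lebesgue_measureN.
Qed.

(** The integrand is odd; since the reflection [x |-> - x] is available for
    nonnegative integrands, it is applied to [expR (- `|x|) * (1 + sin (z *
    x))]. *)
Lemma Rintegral_laplace_sin z :
  \int[mu]_x (expR (- `|x|) * sin (z * x)) = 0.
Proof.
have cs : continuous (fun x => sin (z * x)).
  by move=> x; apply: continuous_comp; [exact: mulrl_continuous|exact: continuous_sin].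
set f := fun x => expR (- `|x|) * sin (z * x).
have If : mu.-integrable setT (EFin \o f).
  by apply: integrable_laplaceM => // x; exact: sin_max.
have If2 : mu.-integrable setT (EFin \o (fun x : R => expR (- `|x|) + f x)).
  by apply: (integrableD _ integrable_laplace If).
have mf := measurable_int _ If2.
have H : \int[mu]_x (expR (- `|x|) + f x) = \int[mu]_x (expR (- `|x|) - f x).
  rewrite /Rintegral -(@ge0_integral_opp (fun x => (expR (- `|x|) + f x)%:E))//.
    by congr fine; apply: eq_integral => x _; rewrite /f normrN mulrN sinN mulrN.
  move=> x; rewrite lee_fin /f -{1}[expR _]mulr1 -mulrDr.
  by apply: mulr_ge0; [exact: expR_ge0|have := sin_geN1 (z * x); lra].
have := H; rewrite RintegralD// ?RintegralB//; try exact: integrable_laplace.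
by move=> /addrI /eqP; rewrite -subr_eq0 opprK -mulr2n mulrn_eq0 => /eqP.
Qed.
End kernel1.

(** * Dominated integrability and Fubini *)

Section real_integrals.
Context {R : realType}.

Lemma integrable_ge0_lty d (T : measurableType d) (mu : {measure set T -> \bar R})
    (f : T -> R) : measurable_fun setT f -> (forall x, 0 <= f x) ->
  (\int[mu]_x (f x)%:E < +oo)%E -> mu.-integrable setT (EFin \o f).
Proof.
move=> mf f0 foo; apply/integrableP; split; first exact/measurable_EFinP.
by under eq_integral do rewrite /= ger0_norm//.
Qed.

Lemma integrable_dom d (T : measurableType d) (mu : {measure set T -> \bar R})
    (f g : T -> R) : measurable_fun setT f -> (forall x, `|f x| <= g x) ->
  mu.-integrable setT (EFin \o g) -> mu.-integrable setT (EFin \o f).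
Proof.
move=> mf fg; apply: le_integrable => //; first exact/measurable_EFinP.
by move=> x _; rewrite /= lee_fin (le_trans (fg x)) ?ler_norm.
Qed.

Section fubini.
Context d1 d2 (T1 : measurableType d1) (T2 : measurableType d2).
Variables (m1 : {sigma_finite_measure set T1 -> \bar R})
  (m2 : {sigma_finite_measure set T2 -> \bar R}).
Variables (f : T1 * T2 -> R) (g : T1 -> R) (h : T2 -> R).
Hypotheses (mf : measurable_fun setT f) (ig : m1.-integrable setT (EFin \o g))
  (ih : m2.-integrable setT (EFin \o h)) (fgh : forall x y, `|f (x, y)| <= g x * h y).

(** A majorant in product form makes the hypotheses of Fubini's theorem
    immediate, and all the double integrals below have one. *)
Lemma integrable_prod_dom : (m1 \x m2)%E.-integrable setT (EFin \o f).
Proof.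
apply/integrable12ltyP; first exact/measurable_EFinP.
have mg := measurable_int _ ig; have mh := measurable_int _ ih.
apply: (@le_lt_trans _ _ (\int[m1]_x (`|g x|%:E * \int[m2]_y `|h y|%:E))%E).
  apply: ge0_le_integral => //.
  - by move=> x _; apply: integral_ge0.
  - apply: (measurable_fun_fubini_tonelli_F (abse \o (EFin \o f))) => //=.
    by apply: measurableT_comp => //; exact/measurable_EFinP.
  - apply: emeasurable_funM => //.
    by apply/measurable_EFinP; apply: measurableT_comp => //; exact/measurable_EFinP.
  - move=> x _; rewrite -ge0_integralZl//; last first.
      by apply/measurable_EFinP; apply: measurableT_comp => //; exact/measurable_EFinP.
    apply: ge0_le_integral => //.
    + do 2 apply: measurableT_comp => //; apply: measurableT_comp => //.
    + apply: emeasurable_funM => //.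
      by apply/measurable_EFinP; apply: measurableT_comp => //; exact/measurable_EFinP.
    + by move=> y _; rewrite -EFinM lee_fin (le_trans (fgh x y))// -normrM ler_norm.
have Ih : (\int[m2]_y `|h y|%:E < +oo)%E by case/integrableP : ih.
have h0 : (0 <= \int[m2]_y `|h y|%:E)%E by apply: integral_ge0.
rewrite ge0_integralZr//; last first.
  by apply/measurable_EFinP; apply: measurableT_comp => //; exact/measurable_EFinP.
apply: lte_mul_pinfty => //; first exact: integral_ge0.
  by rewrite ge0_fin_numE//; [by case/integrableP : ig|exact: integral_ge0].
Qed.

Let fin1 x : (\int[m2]_y (f (x, y))%:E)%E \is a fin_num.
Proof.
apply: integrable_fin_num => //.
apply: (@integrable_dom _ _ _ (fun y => f (x, y)) (fun y => g x * h y)).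
- exact: measurableT_comp mf (measurable_pair1 _).
- by move=> y.
- exact: (integrableZl _ (g x) ih).
Qed.

Let fin2 y : (\int[m1]_x (f (x, y))%:E)%E \is a fin_num.
Proof.
apply: integrable_fin_num => //.
apply: (@integrable_dom _ _ _ (fun x => f (x, y)) (fun x => g x * h y)).
- exact: measurableT_comp mf (measurable_pair2 _).
- by move=> x.
- exact: (integrableZr _ (h y) ig).
Qed.

Lemma Rintegral_prod_dom :
  \int[(m1 \x m2)%E]_z f z = \int[m1]_x \int[m2]_y f (x, y).
Proof.
rewrite /Rintegral; congr fine.
rewrite -(integral12_prod_meas1 integrable_prod_dom).
by apply: eq_integral => x _; rewrite /fubini_F/= fineK.
Qed.

Lemma Rintegral_fubini_dom :
  \int[m1]_x \int[m2]_y f (x, y) = \int[m2]_y \int[m1]_x f (x, y).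
Proof.
rewrite /Rintegral; congr fine.
transitivity (\int[m1]_x \int[m2]_y (f (x, y))%:E)%E.
  by apply: eq_integral => x _; rewrite fineK.
rewrite (Fubini integrable_prod_dom).
by apply: eq_integral => y _; rewrite fineK.
Qed.

End fubini.
End real_integrals.

(** * Product kernels on row vectors *)

Section rV_integrals.
Context {R : realType}.
Notation mu := (@lebesgue_measure R).

Lemma integrable_affine n (a : 'rV[R]_n) (r : R) (f : 'rV[R]_n -> R) : 0 < r ->
  (lebesgue_rV n).-integrable setT (EFin \o f) ->
  (lebesgue_rV n).-integrable setT (EFin \o (fun x => f (a + r *: x))).
Proof.
move=> r0 /integrableP[mf foo]; apply/integrableP; split.
  exact: measurableT_comp mf (measurable_affine a r).
have -> : (\int[lebesgue_rV n]_x `|(EFin \o (fun x => f (a + r *: x)%R)) x| =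
    (r ^- n)%:E * \int[lebesgue_rV n]_x `|(EFin \o f) x|)%E.
  by rewrite -(ge0_integral_affine a r0)//; exact: measurableT_comp.
by rewrite lte_mul_pinfty// ?lee_fin ?invr_ge0 ?exprn_ge0 ?ltW.
Qed.

(** Reduction to the nonnegative case through positive and negative parts. *)
Lemma Rintegral_affine n (a : 'rV[R]_n) (r : R) (f : 'rV[R]_n -> R) : 0 < r ->
  (lebesgue_rV n).-integrable setT (EFin \o f) ->
  \int[lebesgue_rV n]_x f (a + r *: x) = r ^- n * \int[lebesgue_rV n]_x f x.
Proof.
move=> r0 If; have Ia := integrable_affine a r0 If.
have mf := measurable_int _ If.
rewrite /Rintegral; transitivity (fine ((r ^- n)%:E * \int[lebesgue_rV n]_x (f x)%:E)%E).
  congr fine; rewrite integralE [in RHS]integralE.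
  transitivity (\int[lebesgue_rV n]_x ((EFin \o f)^\+ (a + r *: x)%R)
    - \int[lebesgue_rV n]_x ((EFin \o f)^\- (a + r *: x)%R))%E.
    by congr (_ - _)%E; apply: eq_integral => x _; rewrite ?funeposE ?funenegE.
  have mp : measurable_fun setT ((EFin \o f)^\+)%E by exact: measurable_funepos.
  have mn : measurable_fun setT ((EFin \o f)^\-)%E by exact: measurable_funeneg.
  rewrite (ge0_integral_affine a r0 mp)// (ge0_integral_affine a r0 mn)//.
  apply/esym; apply: (muleBr (x := (r ^- n)%:E)) => //.
  apply: fin_num_adde_defl; rewrite fin_numN.
  exact: integrable_fin_num (integrable_funeneg measurableT If).
by rewrite fineM//; exact: integrable_fin_num.
Qed.

Definition tailV n (x : 'rV[R]_n.+1) : 'rV[R]_n := \row_i x 0 (lift ord0 i).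

Lemma integral_rVS_prod n (a : R -> R) (b : 'rV[R]_n -> R) :
  mu.-integrable setT (EFin \o a) ->
  (lebesgue_rV n).-integrable setT (EFin \o b) ->
  (lebesgue_rV n.+1).-integrable setT (EFin \o (fun x : 'rV[R]_n.+1 => a (x 0 0) * b (tailV x))) /\
  \int[lebesgue_rV n.+1]_x (a (x 0 0) * b (tailV x)) =
    \int[mu]_t a t * \int[lebesgue_rV n]_y b y.
Proof.
move=> Ia Ib; set f := fun x => _.
have ma : measurable_fun setT a by apply/measurable_EFinP; exact: measurable_int Ia.
have mb : measurable_fun setT b by apply/measurable_EFinP; exact: measurable_int Ib.
have mf : measurable_fun setT f.
  apply: measurable_funM.
    exact: measurableT_comp ma (measurable_coord _).
  apply: measurableT_comp mb _.
  apply/measurable_fun_rVP => i; under eq_fun do rewrite mxE.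
  exact: measurable_coord.
have fE p : f (consrV p) = a p.1 * b p.2.
  rewrite /f consrV0; congr (_ * b _); apply/rowP => i.
  by rewrite mxE consrVS.
have mc := @measurable_consrV R n.
have mF : measurable_fun setT (f \o @consrV R n) by apply: measurableT_comp mf mc.
have na := integrable_norm Ia; have nb := integrable_norm Ib.
have IF : (mu \x lebesgue_rV n)%E.-integrable setT (EFin \o (f \o @consrV R n)).
  refine (@integrable_prod_dom R _ _ _ _ (@lebesgue_measure R) (lebesgue_rV n)
    _ _ _ mF na nb _) => // x y.
  by rewrite /= fE normrM.
have mEf : measurable_fun setT (EFin \o f) by exact/measurable_EFinP.
split; first exact: (integrable_pushforward mc mEf IF).
transitivity (\int[(mu \x lebesgue_rV n)%E]_z (f \o @consrV R n) z).
  rewrite /Rintegral; congr fine.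
  exact: (integral_pushforward mc mEf IF measurableT).
rewrite (_ : \int[(mu \x lebesgue_rV n)%E]_z _ = \int[mu]_t \int[lebesgue_rV n]_y (f \o @consrV R n) (t, y)); last first.
  refine (@Rintegral_prod_dom R _ _ _ _ (@lebesgue_measure R) (lebesgue_rV n)
    _ _ _ mF na nb _) => // x y.
  by rewrite /= fE normrM.
rewrite -RintegralZr//; apply: eq_Rintegral => t _.
rewrite -RintegralZl//; apply: eq_Rintegral => y _.
by rewrite /= fE.
Qed.

Lemma Rintegral_rV0 (b : 'rV[R]_0 -> R) :
  (lebesgue_rV 0).-integrable setT (EFin \o b) /\
  \int[lebesgue_rV 0]_x b x = b 0.
Proof.
have mb : measurable_fun setT (EFin \o b).
  have -> : EFin \o b = cst (b 0)%:E; last exact: measurable_cst.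
  by apply/funext => x /=; congr (b _)%:E; apply/rowP => -[].
split.
  apply/integrableP; split=> //.
  rewrite integral_dirac// ?diracT ?mul1e ?ltry//.
  exact: measurableT_comp.
by rewrite /Rintegral integral_dirac// diracT mul1e.
Qed.

Lemma integral_prod_rV n (f : R -> R) : mu.-integrable setT (EFin \o f) ->
  (lebesgue_rV n).-integrable setT (EFin \o (fun x : 'rV[R]_n => \prod_i f (x 0 i))) /\
  \int[lebesgue_rV n]_x (\prod_i f (x 0 i)) = (\int[mu]_t f t) ^+ n.
Proof.
move=> If; elim: n => [|n [I1 I2]].
  have [H1 H2] := Rintegral_rV0 (fun x : 'rV[R]_0 => \prod_i f (x 0 i)).
  by split => //; rewrite H2 big_ord0.
have [J1 J2] := integral_rVS_prod If I1.
have E : (fun x : 'rV[R]_n.+1 => \prod_i f (x 0 i)) =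
    fun x => f (x 0 0) * \prod_i f (tailV x 0 i).
  by apply/funext => x; rewrite big_ord_recl; congr (_ * _); apply: eq_bigr => i _; rewrite mxE.
by rewrite E; split => //; rewrite J2 I2 exprS.
Qed.

(** Up to the factor [2^n] this is the Fourier transform of [laplaceV]; it
    also serves as an integrable majorant of the weights [(1 + enorm x) ^-
    n.*2]. *)
Definition cauchyV n (x : 'rV[R]_n) : R := \prod_i (1 + (x 0 i) ^+ 2)^-1.

Lemma integrable_inv1Dsqr : mu.-integrable setT (EFin \o (fun x : R => (1 + x ^+ 2)^-1)).
Proof.
apply: integrable_ge0_lty.
- apply: continuous_measurable_fun; exact: continuous_inv1Dsqr.
- by move=> x; exact/ltW/inv1Dsqr_gt0.
- by rewrite integral_inv1Dsqr ltry.
Qed.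

Lemma integrable_cauchyV n : (lebesgue_rV n).-integrable setT (EFin \o @cauchyV n).
Proof. by case: (integral_prod_rV n integrable_inv1Dsqr). Qed.

Lemma Rintegral_cauchyV n : \int[lebesgue_rV n]_x cauchyV x = pi ^+ n.
Proof.
rewrite /cauchyV; case: (integral_prod_rV n integrable_inv1Dsqr) => _ ->.
by rewrite /Rintegral integral_inv1Dsqr.
Qed.

Definition laplaceV n (x : 'rV[R]_n) : R := \prod_i expR (- `|x 0 i|).

Lemma integrable_laplaceV n : (lebesgue_rV n).-integrable setT (EFin \o @laplaceV n).
Proof. by case: (integral_prod_rV n integrable_laplace). Qed.

Lemma dotp_recl n (x z : 'rV[R]_n.+1) :
  dotp x z = z 0 0 * x 0 0 + dotp (tailV x) (tailV z).
Proof.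
rewrite /dotp big_ord_recl mulrC; congr (_ + _).
by apply: eq_bigr => i _; rewrite !mxE.
Qed.

Lemma laplaceV_recl n (x : 'rV[R]_n.+1) :
  laplaceV x = expR (- `|x 0 0|) * laplaceV (tailV x).
Proof.
rewrite /laplaceV big_ord_recl; congr (_ * _).
by apply: eq_bigr => i _; rewrite mxE.
Qed.

Let icn (z : R) : mu.-integrable setT (EFin \o (fun x : R => expR (- `|x|) * cos (z * x))).
Proof.
apply: integrable_laplaceM => [x|x]; last exact: cos_max.
by apply: continuous_comp; [exact: mulrl_continuous|exact: continuous_cos].
Qed.

Let isn (z : R) : mu.-integrable setT (EFin \o (fun x : R => expR (- `|x|) * sin (z * x))).
Proof.
apply: integrable_laplaceM => [x|x]; last exact: sin_max.
by apply: continuous_comp; [exact: mulrl_continuous|exact: continuous_sin].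
Qed.

(** Induction on [n]: the addition formulas split [cos] and [sin] of [dotp x
    z] into products of a function of the first coordinate and one of the
    others. *)
Lemma fourier_laplaceV n (z : 'rV[R]_n) :
  [/\ (lebesgue_rV n).-integrable setT (EFin \o (fun x => laplaceV x * cos (dotp x z))),
   (lebesgue_rV n).-integrable setT (EFin \o (fun x => laplaceV x * sin (dotp x z))),
  \int[lebesgue_rV n]_x (laplaceV x * cos (dotp x z)) = 2 ^+ n * cauchyV z &
  \int[lebesgue_rV n]_x (laplaceV x * sin (dotp x z)) = 0].
Proof.
elim: n z => [|n IH] z.
  split; try exact: (Rintegral_rV0 _).1; rewrite (Rintegral_rV0 _).2.
    by rewrite /laplaceV /cauchyV /dotp !big_ord0 cos0 expr0.
  by rewrite /dotp big_ord0 sin0 mulr0.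
have [c1 s1 c2 s2] := IH (tailV z).
have [cc1 cc2] := integral_rVS_prod (icn (z 0 0)) c1.
have [ss1 ss2] := integral_rVS_prod (isn (z 0 0)) s1.
have [sc1 sc2] := integral_rVS_prod (isn (z 0 0)) c1.
have [cs1 cs2] := integral_rVS_prod (icn (z 0 0)) s1.
have Ec : (fun x : 'rV[R]_n.+1 => laplaceV x * cos (dotp x z)) = fun x =>
    expR (- `|x 0 0|) * cos (z 0 0 * x 0 0) * (laplaceV (tailV x) * cos (dotp (tailV x) (tailV z)))
  - expR (- `|x 0 0|) * sin (z 0 0 * x 0 0) * (laplaceV (tailV x) * sin (dotp (tailV x) (tailV z))).
  by apply/funext => x; rewrite dotp_recl cosD laplaceV_recl; ring.
have Es : (fun x : 'rV[R]_n.+1 => laplaceV x * sin (dotp x z)) = fun x =>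
    expR (- `|x 0 0|) * sin (z 0 0 * x 0 0) * (laplaceV (tailV x) * cos (dotp (tailV x) (tailV z)))
  + expR (- `|x 0 0|) * cos (z 0 0 * x 0 0) * (laplaceV (tailV x) * sin (dotp (tailV x) (tailV z))).
  by apply/funext => x; rewrite dotp_recl sinD laplaceV_recl; ring.
rewrite Ec Es; split.
- exact: (integrableB measurableT cc1 ss1).
- exact: (integrableD measurableT sc1 cs1).
- rewrite RintegralB// cc2 ss2 s2 mulr0 subr0 c2 Rintegral_laplace_cos.
  rewrite /cauchyV big_ord_recl.
  set p := \prod_i _; set q := \prod_i _.
  have -> : p = q by apply: eq_bigr => i _; rewrite mxE.
  by rewrite [2 ^+ n.+1]exprS; ring.
- by rewrite RintegralD// sc2 cs2 s2 Rintegral_laplace_sin mul0r mulr0 addr0.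
Qed.

End rV_integrals.

(** * Complex numbers and componentwise convergence *)

Section complex_facts.
Context {R : realType}.
Implicit Types (z w : R[i]) (s t : R).

Lemma normc_ge0 z : 0 <= normc z.
Proof. by case: z => a b; exact: sqrtr_ge0. Qed.

Lemma cReD z w : complex.Re (z + w) = complex.Re z + complex.Re w.
Proof. by case: z w => [a b] [c d]. Qed.

Lemma cImD z w : complex.Im (z + w) = complex.Im z + complex.Im w.
Proof. by case: z w => [a b] [c d]. Qed.

Lemma cReN z : complex.Re (- z) = - complex.Re z.
Proof. by case: z. Qed.

Lemma cImN z : complex.Im (- z) = - complex.Im z.
Proof. by case: z. Qed.

Lemma cReM z w : complex.Re (z * w) =
  complex.Re z * complex.Re w - complex.Im z * complex.Im w.
Proof. by case: z w => [a b] [c d]. Qed.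

Lemma cImM z w : complex.Im (z * w) =
  complex.Re z * complex.Im w + complex.Im z * complex.Re w.
Proof. by case: z w => [a b] [c d]. Qed.

(** Componentwise equality in the form in which it is applied backwards. *)
Lemma complex_eqP z w :
  complex.Re z = complex.Re w -> complex.Im z = complex.Im w -> z = w.
Proof. by case: z w => [a b] [c d] /= -> ->. Qed.

Lemma normc_Re z : `|complex.Re z| <= normc z.
Proof. by case: z => a b /=; rewrite -sqrtr_sqr ler_wsqrtr// lerDl sqr_ge0. Qed.

Lemma normc_Im z : `|complex.Im z| <= normc z.
Proof. by case: z => a b /=; rewrite -sqrtr_sqr ler_wsqrtr// lerDr sqr_ge0. Qed.

Lemma normc_leD z : normc z <= `|complex.Re z| + `|complex.Im z|.
Proof.
case: z => a b /=; rewrite -[leRHS]ger0_norm ?addr_ge0// -sqrtr_sqr.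
rewrite ler_wsqrtr// sqrrD !real_normK ?num_real//.
by rewrite addrAC lerDl mulrn_wge0// mulr_ge0.
Qed.

Lemma ler_normcD z w : normc (z + w) <= normc z + normc w.
Proof. exact: complex.le_normcD. Qed.

Lemma normc_opp z : normc (- z) = normc z.
Proof. by case: z => a b /=; rewrite !sqrrN. Qed.

Lemma normc_eq0 z : (normc z == 0) = (z == 0).
Proof. by apply/eqP/eqP => [/eq0_normc//|->]; rewrite normc0. Qed.

Lemma normcR s : normc s%:C%C = `|s|.
Proof. by rewrite /= expr0n/= addr0 sqrtr_sqr. Qed.

Lemma le_normc_sum I (r : seq I) (P : pred I) (f : I -> R[i]) :
  normc (\sum_(i <- r | P i) f i) <= \sum_(i <- r | P i) normc (f i).
Proof.
elim/big_rec2: _ => [|i y x _ H]; first by rewrite normc0.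
by rewrite (le_trans (ler_normcD _ _))// lerD2l.
Qed.

Lemma ler_dist_normc z w : `|normc z - normc w| <= normc (z - w).
Proof.
rewrite ler_norml; apply/andP; split.
  have := ler_normcD z (w - z); rewrite addrC subrK -[w - z]opprB normc_opp.
  by move=> h; rewrite lerNl opprB lerBlDr addrC.
by have := ler_normcD (z - w) w; rewrite subrK => h; rewrite lerBlDr.
Qed.

Lemma conjcM z w : conjc (z * w) = conjc z * conjc w.
Proof. by rewrite rmorphM. Qed.

Lemma normc_conj z : normc (conjc z) = normc z.
Proof. by case: z => a b /=; rewrite sqrrN. Qed.

Lemma mulc_conj z : z * conjc z = (normc z ^+ 2)%:C%C.
Proof.
case: z => a b; apply: complex_eqP; rewrite /= ?cReM ?cImM/=.
  by rewrite sqr_sqrtr ?addr_ge0 ?sqr_ge0// mulrN opprK !expr2.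
by rewrite mulrN mulrC addNr.
Qed.

Lemma expi0 : expi 0 = 1 :> R[i].
Proof. by rewrite /expi cos0 sin0. Qed.

Lemma expiD s t : expi (s + t) = expi s * expi t.
Proof.
by apply: complex_eqP; rewrite ?cReM ?cImM /= ?cosD ?sinD// [LHS]addrC.
Qed.

Lemma normc_expi t : normc (expi t) = 1.
Proof. by rewrite /= cos2Dsin2 sqrtr1. Qed.

Lemma conj_expi t : conjc (expi t) = expi (- t).
Proof. by rewrite /expi cosN sinN. Qed.

(** The convergence that [climn] computes the limit of. *)
Definition ccvg (u : nat -> R[i]) (l : R[i]) : Prop :=
  ((fun N => complex.Re (u N)) @ \oo --> complex.Re l) /\
  ((fun N => complex.Im (u N)) @ \oo --> complex.Im l).

Implicit Types u : nat -> R[i].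

Lemma ccvg_climn u l : ccvg u l -> climn u = l.
Proof. by case=> h1 h2; apply: complex_eqP => /=; exact: cvg_lim. Qed.

Lemma ccvg_unique u l l' : ccvg u l -> ccvg u l' -> l = l'.
Proof. by move=> /ccvg_climn <- /ccvg_climn. Qed.

Lemma ccvg_cst c : ccvg (fun=> c) c.
Proof. by split; exact: cvg_cst. Qed.

Lemma ccvgD u1 u2 l1 l2 : ccvg u1 l1 -> ccvg u2 l2 ->
  ccvg (fun N => u1 N + u2 N) (l1 + l2).
Proof.
move=> [a1 b1] [a2 b2]; split.
  by rewrite cReD; under eq_fun do rewrite cReD; exact: cvgD.
by rewrite cImD; under eq_fun do rewrite cImD; exact: cvgD.
Qed.

Lemma ccvgM u1 u2 l1 l2 : ccvg u1 l1 -> ccvg u2 l2 ->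
  ccvg (fun N => u1 N * u2 N) (l1 * l2).
Proof.
move=> [a1 b1] [a2 b2]; split.
  by rewrite cReM; under eq_fun do rewrite cReM; apply: cvgB; exact: cvgM.
by rewrite cImM; under eq_fun do rewrite cImM; apply: cvgD; exact: cvgM.
Qed.

Lemma ccvg_near u u' l : (\forall N \near \oo, u N = u' N) -> ccvg u l -> ccvg u' l.
Proof.
move=> h [a b]; split.
  by apply: cvg_trans a; apply: near_eq_cvg; near=> N; rewrite (near h N).
by apply: cvg_trans b; apply: near_eq_cvg; near=> N; rewrite (near h N).
Unshelve. all: by end_near. Qed.

Lemma ccvgP u l : ccvg u l <-> (fun N => normc (u N - l)) @ \oo --> 0.
Proof.
split=> [[a b]|h].
  have H : (fun N => `|complex.Re (u N) - complex.Re l| + `|complex.Im (u N) - complex.Im l|)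
      @ \oo --> (0 : R).
    rewrite -[X in _ --> X](addr0 0); apply: cvgD; apply/norm_cvg0P; exact/subr_cvg0.
  apply: squeeze_cvgr (cvg_cst 0) H; apply: nearW => N.
  by rewrite normc_ge0/= (le_trans (normc_leD _))// cReD cImD cReN cImN.
split; apply/subr_cvg0/norm_cvg0P; apply: squeeze_cvgr (cvg_cst 0) h; apply: nearW => N.
  by rewrite normr_ge0/= -cReN -cReD normc_Re.
by rewrite normr_ge0/= -cImN -cImD normc_Im.
Qed.

Lemma ccvg_squeeze u l (e : nat -> R) : (forall N, normc (u N - l) <= e N) ->
  e @ \oo --> 0 -> ccvg u l.
Proof.
move=> h e0; apply/ccvgP; apply: squeeze_cvgr (cvg_cst 0) e0.
by apply: nearW => N; rewrite normc_ge0 h.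
Qed.

Lemma ccvg_normc u l : ccvg u l -> (fun N => normc (u N)) @ \oo --> normc l.
Proof.
move=> /ccvgP h; apply/subr_cvg0/norm_cvg0P; apply: squeeze_cvgr (cvg_cst 0) h.
by apply: nearW => N; rewrite normr_ge0 ler_dist_normc.
Qed.

Lemma ccvg_le u l B : (forall N, normc (u N) <= B) -> ccvg u l -> normc l <= B.
Proof.
move=> h /ccvg_normc ul; rewrite -(cvg_lim (@Rhausdorff R) ul).
by apply: limr_le; [exact: cvgP ul|exact: nearW].
Qed.

(** Every series below is controlled by a geometric majorant; this gives both
    its convergence and a bound for its sum. *)
Lemma ccvg_geometric (a : nat -> R[i]) B :
  (forall j, (0 < j)%N -> normc (a j) <= B * 2 ^- j) ->
  exists2 l, ccvg (fun N => \sum_(1 <= j < N.+1) a j) l & normc l <= B.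
Proof.
move=> h.
have B0 : 0 <= B.
  have := le_trans (normc_ge0 _) (h 1%N isT).
  by rewrite pmulr_lge0// invr_gt0 exprn_gt0.
have geo : cvgn (series (geometric (B / 2) 2^-1)).
  by apply: is_cvg_geometric_series; rewrite ger0_norm// invf_lt1// ltr1n.
have S (g : R[i] -> R) : (forall z, `|g z| <= normc z) ->
    cvgn (series (fun j => g (a j.+1))).
  move=> gz; apply: normed_cvg; apply: series_le_cvg geo => j.
  - exact: normr_ge0.
  - by rewrite /geometric/= mulr_ge0 ?divr_ge0 ?exprn_ge0 ?invr_ge0.
  - rewrite /geometric/= (le_trans (gz _))// (le_trans (h _ _))//.
    by rewrite -exprVn exprS mulrA.
have E N : \sum_(1 <= j < N.+1) a j = \sum_(0 <= j < N) a j.+1.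
  by rewrite big_add1.
have SR : (fun N => complex.Re (\sum_(1 <= j < N.+1) a j)) = series (fun j => complex.Re (a j.+1)).
  apply/funext => N; rewrite E /series/=.
  exact: (big_morph (@complex.Re R) cReD erefl).
have SI : (fun N => complex.Im (\sum_(1 <= j < N.+1) a j)) = series (fun j => complex.Im (a j.+1)).
  apply/funext => N; rewrite E /series/=.
  exact: (big_morph (@complex.Im R) cImD erefl).
pose l : R[i] := Complex (limn (series (fun j => complex.Re (a j.+1))))
  (limn (series (fun j => complex.Im (a j.+1)))).
have ul : ccvg (fun N => \sum_(1 <= j < N.+1) a j) l.
  by rewrite /ccvg SR SI; split; [exact: S normc_Re|exact: S normc_Im].
exists l => //; apply: ccvg_le ul => N; rewrite E.
rewrite (le_trans (le_normc_sum _ _ _))//.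
have : \sum_(0 <= j < N) normc (a j.+1) <= B * (1 - 2 ^- N).
  elim: N => [|N IH]; first by rewrite big_nil expr0 invr1 subrr mulr0.
  rewrite big_nat_recr//= (le_trans (lerD IH (h _ _)))//.
  rewrite -mulrDr ler_wpM2l// exprS invfM.
  by move: (_ ^- N) => x; lra.
move/le_trans; apply; rewrite ler_piMr// gerBl invr_ge0 exprn_ge0//.
Qed.

End complex_facts.

(** * Euclidean norm and polynomial weights *)

Section euclid.
Context {R : realType} {n : nat}.
Implicit Types (x y z : 'rV[R]_n) (a b r : R).

Lemma dotpC x y : dotp x y = dotp y x.
Proof. by apply: eq_bigr => i _; rewrite mulrC. Qed.

Lemma dotpDl x y z : dotp (x + y) z = dotp x z + dotp y z.
Proof. by rewrite -big_split; apply: eq_bigr => i _; rewrite mxE mulrDl. Qed.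

Lemma dotpZl a x y : dotp (a *: x) y = a * dotp x y.
Proof. by rewrite mulr_sumr; apply: eq_bigr => i _; rewrite mxE mulrA. Qed.

Lemma dotpDr x y z : dotp z (x + y) = dotp z x + dotp z y.
Proof. by rewrite dotpC dotpDl !(dotpC z). Qed.

Lemma dotpZr a x y : dotp y (a *: x) = a * dotp y x.
Proof. by rewrite dotpC dotpZl (dotpC y). Qed.

Lemma dotpNl x y : dotp (- x) y = - dotp x y.
Proof. by rewrite -scaleN1r dotpZl mulN1r. Qed.

Lemma dotpNr x y : dotp y (- x) = - dotp y x.
Proof. by rewrite dotpC dotpNl (dotpC y). Qed.

Lemma dotp0l x : dotp 0 x = 0.
Proof. by rewrite -(scale0r 0) dotpZl mul0r. Qed.

Lemma dotp_ge0 x : 0 <= dotp x x.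
Proof. by apply: sumr_ge0 => i _; rewrite -expr2 sqr_ge0. Qed.

Lemma dotp_eq0 x : dotp x x = 0 -> x = 0.
Proof.
move=> /eqP; rewrite psumr_eq0 => [/allP h|i _]; last by rewrite -expr2 sqr_ge0.
apply/rowP => i; have := h i; rewrite mem_index_enum => /(_ isT).
by rewrite mxE mulf_eq0 orbb => /eqP.
Qed.

Lemma enorm_ge0 x : 0 <= enorm x. Proof. exact: sqrtr_ge0. Qed.

Lemma enorm_sqr x : enorm x ^+ 2 = dotp x x.
Proof. by rewrite sqr_sqrtr// dotp_ge0. Qed.

Lemma enorm0 : enorm (0 : 'rV[R]_n) = 0.
Proof. by rewrite /enorm dotp0l sqrtr0. Qed.

Lemma enorm_eq0 x : enorm x = 0 -> x = 0.
Proof. by move=> h; apply: dotp_eq0; rewrite -enorm_sqr h expr0n. Qed.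

Lemma enormZ a x : enorm (a *: x) = `|a| * enorm x.
Proof.
by rewrite /enorm dotpZl dotpZr mulrA -expr2 sqrtrM ?sqr_ge0// sqrtr_sqr.
Qed.

Lemma enormN x : enorm (- x) = enorm x.
Proof. by rewrite -scaleN1r enormZ normrN1 mul1r. Qed.

Lemma enorm_distC x y : enorm (x - y) = enorm (y - x).
Proof. by rewrite -enormN opprB. Qed.

Lemma cauchy_schwarz x y : dotp x y <= enorm x * enorm y.
Proof.
have [y0|y0] := eqVneq (dotp y y) 0.
  by rewrite (dotp_eq0 y0) dotpC dotp0l mulr_ge0 ?enorm_ge0.
have yy : 0 < dotp y y by rewrite lt_neqAle eq_sym y0 dotp_ge0.
have := dotp_ge0 (dotp y y *: x - dotp x y *: y).
rewrite !(dotpDl, dotpDr, dotpNl, dotpNr, dotpZl, dotpZr) (dotpC y x).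
rewrite (_ : _ + _ = dotp y y * (dotp x x * dotp y y - dotp x y ^+ 2)); last by ring.
rewrite pmulr_rge0// subr_ge0 -!enorm_sqr -exprMn => h.
rewrite (le_trans (ler_norm _))// -ler_sqr ?nnegrE ?normr_ge0 ?mulr_ge0 ?enorm_ge0//.
by rewrite real_normK ?num_real.
Qed.

Lemma normr_dotp x y : `|dotp x y| <= enorm x * enorm y.
Proof.
rewrite ler_norml cauchy_schwarz andbT lerNl -dotpNl.
by rewrite -[enorm x]enormN cauchy_schwarz.
Qed.

Lemma enormD x y : enorm (x + y) <= enorm x + enorm y.
Proof.
rewrite -ler_sqr ?nnegrE ?addr_ge0 ?enorm_ge0// enorm_sqr sqrrD !enorm_sqr.
rewrite !(dotpDl, dotpDr) (dotpC y x); have := cauchy_schwarz x y; lra.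
Qed.

Lemma normr_coord_enorm x i : `|x 0 i| <= enorm x.
Proof.
rewrite -sqrtr_sqr ler_wsqrtr// /dotp (bigD1 i)//= expr2 lerDl.
by apply: sumr_ge0 => j _; rewrite -expr2 sqr_ge0.
Qed.

Lemma enorm_le_sum x : enorm x <= \sum_i `|x 0 i|.
Proof.
have s0 : 0 <= \sum_i `|x 0 i| by apply: sumr_ge0.
rewrite -[leRHS]ger0_norm// -sqrtr_sqr ler_wsqrtr// expr2 mulr_suml.
apply: ler_sum => i _; rewrite (le_trans (ler_norm _))// normrM ler_wpM2l//.
by rewrite (bigD1 i)//= lerDl sumr_ge0.
Qed.

Lemma norm_le_enorm x : `|x| <= enorm x.
Proof.
rewrite /Num.norm/= mx_normrE; apply/bigmax_leP; split => [|[i j] _ /=].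
  exact: enorm_ge0.
by rewrite ord1 normr_coord_enorm.
Qed.

Lemma enorm_le_norm x : enorm x <= n%:R * `|x|.
Proof.
rewrite (le_trans (enorm_le_sum x))//.
rewrite mulr_natl -[X in _ *+ X]card_ord -sumr_const ler_sum// => i _.
rewrite [leRHS]/Num.norm/= mx_normrE.
exact: (le_bigmax _ (fun p : 'I_1 * 'I_n => `|x p.1 p.2|) (0, i)).
Qed.

(** Peetre's inequality: translations change polynomial weights by bounded
    factors. *)
Lemma peetre x y : 1 + enorm (x + y) <= (1 + enorm x) * (1 + enorm y).
Proof.
have := enormD x y; have := enorm_ge0 x; have := enorm_ge0 y.
have := mulr_ge0 (enorm_ge0 x) (enorm_ge0 y).
move: (enorm (x + y)) (enorm x) (enorm y) => a b c; nra.
Qed.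

Lemma enorm1_gt0 x : 0 < 1 + enorm x.
Proof. by rewrite ltr_pwDl// enorm_ge0. Qed.

Lemma enorm1_ge1 x : 1 <= 1 + enorm x.
Proof. by rewrite lerDl enorm_ge0. Qed.

Let continuous_sum (f : 'I_n -> 'rV[R]_n -> R) : (forall i, continuous (f i)) ->
  continuous (fun x => \sum_i f i x).
Proof.
move=> cf; elim: (index_enum _) => [|i s IH].
  rewrite (_ : (fun x => _) = cst 0); first exact: cst_continuous.
  by apply/funext => y; rewrite big_nil.
rewrite (_ : (fun x => _) = f i \+ (fun x => \sum_(j <- s) f j x)).
  by move=> x; apply: continuousD; [exact: cf|exact: IH].
by apply/funext => y; rewrite big_cons.
Qed.

Lemma dotp_continuous_l y : continuous (fun x => dotp x y).
Proof.
apply: continuous_sum => i x; apply: continuousM; last exact: cst_continuous.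
exact: coord_continuous.
Qed.

Lemma enorm_continuous : continuous (fun x : 'rV[R]_n => enorm x).
Proof.
move=> x; apply: (@continuous_comp _ _ _ (fun x => dotp x x) (@Num.sqrt R)); last exact: sqrt_continuous.
apply: continuous_sum => i z; apply: continuousM; exact: coord_continuous.
Qed.

(** Each factor satisfies [1 + x_i^2 <= (1 + enorm x)^2]; this is the origin
    of the exponent [2n] in the integrable weights. *)
Lemma weight_le_cauchyV x : (1 + enorm x) ^- n.*2 <= cauchyV x.
Proof.
rewrite /cauchyV -[n.*2]muln2 mulnC exprM.
rewrite -[X in _ ^- X](card_ord n) -prodr_const -prodfV.
apply: ler_prod => i _; rewrite invr_ge0 exprn_ge0 ?(ltW (enorm1_gt0 _))//=.
rewrite lef_pV2 ?posrE ?exprn_gt0 ?enorm1_gt0 ?ltr_pwDl ?sqr_ge0//.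
rewrite sqrrD expr1n mul1r -addrA lerD2l ler_wpDl ?mulrn_wge0 ?enorm_ge0//.
by rewrite -[leLHS]real_normK ?num_real// lerXn2r ?nnegrE ?normr_ge0 ?enorm_ge0// normr_coord_enorm.
Qed.

Lemma enorm1X_continuous m : continuous (fun x : 'rV[R]_n => (1 + enorm x) ^+ m).
Proof.
move=> x; apply: (@continuous_comp _ _ _ (fun x => 1 + enorm x) (fun x : R => x ^+ m)).
  by apply: continuousD; [exact: cst_continuous|exact: enorm_continuous].
exact: exprn_continuous.
Qed.

Lemma weight_continuous m : continuous (fun x : 'rV[R]_n => (1 + enorm x) ^- m).
Proof.
move=> x; apply: (@continuous_comp _ _ _ (fun x => (1 + enorm x) ^+ m) (@GRing.inv R)).
  exact: enorm1X_continuous.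
by apply: inv_continuous; rewrite gt_eqF// exprn_gt0// enorm1_gt0.
Qed.

Lemma weight_ge0 m x : 0 <= (1 + enorm x) ^- m.
Proof. by rewrite invr_ge0 exprn_ge0// ltW// enorm1_gt0. Qed.

Lemma weight_gt0 m x : 0 < (1 + enorm x) ^- m.
Proof. by rewrite invr_gt0 exprn_gt0// enorm1_gt0. Qed.

Lemma le_weight m k x : (m <= k)%N -> (1 + enorm x) ^- k <= (1 + enorm x) ^- m.
Proof.
move=> mk; rewrite lef_pV2 ?posrE ?exprn_gt0 ?enorm1_gt0//.
by rewrite ler_weXn2l// enorm1_ge1.
Qed.

Lemma integrable_weight (m : nat) : (n.*2 <= m)%N ->
  (lebesgue_rV n).-integrable setT (EFin \o (fun x => (1 + enorm x) ^- m)).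
Proof.
move=> nm; apply: integrable_dom (integrable_cauchyV n).
  by apply: continuous_measurable_rV; exact: weight_continuous.
move=> x; rewrite ger0_norm ?weight_ge0//.
exact: le_trans (le_weight _ nm) (weight_le_cauchyV x).
Qed.

End euclid.

(** * Integrals of complex-valued functions *)

Section cint.
Context {R : realType} {n : nat}.
Implicit Types (f g : 'rV[R]_n -> R[i]) (G : 'rV[R]_n -> R) (c : R[i]).
Notation mu := (lebesgue_rV n).
Notation rintegrable G := (mu.-integrable setT (EFin \o G)).

Definition cintegrable f :=
  rintegrable (fun x => complex.Re (f x)) /\ rintegrable (fun x => complex.Im (f x)).

Lemma eq_cint f g : f =1 g -> cint f = cint g.
Proof. by move=> /funext ->. Qed.

Lemma cmeasurable_cst c : cmeasurable (fun=> c : R[i]) (n := n).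
Proof. by split; exact: measurable_cst. Qed.

Lemma cmeasurableD f g : cmeasurable f -> cmeasurable g ->
  cmeasurable (fun x => f x + g x).
Proof.
move=> [f1 f2] [g1 g2]; split.
  by under eq_fun do rewrite cReD; exact: measurable_funD.
by under eq_fun do rewrite cImD; exact: measurable_funD.
Qed.

Lemma cmeasurableM f g : cmeasurable f -> cmeasurable g ->
  cmeasurable (fun x => f x * g x).
Proof.
move=> [f1 f2] [g1 g2]; split.
  by under eq_fun do rewrite cReM; apply: measurable_funB; exact: measurable_funM.
by under eq_fun do rewrite cImM; apply: measurable_funD; exact: measurable_funM.
Qed.

Lemma cmeasurable_normc f : cmeasurable f -> measurable_fun setT (fun x => normc (f x)).
Proof.
move=> [f1 f2].
rewrite (_ : (fun x => _) = fun x => Num.sqrt (complex.Re (f x) ^+ 2 + complex.Im (f x) ^+ 2)).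
  apply: (@measurableT_comp _ _ _ _ _ _ (@Num.sqrt R)).
    by apply: continuous_measurable_fun; exact: sqrt_continuous.
  by apply: measurable_funD; exact: measurable_funX.
by apply/funext => x; case: (f x).
Qed.

Lemma cmeasurable_continuous f : continuous (fun x => complex.Re (f x)) ->
  continuous (fun x => complex.Im (f x)) -> cmeasurable f.
Proof. by move=> h1 h2; split; exact: continuous_measurable_rV. Qed.

Lemma cmeasurable_expi (G : 'rV[R]_n -> R) : continuous G -> cmeasurable (fun x => expi (G x)).
Proof.
move=> cG; apply: cmeasurable_continuous => x /=.
  by apply: (@continuous_comp _ _ _ G (@cos R)); [exact: cG|exact: continuous_cos].
by apply: (@continuous_comp _ _ _ G (@sin R)); [exact: cG|exact: continuous_sin].
Qed.

Lemma cmeasurable_expi_dotp y : cmeasurable (fun x : 'rV[R]_n => expi (- dotp x y)).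
Proof.
apply: cmeasurable_expi => x.
apply: (@continuous_comp _ _ _ (fun x => dotp x y) (@GRing.opp R)).
  exact: dotp_continuous_l.
exact: opp_continuous.
Qed.

Lemma cintegrable_measurable f : cintegrable f -> cmeasurable f.
Proof.
by move=> [/measurable_int f1 /measurable_int f2]; split; exact/measurable_EFinP.
Qed.

Lemma cintegrable_dom f G : cmeasurable f -> (forall x, normc (f x) <= G x) ->
  rintegrable G -> cintegrable f.
Proof.
move=> [f1 f2] fG iG; split; apply: integrable_dom iG => // x.
  by rewrite (le_trans (normc_Re _)).
by rewrite (le_trans (normc_Im _)).
Qed.

Lemma cintegrable_normc f : cintegrable f -> rintegrable (fun x => normc (f x)).
Proof.
move=> If; have mf := cintegrable_measurable If.
case: If => f1 f2.
apply: (@integrable_dom _ _ _ _ _ (fun x => `|complex.Re (f x)| + `|complex.Im (f x)|)).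
- exact: cmeasurable_normc.
- by move=> x; rewrite ger0_norm ?normc_ge0// normc_leD.
- exact: (integrableD measurableT (integrable_norm f1) (integrable_norm f2)).
Qed.

Lemma cintegrableD f g : cintegrable f -> cintegrable g ->
  cintegrable (fun x => f x + g x).
Proof.
move=> [f1 f2] [g1 g2]; split.
  rewrite (_ : (fun x => _) = (fun x => complex.Re (f x)) \+ (fun x => complex.Re (g x))).
    exact: (integrableD measurableT f1 g1).
  by apply/funext => x; rewrite cReD.
rewrite (_ : (fun x => _) = (fun x => complex.Im (f x)) \+ (fun x => complex.Im (g x))).
  exact: (integrableD measurableT f2 g2).
by apply/funext => x; rewrite cImD.
Qed.

Lemma cintD f g : cintegrable f -> cintegrable g ->
  cint (fun x => f x + g x) = cint f + cint g.
Proof.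
move=> [f1 f2] [g1 g2]; apply: complex_eqP; rewrite ?cReD ?cImD/=.
  by rewrite -RintegralD//; apply: eq_Rintegral => x _; rewrite cReD.
by rewrite -RintegralD//; apply: eq_Rintegral => x _; rewrite cImD.
Qed.

Lemma cintegrableZ c f : cintegrable f -> cintegrable (fun x => c * f x).
Proof.
move=> If; apply: (@cintegrable_dom _ (fun x => normc c * normc (f x))).
- apply: cmeasurableM; [exact: cmeasurable_cst|exact: cintegrable_measurable].
- by move=> x; rewrite normcM.
- exact: (integrableZl measurableT (normc c) (cintegrable_normc If)).
Qed.

Lemma cintZ c f : cintegrable f -> cint (fun x => c * f x) = c * cint f.
Proof.
move=> [f1 f2].
have Z (r : R) (h : 'rV[R]_n -> R) : rintegrable h -> rintegrable (fun x => r * h x).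
  by move=> ih; exact: (integrableZl measurableT r ih).
apply: complex_eqP; rewrite ?cReM ?cImM/= -!RintegralZl//.
  rewrite -RintegralB//; [|exact: Z|exact: Z].
  by apply: eq_Rintegral => x _; rewrite cReM.
rewrite -RintegralD//; [|exact: Z|exact: Z].
by apply: eq_Rintegral => x _; rewrite cImM.
Qed.

Lemma cint0 : cint (fun=> 0 : R[i]) (n := n) = 0.
Proof. by rewrite /cint/= /Rintegral integral0. Qed.

Lemma cintegrable0 : cintegrable (fun=> 0).
Proof. by split; exact: integrable0. Qed.

Lemma cintegrable_sum (I : eqType) (s : seq I) (F : I -> 'rV[R]_n -> R[i]) :
  (forall i, i \in s -> cintegrable (F i)) ->
  cintegrable (fun x => \sum_(i <- s) F i x).
Proof.
elim: s => [|i s IH] h.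
  by under eq_fun do rewrite big_nil; exact: cintegrable0.
under eq_fun do rewrite big_cons.
apply: cintegrableD; first by apply: h; rewrite mem_head.
by apply: IH => j js; apply: h; rewrite inE js orbT.
Qed.

Lemma cint_sum (I : eqType) (s : seq I) (F : I -> 'rV[R]_n -> R[i]) :
  (forall i, i \in s -> cintegrable (F i)) ->
  cint (fun x => \sum_(i <- s) F i x) = \sum_(i <- s) cint (F i).
Proof.
elim: s => [|i s IH] h.
  by under eq_cint do rewrite big_nil; rewrite cint0 big_nil.
have h2 : forall j, j \in s -> cintegrable (F j).
  by move=> j js; apply: h; rewrite inE js orbT.
under eq_cint do rewrite big_cons.
rewrite cintD ?big_cons ?IH//; first by apply: h; rewrite mem_head.
exact: cintegrable_sum.
Qed.

(** Real and imaginary parts are estimated separately, hence the factor [2]. *)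
Lemma normc_cint_le f G : cmeasurable f -> (forall x, normc (f x) <= G x) ->
  rintegrable G -> normc (cint f) <= 2 * \int[mu]_x G x.
Proof.
move=> mf fG iG; have [f1 f2] := cintegrable_dom mf fG iG.
rewrite (le_trans (normc_leD _))// mulr_natl mulr2n lerD//=.
  rewrite (le_trans (le_normr_Rintegral measurableT f1))//.
  apply: le_Rintegral => //; first exact: integrable_norm.
  by move=> x _; exact: le_trans (normc_Re _) (fG x).
rewrite (le_trans (le_normr_Rintegral measurableT f2))//.
apply: le_Rintegral => //; first exact: integrable_norm.
by move=> x _; exact: le_trans (normc_Im _) (fG x).
Qed.

Lemma Rintegral_dom_cvg (F : nat -> 'rV[R]_n -> R) (f G : 'rV[R]_n -> R) :
  (forall k, measurable_fun setT (F k)) -> measurable_fun setT f ->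
  (forall x, (fun k => F k x) @ \oo --> f x) -> rintegrable G ->
  (forall k x, `|F k x| <= G x) ->
  (fun k => \int[mu]_x F k x) @ \oo --> \int[mu]_x f x.
Proof.
move=> mF mf Ff iG FG.
have fG x : `|f x| <= G x.
  have nf : (fun k => `|F k x|) @ \oo --> `|f x| by apply: cvg_norm; exact: Ff.
  rewrite -(cvg_lim (@Rhausdorff R) nf); apply: limr_le; first exact: cvgP nf.
  exact: nearW.
have If : rintegrable f by exact: integrable_dom iG.
have H : (\int[mu]_x (F k x)%:E)%E @[k --> \oo] --> (\int[mu]_x (f x)%:E)%E.
  apply: (@dominated_cvg _ _ _ mu setT measurableT (fun k x => (F k x)%:E)
    (fun x => (f x)%:E) (EFin \o G)) => //.
  - by move=> k; exact/measurable_EFinP.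
  - by move=> x _; apply: cvg_EFin; [exact: nearW|exact: Ff].
  - by move=> k x _; rewrite /= lee_fin.
rewrite -(@fineK _ (\int[mu]_x (f x)%:E)%E) in H; last exact: integrable_fin_num If.
by move/fine_cvgP : H => [].
Qed.

Lemma cint_dom_cvg (F : nat -> 'rV[R]_n -> R[i]) f G :
  (forall k, cmeasurable (F k)) -> cmeasurable f ->
  (forall x, ccvg (fun k => F k x) (f x)) -> rintegrable G ->
  (forall k x, normc (F k x) <= G x) ->
  ccvg (fun k => cint (F k)) (cint f).
Proof.
move=> mF mf Ff iG FG; split => /=.
  apply: (Rintegral_dom_cvg _ _ _ iG) => [k||x|k x].
  - by have [] := mF k.
  - by have [] := mf.
  - by have [] := Ff x.
  - by rewrite (le_trans (normc_Re _)).
apply: (Rintegral_dom_cvg _ _ _ iG) => [k||x|k x].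
- by have [] := mF k.
- by have [] := mf.
- by have [] := Ff x.
- by rewrite (le_trans (normc_Im _)).
Qed.

Lemma cint_affine (a : 'rV[R]_n) (r : R) f : 0 < r -> cintegrable f ->
  cint (fun x => f (a + r *: x)) = (r ^- n)%:C%C * cint f.
Proof.
move=> r0 [f1 f2]; apply: complex_eqP; rewrite ?cReM ?cImM/=.
  by rewrite mul0r subr0 -(Rintegral_affine a r0 f1).
by rewrite mul0r addr0 -(Rintegral_affine a r0 f2).
Qed.

Lemma cintegrable_affine (a : 'rV[R]_n) (r : R) f : 0 < r -> cintegrable f ->
  cintegrable (fun x => f (a + r *: x)).
Proof.
by move=> r0 [f1 f2]; split; [exact: integrable_affine f1|exact: integrable_affine f2].
Qed.

Lemma cint_translate (a : 'rV[R]_n) f : cintegrable f ->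
  cint (fun x => f (x + a)) = cint f.
Proof.
move=> If; rewrite -[RHS]mul1r -[1]/((1 : R)%:C%C).
rewrite (_ : 1 = 1 ^- n); last by rewrite expr1n invr1.
rewrite -(cint_affine a ltr01 If).
by apply: eq_cint => x; rewrite scale1r addrC.
Qed.

Lemma cint_fubini (F : 'rV[R]_n * 'rV[R]_n -> R[i]) G H :
  measurable_fun setT (fun z => complex.Re (F z)) ->
  measurable_fun setT (fun z => complex.Im (F z)) ->
  rintegrable G -> rintegrable H -> (forall x y, normc (F (x, y)) <= G x * H y) ->
  cint (fun x => cint (fun y => F (x, y))) = cint (fun y => cint (fun x => F (x, y))).
Proof.
move=> m1 m2 iG iH h; apply: complex_eqP => /=.
  apply: (Rintegral_fubini_dom m1 iG iH) => x y.
  by rewrite (le_trans (normc_Re _)).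
apply: (Rintegral_fubini_dom m2 iG iH) => x y.
by rewrite (le_trans (normc_Im _)).
Qed.

Lemma cint_conj f : cintegrable f -> cint (fun x => conjc (f x)) = conjc (cint f).
Proof.
move=> [f1 f2]; apply: complex_eqP => /=.
  by apply: eq_Rintegral => x _; case: (f x).
rewrite -mulN1r -RintegralZl//; apply: eq_Rintegral => x _.
by rewrite mulN1r; case: (f x).
Qed.

End cint.

(** * Partial derivatives, Schwartz functions and multipliers *)

Section calculus.
Context {R : realType} {n : nat}.
Implicit Types (f g : 'rV[R]_n -> R[i]) (h : 'rV[R]_n -> R) (x a b v : 'rV[R]_n) (c : R[i]).

Definition cdiff f x := differentiable (fun y => complex.Re (f y)) x /\
  differentiable (fun y => complex.Im (f y)) x.

(** Directional derivatives are derivatives of the restriction to a line,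
    which reduces them to calculus in one variable. *)
Lemma derive_line h x v t :
  'D_v h (t *: v + x) = 'D_1 (fun s : R => h (s *: v + x)) t.
Proof.
rewrite /derive (_ : (fun s : R => s^-1 *: ((h \o shift (t *: v + x)) (s *: v) - _)) =
  (fun s => s^-1 *: (((fun s : R => h (s *: v + x)) \o shift t) (s *: 1) -
    h (t *: v + x))))//.
by apply/funext => s /=; rewrite scalerDl addrA [s *: 1]mulr1.
Qed.

Lemma derive_line0 h x v : 'D_v h x = 'D_1 (fun s : R => h (s *: v + x)) 0.
Proof. by rewrite -derive_line scale0r add0r. Qed.

Lemma derive_translate h x v a : 'D_v (fun y => h (y + a)) x = 'D_v h (x + a).
Proof.
rewrite /derive (_ : (fun s : R => s^-1 *: (((fun y => h (y + a)) \o shift x) (s *: v) - _)) =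
  (fun s => s^-1 *: ((h \o shift (x + a)) (s *: v) - h (x + a))))//.
by apply/funext => s /=; rewrite addrA.
Qed.

Lemma differentiable_translate h x a : differentiable h (x + a) ->
  differentiable (fun y => h (y + a)) x.
Proof.
move=> dh; apply: (@differentiable_comp _ _ _ _ (fun y => y + a) h) => //.
Qed.

Lemma differentiable_dotp x b : differentiable (fun y => dotp y b) x.
Proof.
rewrite (_ : (fun y => _) = \sum_i (fun y : 'rV[R]_n => y 0 i * b 0 i)).
  apply: differentiable_sum => i; apply: differentiableM => //.
  exact: differentiable_coord.
by apply/funext => y; rewrite /dotp fct_sumE.
Qed.

Let line_dotp s v x b : dotp (s *: v + x) b = s * dotp v b + dotp x b.
Proof. by rewrite dotpDl dotpZl. Qed.

Lemma derive_dotp x b v : 'D_v (fun y => dotp y b) x = dotp v b.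
Proof.
rewrite derive_line0; under eq_fun do rewrite line_dotp.
have H : is_derive 0 (1 : R) (fun s : R => s * dotp v b + dotp x b) (dotp v b).
  by apply: is_derive_eq; rewrite addr0 scaler0 add0r /GRing.scale/= mulr1.
by case: H.
Qed.

Lemma derive_cos_dotp x b v (r : R) :
  'D_v (fun y => cos (r + dotp y b)) x = - sin (r + dotp x b) * dotp v b.
Proof.
rewrite derive_line0; under eq_fun do rewrite line_dotp.
have H : is_derive 0 (1 : R) (fun s : R => cos (r + (s * dotp v b + dotp x b)))
   (- sin (r + (0 * dotp v b + dotp x b)) * dotp v b).
  by apply: is_derive_eq; rewrite add0r mul1r scaler0 addr0 add0r /GRing.scale/= mulr1.
by case: H => _ ->; rewrite mul0r add0r.
Qed.

Lemma derive_sin_dotp x b v (r : R) :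
  'D_v (fun y => sin (r + dotp y b)) x = cos (r + dotp x b) * dotp v b.
Proof.
rewrite derive_line0; under eq_fun do rewrite line_dotp.
have H : is_derive 0 (1 : R) (fun s : R => sin (r + (s * dotp v b + dotp x b)))
   (cos (r + (0 * dotp v b + dotp x b)) * dotp v b).
  by apply: is_derive_eq; rewrite add0r mul1r scaler0 addr0 add0r /GRing.scale/= mulr1.
by case: H => _ ->; rewrite mul0r add0r.
Qed.

Lemma dotp_delta (i : 'I_n) b : dotp (delta_mx 0 i) b = b 0 i.
Proof.
rewrite /dotp (bigD1 i)//= mxE !eqxx mul1r big1 ?addr0// => j ji.
by rewrite mxE (negbTE ji) andbF mul0r.
Qed.

Lemma cdiff_expi x b (r : R) : cdiff (fun y => expi (r + dotp y b)) x.
Proof.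
have D : differentiable (fun y => r + dotp y b) x.
  apply: differentiableD; first exact: differentiable_cst.
  exact: differentiable_dotp.
split => /=.
  apply: (@differentiable_comp _ _ _ _ (fun y => r + dotp y b) (@cos R)) => //.
  exact/derivable1_diffP/derivable_cos.
apply: (@differentiable_comp _ _ _ _ (fun y => r + dotp y b) (@sin R)) => //.
exact/derivable1_diffP/derivable_sin.
Qed.

Lemma partial_expi (i : 'I_n) b (r : R) :
  partial i (fun y => expi (r + dotp y b)) =
  fun y => Complex 0 (b 0 i) * expi (r + dotp y b).
Proof.
apply/funext => x; apply: complex_eqP; rewrite ?cReM ?cImM /partial/=.
  by rewrite derive_cos_dotp dotp_delta mul0r sub0r mulNr mulrC.
by rewrite derive_sin_dotp dotp_delta mul0r add0r mulrC.
Qed.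

Lemma cdiff_cst c x : cdiff (fun=> c) x.
Proof. by split; exact: differentiable_cst. Qed.

Lemma partial_cst c (i : 'I_n) : partial i (fun=> c : R[i]) = fun=> 0.
Proof. by apply/funext => x; rewrite /partial !derive_cst. Qed.

Lemma cdiffD f g x : cdiff f x -> cdiff g x -> cdiff (fun y => f y + g y) x.
Proof.
move=> [f1 f2] [g1 g2]; split.
  by under eq_fun do rewrite cReD; exact: differentiableD.
by under eq_fun do rewrite cImD; exact: differentiableD.
Qed.

Lemma partialD (i : 'I_n) f g : (forall x, cdiff f x) -> (forall x, cdiff g x) ->
  partial i (fun y => f y + g y) = fun y => partial i f y + partial i g y.
Proof.
move=> df dg; apply/funext => x; have [f1 f2] := df x; have [g1 g2] := dg x.
apply: complex_eqP; rewrite ?cReD ?cImD /partial/=.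
  under eq_fun do rewrite cReD; apply: deriveD; exact: diff_derivable.
under eq_fun do rewrite cImD; apply: deriveD; exact: diff_derivable.
Qed.

Lemma cdiffM f g x : cdiff f x -> cdiff g x -> cdiff (fun y => f y * g y) x.
Proof.
move=> [f1 f2] [g1 g2]; split.
  under eq_fun do rewrite cReM; apply: differentiableB; exact: differentiableM.
under eq_fun do rewrite cImM; apply: differentiableD; exact: differentiableM.
Qed.

Lemma partialM (i : 'I_n) f g : (forall x, cdiff f x) -> (forall x, cdiff g x) ->
  partial i (fun y => f y * g y) =
  fun y => partial i f y * g y + f y * partial i g y.
Proof.
move=> df dg; apply/funext => x; have [f1 f2] := df x; have [g1 g2] := dg x.
pose e : 'rV[R]_n := delta_mx 0 i.
have f1' : derivable (fun y => complex.Re (f y)) x e by exact: diff_derivable.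
have f2' : derivable (fun y => complex.Im (f y)) x e by exact: diff_derivable.
have g1' : derivable (fun y => complex.Re (g y)) x e by exact: diff_derivable.
have g2' : derivable (fun y => complex.Im (g y)) x e by exact: diff_derivable.
apply: complex_eqP; rewrite ?cReD ?cImD ?cReM ?cImM /partial/=.
  under eq_fun do rewrite cReM.
  rewrite (deriveB (derivableM f1' g1') (derivableM f2' g2')).
  rewrite (deriveM f1' g1') (deriveM f2' g2') /GRing.scale/=; ring.
under eq_fun do rewrite cImM.
rewrite (deriveD (derivableM f1' g2') (derivableM f2' g1')).
rewrite (deriveM f1' g2') (deriveM f2' g1') /GRing.scale/=; ring.
Qed.

Lemma partialZ (i : 'I_n) f c : (forall x, cdiff f x) ->
  partial i (fun y => c * f y) = fun y => c * partial i f y.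
Proof.
move=> df; rewrite (partialM i (cdiff_cst c) df) partial_cst.
by apply/funext => x; rewrite mul0r add0r.
Qed.

Lemma partial_translate (i : 'I_n) f a :
  partial i (fun y => f (y + a)) = fun y => partial i f (y + a).
Proof.
apply/funext => x; rewrite /partial.
rewrite (derive_translate (fun y => complex.Re (f y))).
by rewrite (derive_translate (fun y => complex.Im (f y))).
Qed.

Lemma cdiff_translate f a x : cdiff f (x + a) -> cdiff (fun y => f (y + a)) x.
Proof. by move=> [f1 f2]; split; [exact: differentiable_translate f1|exact: differentiable_translate f2]. Qed.

Let Re_conj f : (fun y => complex.Re (conjc (f y))) = fun y => complex.Re (f y).
Proof. by apply/funext => y; case: (f y). Qed.

Let Im_conj f : (fun y => complex.Im (conjc (f y))) = fun y => - complex.Im (f y).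
Proof. by apply/funext => y; case: (f y). Qed.

Lemma cdiff_conj f x : cdiff f x -> cdiff (fun y => conjc (f y)) x.
Proof.
by move=> [f1 f2]; split; rewrite ?Re_conj ?Im_conj//; exact: differentiableN.
Qed.

Lemma partial_conj (i : 'I_n) f : (forall x, cdiff f x) ->
  partial i (fun y => conjc (f y)) = fun y => conjc (partial i f y).
Proof.
move=> df; apply/funext => x; rewrite /partial Re_conj Im_conj.
by rewrite deriveN//; apply: diff_derivable; have [] := df x.
Qed.

Lemma cdiff_coord (j : 'I_n) x : cdiff (fun y => (y 0 j)%:C%C) x.
Proof. by split; [exact: differentiable_coord|exact: differentiable_cst]. Qed.

Lemma partial_coord (i j : 'I_n) : 
  partial i (fun y : 'rV[R]_n => (y 0 j)%:C%C) = fun=> (i == j)%:R.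
Proof.
apply/funext => x; apply: complex_eqP; rewrite /partial/=.
  rewrite (_ : (fun y : 'rV[R]_n => y 0 j) = fun y => dotp y (delta_mx 0 j)).
    by rewrite derive_dotp dotp_delta mxE eqxx/=; case: eqP.
  by apply/funext => y; rewrite dotpC dotp_delta.
by rewrite derive_cst; case: (i == j).
Qed.

Implicit Types P Q : ('rV[R]_n -> R[i]) -> Prop.

Lemma partials_class P f s : (forall f i, P f -> P (partial i f)) ->
  P f -> P (partials s f).
Proof. by move=> h Pf; elim: s => //= i s IH; exact: h. Qed.

(** Coinductive principle: a class of differentiable functions that is stable
    under partial derivatives consists of smooth functions. It avoids all
    Leibniz formulas for iterated derivatives. *)
Lemma smooth_class P : (forall f x, P f -> cdiff f x) ->
  (forall f i, P f -> P (partial i f)) -> forall f, P f -> smooth f.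
Proof. by move=> h1 h2 f Pf s x; exact: (h1 (partials s f) x (partials_class s h2 Pf)). Qed.

Lemma smooth_cdiff f x : smooth f -> cdiff f x.
Proof. by move=> /(_ [::] x). Qed.

Lemma partials_rcons s i f : partials (rcons s i) f = partials s (partial i f).
Proof. by rewrite /partials foldr_rcons. Qed.

Lemma smooth_partial f i : smooth f -> smooth (partial i f).
Proof. by move=> h s x; rewrite -partials_rcons; exact: h. Qed.

Lemma smooth_continuous f : smooth f ->
  continuous (fun x => complex.Re (f x)) /\ continuous (fun x => complex.Im (f x)).
Proof.
by move=> sf; split => x; apply: differentiable_continuous; have [] := smooth_cdiff x sf.
Qed.

Lemma smooth_measurable f : smooth f -> cmeasurable f.
Proof. by move=> /smooth_continuous[]; exact: cmeasurable_continuous. Qed.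

Definition rapid f := forall N : nat, exists C, forall x, normc (f x) <= C * (1 + enorm x) ^- N.

(** The multipliers of the Schwartz space: smooth functions whose derivatives
    grow at most polynomially. *)
Definition moderate f := smooth f /\
  forall s, exists N C, forall x, normc (partials s f x) <= C * (1 + enorm x) ^+ N.

Lemma le_schwartz_norm f N s x : (size s <= N)%N ->
  (((1 + enorm x) ^+ N * normc (partials s f x))%:E <= schwartz_norm N f)%E.
Proof. by move=> sN; apply: ereal_sup_ubound; exists (s, x). Qed.

Lemma schwartz_norm_ge0 f N : (0 <= schwartz_norm N f)%E.
Proof.
apply: le_trans (@le_schwartz_norm f N [::] 0 isT).
by rewrite lee_fin mulr_ge0 ?normc_ge0// exprn_ge0// ltW// enorm1_gt0.
Qed.

Lemma schwartz_rapid f s : schwartz f -> rapid (partials s f).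
Proof.
move=> [_ h] N; have := h (maxn (size s) N); set M := maxn _ _ => hM.
exists (fine (schwartz_norm M f)) => x.
rewrite ler_pdivlMr ?exprn_gt0 ?enorm1_gt0// -lee_fin fineK; last first.
  by rewrite ge0_fin_numE// schwartz_norm_ge0.
apply: le_trans (le_schwartz_norm f x (leq_maxl _ _)); rewrite lee_fin mulrC.
by rewrite ler_wpM2r ?normc_ge0// ler_weXn2l ?enorm1_ge1// leq_maxr.
Qed.

(** The Schwartz seminorm takes a supremum over all multi-indices of length at
    most [N]; these are finitely many, and induction on their length bounds
    it. *)
Lemma rapid_schwartz f : smooth f -> (forall s, rapid (partials s f)) -> schwartz f.
Proof.
move=> sf h; split => // N.
have [C hC] : exists C, forall s x, (size s <= N)%N ->
    (1 + enorm x) ^+ N * normc (partials s f x) <= C.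
  have {}h s : exists C, 0 <= C /\ forall x, (1 + enorm x) ^+ N * normc (partials s f x) <= C.
    have [C hC] := h s N; exists C; split.
      by have := le_trans (normc_ge0 _) (hC 0); rewrite pmulr_lge0// weight_gt0.
    by move=> x; rewrite mulrC -ler_pdivlMr ?exprn_gt0 ?enorm1_gt0.
  have {}h m : exists C, 0 <= C /\ forall s x, (size s <= m)%N ->
      (1 + enorm x) ^+ N * normc (partials s f x) <= C.
    elim: m => [|m [C [C0 IH]]].
      have [C [C0 hC]] := h [::]; exists C; split => // s x.
      by rewrite leqn0 => /nilP ->; exact: hC.
    pose D (t : m.+1.-tuple 'I_n) := projT1 (cid (h t)).
    have DP t : 0 <= D t /\ forall x, (1 + enorm x) ^+ N * normc (partials t f x) <= D t.
      exact: projT2 (cid (h t)).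
    exists (C + \sum_t D t); split.
      by rewrite addr_ge0// sumr_ge0// => t _; case: (DP t).
    move=> s x; rewrite leq_eqVlt => /orP[sm|]; last first.
      rewrite ltnS => /(IH s x) /le_trans; apply.
      by rewrite lerDl sumr_ge0// => t _; case: (DP t).
    have [_ /(_ x) /le_trans] := DP (Tuple sm); apply.
    rewrite (bigD1 (Tuple sm))//= addrCA lerDl addr_ge0// sumr_ge0// => t _.
    by case: (DP t).
  by have [C [_ hC]] := h N; exists C.
apply: (@le_lt_trans _ _ C%:E); last exact: ltry.
by apply: ub_ereal_sup => _ [[s x] /= sN <-]; rewrite lee_fin hC.
Qed.

(** The analogue of [smooth_class] for Schwartz functions: rapid decay has to
    be checked on the members of the class only. *)
Lemma schwartz_class P : (forall f x, P f -> cdiff f x) ->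
  (forall f i, P f -> P (partial i f)) -> (forall f, P f -> rapid f) ->
  forall f, P f -> schwartz f.
Proof.
move=> h1 h2 h3 f Pf; apply: rapid_schwartz; first exact: smooth_class h1 h2 _ Pf.
by move=> s; apply: h3; exact: partials_class.
Qed.

Lemma moderate_class P : (forall f x, P f -> cdiff f x) ->
  (forall f i, P f -> P (partial i f)) ->
  (forall f, P f -> exists N C, forall x, normc (f x) <= C * (1 + enorm x) ^+ N) ->
  forall f, P f -> moderate f.
Proof.
move=> h1 h2 h3 f Pf; split; first exact: smooth_class h1 h2 _ Pf.
by move=> s; apply: h3; exact: partials_class.
Qed.

Lemma schwartz_partial f i : schwartz f -> schwartz (partial i f).
Proof.
move=> sf; apply: rapid_schwartz; first by apply: smooth_partial; case: sf.
by move=> s; rewrite -partials_rcons; exact: schwartz_rapid.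
Qed.

Lemma moderate_partial f i : moderate f -> moderate (partial i f).
Proof.
move=> [sf h]; split; first exact: smooth_partial.
by move=> s; rewrite -partials_rcons.
Qed.

Lemma schwartz_cdiff f x : schwartz f -> cdiff f x.
Proof. by move=> [/smooth_cdiff]. Qed.

Lemma moderate_cdiff f x : moderate f -> cdiff f x.
Proof. by move=> [/smooth_cdiff]. Qed.

(** Products of members of [P] and [Q] are not stable under partial
    derivatives, but by the product rule finite sums of them are, if [P] and
    [Q] are stable. *)
Inductive prod_closure P Q : ('rV[R]_n -> R[i]) -> Prop :=
| prod_closure_mul f g of P f & Q g : prod_closure P Q (fun x => f x * g x)
| prod_closure_add f g of prod_closure P Q f & prod_closure P Q g :
    prod_closure P Q (fun x => f x + g x).

Lemma rapidD f g : rapid f -> rapid g -> rapid (fun x => f x + g x).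
Proof.
move=> hf hg N; have [C hC] := hf N; have [D hD] := hg N.
by exists (C + D) => x; rewrite (le_trans (ler_normcD _ _))// mulrDl lerD.
Qed.

(** [schwartz_class] applied to [prod_closure]. *)
Lemma schwartzM f g : schwartz f -> moderate g -> schwartz (fun x => f x * g x).
Proof.
move=> sf mg; apply: (@schwartz_class (prod_closure schwartz moderate)); last exact: prod_closure_mul.
- move=> p x; elim=> {p} [p q sh mk|p q _ IH1 _ IH2]; last exact: cdiffD.
  by apply: cdiffM; [exact: schwartz_cdiff|exact: moderate_cdiff].
- have D p x : prod_closure schwartz moderate p -> cdiff p x.
    elim=> {p} [p q sh mk|p q _ IH1 _ IH2]; last exact: cdiffD.
    by apply: cdiffM; [exact: schwartz_cdiff|exact: moderate_cdiff].
  move=> p i; elim=> {p} [p q sh mk|p q p1 IH1 p2 IH2].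
    rewrite partialM; [|by move=> x; exact: schwartz_cdiff|by move=> x; exact: moderate_cdiff].
    apply: prod_closure_add; apply: prod_closure_mul => //.
      exact: schwartz_partial.
    exact: moderate_partial.
  by rewrite partialD; [exact: prod_closure_add|move=> x; exact: D|move=> x; exact: D].
- move=> p; elim=> {p} [p q sh [_ mk]|p q _ IH1 _ IH2]; last exact: rapidD.
  move=> N; have [M [C hC]] := mk [::].
  have [D hD] := schwartz_rapid [::] sh (N + M)%N.
  exists (D * C) => x; rewrite normcM.
  have e0 := enorm1_gt0 x.
  rewrite (le_trans (ler_pM (normc_ge0 _) (normc_ge0 _) (hD x) (hC x)))//.
  rewrite exprD invfM mulrACA -[X in _ * X]mulrA mulVf ?mulr1//.
  by rewrite expf_neq0// gt_eqF.
Qed.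

End calculus.

Section closures.
Context {R : realType} {n : nat}.
Implicit Types (f g : 'rV[R]_n -> R[i]) (x y b a : 'rV[R]_n) (c : R[i]).

Lemma rapid_ge0 f N : rapid f -> exists2 C, 0 <= C & forall x, normc (f x) <= C * (1 + enorm x) ^- N.
Proof.
move=> /(_ N)[C h]; exists C => //.
by have := le_trans (normc_ge0 _) (h 0); rewrite pmulr_lge0// weight_gt0.
Qed.

Lemma schwartzD f g : schwartz f -> schwartz g -> schwartz (fun x => f x + g x).
Proof.
move=> sf sg.
apply: (@schwartz_class _ _ (fun h => exists f g, [/\ schwartz f, schwartz g & h = fun x => f x + g x])).
- by move=> _ x [p [q [sp sq ->]]]; apply: cdiffD; exact: schwartz_cdiff.
- move=> _ i [p [q [sp sq ->]]]; exists (partial i p), (partial i q).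
  split; [exact: schwartz_partial|exact: schwartz_partial|].
  by rewrite partialD// => x; exact: schwartz_cdiff.
- move=> _ [p [q [sp sq ->]]]; apply: rapidD.
    exact: (schwartz_rapid [::] sp).
  exact: (schwartz_rapid [::] sq).
- by exists f, g.
Qed.

Lemma schwartz_moderate f : schwartz f -> moderate f.
Proof.
move=> sf; split; first by case: sf.
move=> s; have [C hC] := schwartz_rapid s sf 0%N; exists 0%N, C => x.
by have := hC x; rewrite !expr0 invr1.
Qed.

Lemma moderate_cst c : moderate (fun=> c : R[i]) (n := n).
Proof.
apply: (@moderate_class _ _ (fun h => exists c, h = fun=> c)).
- by move=> _ x [k ->]; exact: cdiff_cst.
- by move=> _ i [k ->]; exists 0; rewrite partial_cst.
- by move=> _ [k ->]; exists 0%N, (normc k) => x; rewrite expr0 mulr1.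
- by exists c.
Qed.

Lemma moderate_expi b (r : R) : moderate (fun y => expi (r + dotp y b)).
Proof.
apply: (@moderate_class _ _ (fun h => exists c, h = fun y => c * expi (r + dotp y b))).
- by move=> _ x [k ->]; apply: cdiffM; [exact: cdiff_cst|exact: cdiff_expi].
- move=> _ i [k ->]; exists (k * Complex 0 (b 0 i)).
  rewrite partialZ; last by move=> x; exact: cdiff_expi.
  by rewrite partial_expi; apply/funext => y; rewrite mulrA.
- move=> _ [k ->]; exists 0%N, (normc k) => x.
  by rewrite expr0 mulr1 normcM normc_expi mulr1.
- by exists 1; apply/funext => y; rewrite mul1r.
Qed.

Lemma moderate_coord (j : 'I_n) : moderate (fun y : 'rV[R]_n => (y 0 j)%:C%C).
Proof.
apply: (@moderate_class _ _ (fun h => h = (fun y => (y 0 j)%:C%C) \/ exists c, h = fun=> c)).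
- by move=> _ x [->|[k ->]]; [exact: cdiff_coord|exact: cdiff_cst].
- move=> _ i [->|[k ->]]; right; first by exists (i == j)%:R; rewrite partial_coord.
  by exists 0; rewrite partial_cst.
- move=> _ [->|[k ->]].
    exists 1%N, 1 => x; rewrite mul1r expr1 normcR.
    by rewrite (le_trans (normr_coord_enorm x j))// lerDr.
  by exists 0%N, (normc k) => x; rewrite expr0 mulr1.
- by left.
Qed.

Lemma schwartzZ c f : schwartz f -> schwartz (fun x => c * f x).
Proof.
move=> sf; under eq_fun do rewrite mulrC.
exact: schwartzM sf (moderate_cst c).
Qed.

Lemma schwartz_expi b (r : R) f : schwartz f -> schwartz (fun x => expi (r + dotp x b) * f x).
Proof.
move=> sf; under eq_fun do rewrite mulrC.
exact: schwartzM sf (moderate_expi b r).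
Qed.

Lemma schwartz_fourier_phase b f : schwartz f -> schwartz (fun x => expi (- dotp x b) * f x).
Proof.
move=> sf; have := schwartz_expi (- b) 0 sf.
by under eq_fun do rewrite add0r dotpNr.
Qed.

Lemma schwartz0 : schwartz (fun=> 0 : R[i]) (n := n).
Proof.
apply: (@schwartz_class _ _ (fun h => h = fun=> 0)) => //.
- by move=> _ x ->; exact: cdiff_cst.
- by move=> _ i ->; rewrite partial_cst.
- by move=> _ -> N; exists 0 => x; rewrite normc0 mul0r.
Qed.

Lemma schwartz_sum (I : Type) (s : seq I) (F : I -> 'rV[R]_n -> R[i]) :
  (forall i, schwartz (F i)) -> schwartz (fun x => \sum_(i <- s) F i x).
Proof.
move=> h; elim: s => [|i s IH].
  by under eq_fun do rewrite big_nil; exact: schwartz0.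
by under eq_fun do rewrite big_cons; exact: schwartzD.
Qed.

Lemma schwartz_conj f : schwartz f -> schwartz (fun x => conjc (f x)).
Proof.
move=> sf.
apply: (@schwartz_class _ _ (fun h => exists2 f, schwartz f & h = fun x => conjc (f x))).
- by move=> _ x [p sp ->]; apply: cdiff_conj; exact: schwartz_cdiff.
- move=> _ i [p sp ->]; exists (partial i p); first exact: schwartz_partial.
  by rewrite partial_conj// => x; exact: schwartz_cdiff.
- move=> _ [p sp ->] N; have [C hC] := schwartz_rapid [::] sp N.
  by exists C => x; rewrite normc_conj; exact: hC.
- by exists f.
Qed.

Lemma schwartz_translate a f : schwartz f -> schwartz (fun x => f (x + a)).
Proof.
move=> sf.
apply: (@schwartz_class _ _ (fun h => exists2 f, schwartz f & h = fun x => f (x + a))).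
- by move=> _ x [p sp ->]; apply: cdiff_translate; exact: schwartz_cdiff.
- move=> _ i [p sp ->]; exists (partial i p); first exact: schwartz_partial.
  by rewrite partial_translate.
- move=> _ [p sp ->] N; have [C C0 hC] := rapid_ge0 N (schwartz_rapid [::] sp).
  exists (C * (1 + enorm a) ^+ N) => x; rewrite (le_trans (hC _))// -mulrA ler_wpM2l//.
  rewrite ler_pdivlMr ?exprn_gt0 ?enorm1_gt0// mulrC ler_pdivrMr ?exprn_gt0 ?enorm1_gt0//.
  rewrite -exprMn lerXn2r ?nnegrE ?mulr_ge0 ?(ltW (enorm1_gt0 _))//.
  by have := peetre (x + a) (- a); rewrite addrK enormN mulrC.
- by exists f.
Qed.

Lemma rapid_cintegrable f : cmeasurable f -> rapid f -> cintegrable f.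
Proof.
move=> mf /(_ n.*2)[C hC]; apply: cintegrable_dom mf hC _.
exact: (integrableZl measurableT C (integrable_weight (leqnn _))).
Qed.

Lemma schwartz_measurable f : schwartz f -> cmeasurable f.
Proof. by move=> [/smooth_measurable]. Qed.

Lemma schwartz_cintegrable f : schwartz f -> cintegrable f.
Proof.
move=> sf; apply: rapid_cintegrable; first exact: schwartz_measurable.
exact: (schwartz_rapid [::] sf).
Qed.

Lemma supp_eq0 f x : ~ supp f x -> f x = 0.
Proof.
move=> h; apply: contra_notP h => /eqP fx; exact: subset_closure.
Qed.

(** The class consists of the smooth functions vanishing off the compact
    support; such a function attains its weighted maximum on the support. *)
Lemma test_schwartz f : test_function f -> schwartz f.
Proof.
move=> [sf cK]; set K := supp f in cK.
have clK : closed K by exact: closed_closure.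
apply: (@schwartz_class _ _ (fun h => smooth h /\ forall x, ~ K x -> h x = 0)).
- by move=> h x [sh _]; exact: smooth_cdiff.
- move=> h i [sh h0]; split; first exact: smooth_partial.
  move=> x Kx; have oK : open (~` K) by exact: closed_openC.
  have nK : \forall y \near x, ~ K y by have := oK x Kx.
  rewrite /partial.
  have -> : 'D_(delta_mx 0 i) (fun y => complex.Re (h y)) x = 'D_(delta_mx 0 i) (cst 0 : 'rV[R]_n -> R) x.
    apply: near_eq_derive; near=> y; rewrite h0//; near: y; exact: nK.
  have -> : 'D_(delta_mx 0 i) (fun y => complex.Im (h y)) x = 'D_(delta_mx 0 i) (cst 0 : 'rV[R]_n -> R) x.
    apply: near_eq_derive; near=> y; rewrite h0//; near: y; exact: nK.
  by rewrite !derive_cst.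
- move=> h [sh h0] N.
  have [c1 c2] := smooth_continuous sh.
  pose G x := (`|complex.Re (h x)| + `|complex.Im (h x)|) * (1 + enorm x) ^+ N.
  have cG : continuous G.
    have n1 : continuous (fun x => `|complex.Re (h x)|).
      move=> x; apply: (@continuous_comp _ _ _ _ (@Num.norm R R)); first exact: c1.
      exact: norm_continuous.
    have n2 : continuous (fun x => `|complex.Im (h x)|).
      move=> x; apply: (@continuous_comp _ _ _ _ (@Num.norm R R)); first exact: c2.
      exact: norm_continuous.
    move=> x; exact: (continuousM (continuousD (n1 x) (n2 x)) (@enorm1X_continuous _ _ N x)).
  have [C hC] : exists C, forall x, K x -> G x <= C.
    have [K0|/set0P [x0 Kx0]] := eqVneq K set0.
      by exists 0 => x; rewrite K0.
    have [||c Kc hc] := @EVT_max_rV R n G K _ cK; first by exists x0.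
      exact: continuous_subspaceT.
    by exists (G c) => x Kx; apply: hc; rewrite inE.
  exists (Num.max C 0) => x; rewrite ler_pdivlMr ?exprn_gt0 ?enorm1_gt0//.
  have [Kx|Kx] := pselect (K x); last first.
    by rewrite h0// normc0 mul0r le_max lexx orbT.
  rewrite le_max; apply/orP; left; apply: le_trans (hC x Kx).
  by rewrite ler_wpM2r ?normc_leD// exprn_ge0// ltW// enorm1_gt0.
- by split => // x; exact: supp_eq0.
Unshelve. all: by end_near. Qed.

End closures.

(** * Taylor remainders of the imaginary exponential *)

Section taylor.
Context {R : realType}.
Implicit Types (s t : R).

(** The bound on the derivative is required only between [0] and [s], which
    symmetrical absolute values express for both signs of [s]. *)
Lemma MVT_bound (f df : R -> R) s M : (forall t, is_derive t 1 f (df t)) ->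
  (forall t, `|t| <= `|s| -> `|df t| <= M) -> `|f s - f 0| <= M * `|s|.
Proof.
move=> fd dM.
have cf (a b : R) : {within `[a, b], continuous f}.
  apply: continuous_subspaceT => t; apply: differentiable_continuous.
  by apply/derivable1_diffP; case: (fd t).
have [s0|s0] := leP 0 s.
  have [t] := MVT_segment s0 (fun x _ => fd x) (cf 0 s).
  rewrite in_itv/= => /andP[t0 ts] ->; rewrite subr0 normrM ler_wpM2r//.
  by apply: dM; rewrite !ger0_norm.
have [t] := MVT_segment (ltW s0) (fun x _ => fd x) (cf s 0).
rewrite in_itv/= => /andP[ts t0]; rewrite distrC => ->.
rewrite sub0r normrM normrN ler_wpM2r//.
by apply: dM; rewrite !ler0_norm ?lerN2// ltW.
Qed.

(** The Taylor coefficients [i^k / k!] of [expi], by recursion. *)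
Fixpoint expi_coef (k : nat) : R[i] :=
  if k is k'.+1 then Complex 0 (k'.+1%:R)^-1 * expi_coef k' else 1.

Definition expi_poly (K : nat) s : R[i] := \sum_(k < K) (s ^+ k)%:C%C * expi_coef k.

Lemma expi_poly0 K : expi_poly K.+1 0 = 1.
Proof.
rewrite /expi_poly big_ord_recl expr0 mulr1 big1 ?addr0// => i _.
by rewrite expr0n/= mul0r.
Qed.

Let polyR (a : nat -> R) K s := \sum_(k < K) s ^+ k * a k.

Let is_derive_poly (a : nat -> R) K s :
  is_derive s 1 (polyR a K.+1) (polyR (fun k => k.+1%:R * a k.+1) K s).
Proof.
elim: K => [|K IH].
  rewrite /polyR big_ord0 (_ : (fun s => _) = cst (a 0%N)); first exact: is_derive_cst.
  by apply/funext => t; rewrite big_ord_recr big_ord0/= add0r expr0 mul1r.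
rewrite (_ : polyR a K.+2 = (fun t => polyR a K.+1 t + t ^+ K.+1 * a K.+1)); last first.
  by apply/funext => t; rewrite /polyR big_ord_recr.
rewrite {2}/polyR big_ord_recr/= -/(polyR _ _ _).
have H : is_derive s 1 (fun t : R => t ^+ K.+1 * a K.+1) (s ^+ K * (K.+1%:R * a K.+1)).
  have E : is_derive s 1 (fun t : R => t ^+ K.+1) (K.+1%:R * s ^+ K).
    apply: DeriveDef; first exact: exprn_derivable.
    by rewrite exp_derive /GRing.scale/= mulr1.
  under eq_fun do rewrite mulrC.
  rewrite mulrA mulrC [s ^+ K * _]mulrC.
  exact: is_deriveZ.
exact: is_deriveD.
Qed.

Let Re_poly K s : complex.Re (expi_poly K s) = polyR (fun k => complex.Re (expi_coef k)) K s.
Proof.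
rewrite /expi_poly (big_morph (@complex.Re R) (@cReD R) erefl).
by apply: eq_bigr => k _; rewrite cReM/= mul0r subr0.
Qed.

Let Im_poly K s : complex.Im (expi_poly K s) = polyR (fun k => complex.Im (expi_coef k)) K s.
Proof.
rewrite /expi_poly (big_morph (@complex.Im R) (@cImD R) erefl).
by apply: eq_bigr => k _; rewrite cImM/= mul0r addr0.
Qed.

Let rem_bound K s : `|complex.Re (expi s - expi_poly K s)| <= `|s| ^+ K /\
  `|complex.Im (expi s - expi_poly K s)| <= `|s| ^+ K.
Proof.
elim: K s => [|K IH] s.
  by rewrite /expi_poly big_ord0 subr0 expr0 /= cos_max sin_max.
have dR t : is_derive t 1 (fun t => complex.Re (expi t - expi_poly K.+1 t))
    (- complex.Im (expi t - expi_poly K t)).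
  rewrite (_ : (fun t => _) = fun t => cos t - polyR (fun k => complex.Re (expi_coef k)) K.+1 t); last first.
    by apply/funext => u; rewrite cReD cReN Re_poly.
  rewrite cImD cImN Im_poly/=.
  have := is_derive_poly (fun k => complex.Re (expi_coef k)) K t => H.
  apply: is_derive_eq; rewrite opprD; congr (_ + _).
  congr (- _); rewrite /polyR -sumrN; apply: eq_bigr => k _.
  by rewrite -mulrN; congr (_ * _); rewrite cReM/= mul0r sub0r mulrN mulVKf// pnatr_eq0.
have dI t : is_derive t 1 (fun t => complex.Im (expi t - expi_poly K.+1 t))
    (complex.Re (expi t - expi_poly K t)).
  rewrite (_ : (fun t => _) = fun t => sin t - polyR (fun k => complex.Im (expi_coef k)) K.+1 t); last first.
    by apply/funext => u; rewrite cImD cImN Im_poly.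
  rewrite cReD cReN Re_poly/=.
  have := is_derive_poly (fun k => complex.Im (expi_coef k)) K t => H.
  apply: is_derive_eq; congr (_ + _).
  congr (- _); rewrite /polyR; apply: eq_bigr => k _.
  by congr (_ * _); rewrite cImM/= mul0r add0r mulVKf// pnatr_eq0.
have z : expi 0 - expi_poly K.+1 0 = 0 by rewrite expi0 expi_poly0 subrr.
have B t : `|t| <= `|s| -> `|t| ^+ K <= `|s| ^+ K.
  by move=> ts; rewrite lerXn2r ?nnegrE.
rewrite exprSr; split.
  have := MVT_bound dR (M := `|s| ^+ K) (s := s); rewrite z subr0; apply => t ts.
  by rewrite normrN (le_trans (IH t).2)// B.
have := MVT_bound dI (M := `|s| ^+ K) (s := s); rewrite z subr0; apply => t ts.
by rewrite (le_trans (IH t).1)// B.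
Qed.

(** The derivative of the [K+1]-st remainder is [i] times the [K]-th one, so
    induction with the mean value inequality on real and imaginary parts
    applies. The factorials are not exploited. *)
Lemma expi_taylor K s : normc (expi s - expi_poly K s) <= 2 * `|s| ^+ K.
Proof.
rewrite (le_trans (normc_leD _))// mulr_natl mulr2n.
by have [h1 h2] := rem_bound K s; exact: lerD.
Qed.

End taylor.

(** * Integration by parts *)

Section frechet.
Context {R : realType} {n : nat}.
Implicit Types (F : 'rV[R]_n -> R) (x b v : 'rV[R]_n).

Let dotp_is_linear b : linear (fun h : 'rV[R]_n => dotp h b : R^o).
Proof. by move=> r x y; rewrite dotpDl dotpZl. Qed.

(** A quadratic remainder estimate in the Euclidean norm identifies the
    differential. *)
Lemma frechet_dotp F b x (C : R) :
  (forall h, `|F (h + x) - F x - dotp h b| <= C * enorm h ^+ 2) ->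
  differentiable F x /\ forall v, 'D_v F x = dotp v b.
Proof.
move=> FC; pose L : {linear 'rV[R]_n -> R^o} := HB.pack (fun h : 'rV[R]_n => dotp h b : R^o)
  (GRing.isLinear.Build R 'rV[R]_n R^o *:%R (fun h : 'rV[R]_n => dotp h b) (dotp_is_linear b)).
have cL : continuous L by exact: dotp_continuous_l.
have E : (F : _ -> R^o) \o shift x = cst (F x) + L +o_ (0 : 'rV[R]_n) id.
  apply/eqaddoP => _/posnumP[e].
  (* the factor n compares the Euclidean norm with the sup norm; adding 1 keeps M positive *)
  pose M := n%:R ^+ 2 * `|C| + 1.
  have M0 : 0 < M by rewrite ltr_wpDl// mulr_ge0// exprn_ge0.
  near=> h; rewrite /= -[X in `|X| <= _]/(F (h + x) - (F x + dotp h b)) opprD addrA.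
  rewrite (le_trans (FC h))//.
  have hM : `|h| <= e%:num / M.
    near: h; have eM : 0 < e%:num / M by rewrite divr_gt0.
    apply/nbhs_ballP; exists (e%:num / M) => //= y.
    by rewrite -ball_normE /ball_/= sub0r normrN => /ltW.
  apply: (@le_trans _ _ (M * `|h| * `|h|)); last first.
    by rewrite ler_wpM2r// mulrC -ler_pdivlMr.
  apply: (@le_trans _ _ (`|C| * (n%:R * `|h|) ^+ 2)).
    rewrite (le_trans (ler_norm _))// normrM ler_wpM2l// ger0_norm ?exprn_ge0 ?enorm_ge0//.
    by rewrite lerXn2r ?nnegrE ?enorm_ge0 ?mulr_ge0// enorm_le_norm.
  rewrite exprMn mulrA -[M * _ * _]mulrA -expr2 ler_wpM2r ?exprn_ge0//.
  by rewrite /M mulrC lerDl.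
have D : differentiable (F : _ -> R^o) x.
  by apply/diff_locallyP; rewrite (diff_unique cL E); split.
split; first exact: D.
by move=> v; rewrite (deriveE v D) (diff_unique cL E).
Unshelve. all: by end_near. Qed.

End frechet.

Section integral_derivative.
Context {R : realType} {n : nat}.
Implicit Types (f : 'rV[R]_n -> R[i]) (x xi : 'rV[R]_n).

Lemma harmonic_dnbhs : (fun k : nat => k.+1%:R^-1 : R) @ \oo --> (0 : R)^'.
Proof.
move=> A [e /= e0 eA].
have [N _ hN] := near_infty_natSinv_lt (PosNum e0).
exists N => // k /= Nk; apply: eA => /=; last by rewrite invr_eq0 pnatr_eq0.
by rewrite sub0r normrN ger0_norm ?invr_ge0//; exact: hN.
Qed.

Let diffquo (F : 'rV[R]_n -> R) (v x : 'rV[R]_n) (k : nat) : R :=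
  k.+1%:R * (F (x + k.+1%:R^-1 *: v) - F x).

Let cvg_diffquo F v x : differentiable F x ->
  (fun k => diffquo F v x k) @ \oo --> 'D_v F x.
Proof.
move=> dF; have dv : derivable F x v by exact: diff_derivable.
have H := cvg_comp _ _ harmonic_dnbhs dv.
apply: cvg_trans H; apply: near_eq_cvg; near=> k.
by rewrite /diffquo /= invrK [_ + x]addrC.
Unshelve. all: by end_near. Qed.

Let unit_norm (i : 'I_n) : enorm (delta_mx 0 i : 'rV[R]_n) = 1.
Proof. by rewrite /enorm dotp_delta mxE !eqxx sqrtr1. Qed.

Let diffquo_le F (i : 'I_n) C N x k : 0 <= C -> (forall y, differentiable F y) ->
  (forall y, `|'D_(delta_mx 0 i) F y| <= C * (1 + enorm y) ^- N) ->
  `|diffquo F (delta_mx 0 i) x k| <= C * 2 ^+ N * (1 + enorm x) ^- N.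
Proof.
move=> C0 dF hC; set e := delta_mx 0 i in hC *.
have k0 : 0 < k.+1%:R^-1 :> R by rewrite invr_gt0 ltr0Sn.
have k1 : k.+1%:R^-1 <= 1 :> R by rewrite invf_le1 ?ler1n ?ltr0Sn.
have fd (t : R) : is_derive t 1 (fun s : R => F (s *: e + x)) ('D_e F (t *: e + x)).
  apply: DeriveDef; last by rewrite derive_line.
  apply: diff_derivable.
  apply: (@differentiable_comp _ _ _ _ (fun s : R => s *: e + x) F) => //.
have := @MVT_bound R (fun s : R => F (s *: e + x)) _ k.+1%:R^-1
   (C * 2 ^+ N * (1 + enorm x) ^- N) fd.
rewrite scale0r add0r (ger0_norm (ltW k0)) => H.
rewrite /diffquo normrM ger0_norm// mulrC -ler_pdivlMr ?ltr0Sn//.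
rewrite [x + _]addrC; apply: H => t tk.
rewrite (le_trans (hC _))// -mulrA ler_wpM2l//.
rewrite ler_pdivlMr ?exprn_gt0 ?enorm1_gt0// mulrC ler_pdivrMr ?exprn_gt0 ?enorm1_gt0//.
rewrite -exprMn lerXn2r ?nnegrE ?mulr_ge0 ?(ltW (enorm1_gt0 _))//.
have := peetre (t *: e + x) (- (t *: e)); rewrite addrAC subrr add0r enormN.
move/le_trans; apply; rewrite mulrC ler_wpM2r ?(ltW (enorm1_gt0 _))//.
rewrite enormZ unit_norm mulr1; move: (le_trans tk k1); lra.
Qed.

(** The difference quotients have integral zero by translation invariance, and
    converge dominatedly to the derivative. *)
Lemma cint_partial f (i : 'I_n) : schwartz f -> cint (partial i f) = 0.
Proof.
move=> sf.
pose D (k : nat) x : R[i] := k.+1%:R%:C%C * (f (x + k.+1%:R^-1 *: delta_mx 0 i) + - f x).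
have If := schwartz_cintegrable sf.
have It k := schwartz_cintegrable (schwartz_translate (k.+1%:R^-1 *: delta_mx 0 i) sf).
have Nf : cintegrable (fun x => - f x).
  by have := cintegrableZ (-1) If; under eq_fun do rewrite mulN1r.
have D0 k : cint (D k) = 0.
  rewrite /D cintZ; last exact: cintegrableD.
  rewrite cintD//.
  rewrite cint_translate//.
  have -> : cint (fun x => - f x) = - cint f.
    by rewrite -mulN1r -cintZ//; apply: eq_cint => x; rewrite mulN1r.
  by rewrite subrr mulr0.
have [C C0 hC] := rapid_ge0 n.*2 (schwartz_rapid [:: i] sf).
have ReD k x : complex.Re (D k x) = diffquo (fun y => complex.Re (f y)) (delta_mx 0 i) x k.
  by rewrite /D cReM/= mul0r subr0 cReD cReN.
have ImD k x : complex.Im (D k x) = diffquo (fun y => complex.Im (f y)) (delta_mx 0 i) x k.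
  by rewrite /D cImM/= mul0r addr0 cImD cImN.
have : ccvg (fun k => cint (D k)) (cint (partial i f)).
  apply: (@cint_dom_cvg _ _ _ _ (fun x => 2 * (C * 2 ^+ n.*2) * (1 + enorm x) ^- n.*2)).
  - move=> k; apply: cmeasurableM; first exact: cmeasurable_cst.
    by apply: cintegrable_measurable; exact: cintegrableD.
  - by apply: schwartz_measurable; exact: schwartz_partial.
  - move=> x; have [d1 d2] := schwartz_cdiff x sf; split.
      by under eq_fun do rewrite ReD; exact: cvg_diffquo.
    by under eq_fun do rewrite ImD; exact: cvg_diffquo.
  - exact: (integrableZl measurableT (2 * (C * 2 ^+ n.*2)) (integrable_weight (leqnn _))).
  - move=> k x; rewrite (le_trans (normc_leD _))// ReD ImD -mulrA mulr_natl mulr2n lerD//.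
      apply: diffquo_le => // y; first by have [] := schwartz_cdiff y sf.
      exact: le_trans (normc_Re (partial i f y)) (hC y).
    apply: diffquo_le => // y; first by have [] := schwartz_cdiff y sf.
    exact: le_trans (normc_Im (partial i f y)) (hC y).
under eq_fun do rewrite D0.
by move/ccvg_climn <-; apply/ccvg_climn/ccvg_cst.
Qed.

Lemma fourier_partial f (i : 'I_n) xi : schwartz f ->
  fourier (partial i f) xi = Complex 0 (xi 0 i) * fourier f xi.
Proof.
move=> sf.
have sp := schwartz_fourier_phase xi sf.
have E : partial i (fun x => expi (- dotp x xi) * f x) =
    fun x => Complex 0 (- xi 0 i) * (expi (- dotp x xi) * f x) +
      expi (- dotp x xi) * partial i f x.
  have := @partial_expi _ _ i (- xi) 0.
  under eq_fun do rewrite add0r dotpNr.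
  under [X in _ = X -> _]eq_fun do rewrite add0r dotpNr mxE.
  move=> pe; rewrite partialM; last by move=> x; exact: schwartz_cdiff.
    by rewrite pe; apply/funext => x; rewrite mulrA.
  move=> x; have := @cdiff_expi _ _ x (- xi) 0.
  by under eq_fun do rewrite add0r dotpNr.
have := cint_partial i sp; rewrite E cintD; first last.
- apply: schwartz_cintegrable; apply: schwartz_fourier_phase; exact: schwartz_partial.
- by apply: cintegrableZ; exact: schwartz_cintegrable.
rewrite cintZ; last exact: schwartz_cintegrable.
rewrite -/(fourier f xi) -/(fourier (partial i f) xi) => /eqP; rewrite addr_eq0 => /eqP h.
apply/esym/eqP; rewrite -subr_eq0 -[X in _ - X]opprK -h.
apply/eqP; rewrite opprK -mulrDl; set c := _ + _.
suff -> : c = 0 by rewrite mul0r.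
by apply: complex_eqP; rewrite ?cReD ?cImD/= ?addr0 ?subrr.
Qed.

End integral_derivative.

(** * The Fourier transform on Schwartz functions *)

Section fourier_schwartz.
Context {R : realType} {n : nat}.
Implicit Types (f g : 'rV[R]_n -> R[i]) (x xi a : 'rV[R]_n).

Lemma expi_poly2 (s : R) : expi_poly 2 s = 1 + Complex 0 s.
Proof.
rewrite /expi_poly big_ord_recl big_ord_recl big_ord0 /= invr1.
by apply: complex_eqP; rewrite ?(cReM, cImM, cReD, cImD)/= !expr0 !expr1; ring.
Qed.

Lemma cintegrable_phase xi f : cintegrable f -> cintegrable (fun x => expi (- dotp x xi) * f x).
Proof.
move=> If; apply: cintegrable_dom (cintegrable_normc If).
  apply: cmeasurableM; [exact: cmeasurable_expi_dotp|exact: cintegrable_measurable].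
by move=> x; rewrite normcM normc_expi mul1r.
Qed.

Lemma normc_fourier_le f xi G : cmeasurable f -> (forall x, normc (f x) <= G x) ->
  (lebesgue_rV n).-integrable setT (EFin \o G) ->
  normc (fourier f xi) <= 2 * \int[lebesgue_rV n]_x G x.
Proof.
move=> mf fG iG; apply: normc_cint_le => //.
  apply: cmeasurableM => //; exact: cmeasurable_expi_dotp.
by move=> x; rewrite normcM normc_expi mul1r.
Qed.

(** Multiplication by [- i x_i], which the Fourier transform turns into a
    partial derivative. *)
Definition mulcoord (i : 'I_n) f : 'rV[R]_n -> R[i] := fun x => Complex 0 (- x 0 i) * f x.

Lemma mulcoordE i f : mulcoord i f = fun x => f x * ((Complex 0 (-1)) * (x 0 i)%:C%C).
Proof.
apply/funext => x; rewrite /mulcoord mulrC; congr (_ * _).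
by apply: complex_eqP; rewrite ?cReM ?cImM/=; ring.
Qed.

Lemma schwartz_mulcoord i f : schwartz f -> schwartz (mulcoord i f).
Proof.
move=> sf; rewrite mulcoordE.
under eq_fun do rewrite mulrCA; apply: schwartzZ.
exact: schwartzM sf (moderate_coord i).
Qed.

(** Differentiation under the integral sign: the remainder of the first order
    expansion of [expi (- dotp x h)] is [O(enorm x ^ 2 * enorm h ^ 2)], and
    [f] absorbs the first factor. *)
Lemma fourier_frechet f xi : schwartz f ->
  cdiff (fourier f) xi /\ forall i, partial i (fourier f) xi = fourier (mulcoord i f) xi.
Proof.
move=> sf; have mf := schwartz_measurable sf.
have If := schwartz_cintegrable sf.
have Ig i := schwartz_cintegrable (schwartz_mulcoord i sf).
have [C0 C00 hC0] := rapid_ge0 (n.*2 + 2) (schwartz_rapid [::] sf).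
pose W x := 2 * C0 * (1 + enorm x) ^- n.*2.
have iW : (lebesgue_rV n).-integrable setT (EFin \o W).
  exact: (integrableZl measurableT (2 * C0) (integrable_weight (leqnn _))).
pose C := 2 * \int[lebesgue_rV n]_x W x.
have key h : normc (fourier f (h + xi) - fourier f xi -
    \sum_i (h 0 i)%:C%C * fourier (mulcoord i f) xi) <= C * enorm h ^+ 2.
  (* the integrand of the error of the first order expansion in h *)
  pose rem x := expi (- dotp x xi) * ((expi (- dotp x h) - expi_poly 2 (- dotp x h)) * f x).
  have E : fourier f (h + xi) - fourier f xi -
      \sum_i (h 0 i)%:C%C * fourier (mulcoord i f) xi = cint rem.
    have E1 : \sum_i (h 0 i)%:C%C * fourier (mulcoord i f) xi =
        cint (fun x => \sum_i (h 0 i)%:C%C * (expi (- dotp x xi) * mulcoord i f x)).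
      rewrite cint_sum; last by move=> i _; apply: cintegrableZ; exact: cintegrable_phase.
      by apply: eq_bigr => i _; rewrite cintZ//; exact: cintegrable_phase.
    have N k : cintegrable k -> - cint k = cint (fun x => - 1 * k x) :> R[i].
      by move=> Ik; rewrite cintZ// mulN1r.
    have Is : cintegrable (fun x => \sum_i (h 0 i)%:C%C * (expi (- dotp x xi) * mulcoord i f x)).
      by apply: cintegrable_sum => i _; apply: cintegrableZ; exact: cintegrable_phase.
    have I1 := cintegrable_phase (h + xi) If.
    have I2 := cintegrableZ (-1) (cintegrable_phase xi If).
    have I3 := cintegrableZ (-1) Is.
    rewrite E1 [fourier f (h + xi)]/fourier [fourier f xi]/fourier.
    rewrite (N _ Is) (N _ (cintegrable_phase xi If)).
    rewrite -(cintD I1 I2) -(cintD (cintegrableD I1 I2) I3).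
    apply: eq_cint => x; rewrite /rem dotpDr opprD expiD.
    have -> : \sum_i (h 0 i)%:C%C * (expi (- dotp x xi) * mulcoord i f x) =
        Complex 0 (- dotp x h) * (expi (- dotp x xi) * f x).
      rewrite (_ : Complex 0 (- dotp x h) = \sum_i Complex 0 (- (x 0 i * h 0 i))); last first.
        rewrite /dotp -sumrN; apply: complex_eqP.
          by rewrite (big_morph (@complex.Re R) (@cReD R) erefl)/= big1.
        by rewrite (big_morph (@complex.Im R) (@cImD R) erefl).
      rewrite mulr_suml; apply: eq_bigr => i _; rewrite /mulcoord.
      rewrite [RHS]mulrA mulrA mulrA; congr (_ * _); rewrite mulrAC; congr (_ * _).
      by apply: complex_eqP; rewrite ?cReM ?cImM/=; ring.
    rewrite expi_poly2.
    ring.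
  rewrite E.
  have mr : cmeasurable rem.
    apply: cmeasurableM; first exact: cmeasurable_expi_dotp.
    apply: cmeasurableM => //.
    have -> : (fun x => expi (- dotp x h) - expi_poly 2 (- dotp x h)) =
       (fun x => expi (- dotp x h) + (- 1 + Complex 0 1 * (dotp x h)%:C%C)).
      apply/funext => x; congr (_ + _).
      rewrite expi_poly2.
      by apply: complex_eqP; rewrite ?cReN ?cImN ?cReD ?cImD ?cReM ?cImM/=; ring.
    apply: cmeasurableD; first exact: cmeasurable_expi_dotp.
    apply: cmeasurableD; first exact: cmeasurable_cst.
    apply: cmeasurableM; first exact: cmeasurable_cst.
    apply: cmeasurable_continuous; first exact: dotp_continuous_l.
    exact: cst_continuous.
  have rW x : normc (rem x) <= enorm h ^+ 2 * W x.
    rewrite !normcM normc_expi mul1r.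
    rewrite (le_trans (ler_pM (normc_ge0 _) (normc_ge0 _) (expi_taylor 2 _) (hC0 x)))//.
    rewrite /W normrN exprD invfM.
    have -> : 2 * `|dotp x h| ^+ 2 * (C0 * ((1 + enorm x) ^- n.*2 * (1 + enorm x) ^- 2)) =
      2 * C0 * (1 + enorm x) ^- n.*2 * (`|dotp x h| ^+ 2 * (1 + enorm x) ^- 2) by ring.
    rewrite [leRHS]mulrC ler_wpM2l//; first by rewrite !mulr_ge0// weight_ge0.
    rewrite ler_pdivrMr ?exprn_gt0 ?enorm1_gt0// -exprMn.
    rewrite lerXn2r ?nnegrE ?mulr_ge0 ?enorm_ge0 ?(ltW (enorm1_gt0 _))//.
    rewrite (le_trans (normr_dotp _ _))// mulrC ler_wpM2l ?enorm_ge0//.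
    by rewrite lerDr.
  have iW2 : (lebesgue_rV n).-integrable setT (EFin \o (fun x => enorm h ^+ 2 * W x)).
    exact: (integrableZl measurableT (enorm h ^+ 2) iW).
  rewrite (le_trans (normc_cint_le mr rW iW2))// RintegralZl//.
  by rewrite /C mulrCA mulrC.
pose br : 'rV[R]_n := \row_i complex.Re (fourier (mulcoord i f) xi).
pose bi : 'rV[R]_n := \row_i complex.Im (fourier (mulcoord i f) xi).
have Rsum (h : 'rV[R]_n) : complex.Re (\sum_i (h 0 i)%:C%C * fourier (mulcoord i f) xi) = dotp h br.
  rewrite (big_morph (@complex.Re R) (@cReD R) erefl).
  by apply: eq_bigr => i _; rewrite mxE cReM/= mul0r subr0.
have Isum (h : 'rV[R]_n) : complex.Im (\sum_i (h 0 i)%:C%C * fourier (mulcoord i f) xi) = dotp h bi.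
  rewrite (big_morph (@complex.Im R) (@cImD R) erefl).
  by apply: eq_bigr => i _; rewrite mxE cImM/= mul0r addr0.
have [D1 D1'] : differentiable (fun y => complex.Re (fourier f y)) xi /\
   forall v, 'D_v (fun y => complex.Re (fourier f y)) xi = dotp v br.
  apply: (@frechet_dotp _ _ _ _ _ C) => h; apply: le_trans (key h).
  by rewrite -Rsum -!cReN -!cReD; exact: normc_Re.
have [D2 D2'] : differentiable (fun y => complex.Im (fourier f y)) xi /\
   forall v, 'D_v (fun y => complex.Im (fourier f y)) xi = dotp v bi.
  apply: (@frechet_dotp _ _ _ _ _ C) => h; apply: le_trans (key h).
  by rewrite -Isum -!cImN -!cImD; exact: normc_Im.
split; first by split.
by move=> i; rewrite /partial D1' D2' !dotp_delta !mxE; case: (fourier _ _).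
Qed.

(** Multiplication by [xi_i] is differentiation on the other side, so
    induction on [M] reduces to boundedness of Fourier transforms. *)
Lemma fourier_coord_decay f M : schwartz f ->
  exists C, forall xi (i : 'I_n), `|xi 0 i| ^+ M * normc (fourier f xi) <= C.
Proof.
move=> sf; have H i : exists C, forall xi, `|xi 0 i| ^+ M * normc (fourier f xi) <= C.
  elim: M f sf => [|M IH] f sf.
    have [C hC] := schwartz_rapid [::] sf n.*2.
    exists (2 * \int[lebesgue_rV n]_x (C * (1 + enorm x) ^- n.*2)) => xi.
    rewrite expr0 mul1r; apply: normc_fourier_le => //; first exact: schwartz_measurable.
    exact: (integrableZl measurableT C (integrable_weight (leqnn _))).
  have [C hC] := IH _ (schwartz_partial i sf); exists C => xi.
  have := hC xi; rewrite fourier_partial// normcM.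
  by rewrite (_ : normc (Complex 0 (xi 0 i)) = `|xi 0 i|) ?mulrA -?exprSr//= expr0n/= add0r sqrtr_sqr.
pose C i := projT1 (cid (H i)).
exists (\big[Num.max/0]_i C i) => xi i.
apply: le_trans (projT2 (cid (H i)) xi) _.
exact: (le_bigmax _ C i).
Qed.

(** Bounds on the powers of the single coordinates yield a bound with the
    Euclidean weight: the largest coordinate, or [1], dominates up to the
    factor [n + 1]. *)
Lemma weight_le_coords (a C : R) M xi : 0 <= a -> a <= C -> (forall i, `|xi 0 i| ^+ M * a <= C) ->
  (1 + enorm xi) ^+ M * a <= n.+1%:R ^+ M * C.
Proof.
move=> a0 aC h.
pose m := \big[Num.max/1]_i `|xi 0 i|.
have m1 : 1 <= m by exact: bigmax_ge_id.
have xm i : `|xi 0 i| <= m by exact: (le_bigmax _ (fun i => `|xi 0 i|) i).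
have e : 1 + enorm xi <= n.+1%:R * m.
  rewrite -[n.+1%:R]natr1 mulrDl mul1r addrC lerD//.
  rewrite (le_trans (enorm_le_sum xi))// mulr_natl -[X in _ *+ X]card_ord -sumr_const.
  exact: ler_sum.
have mC : m ^+ M * a <= C.
  have [->|[i _ ->]] : m = 1 \/ exists2 i, true & m = `|xi 0 i|.
    rewrite /m; elim/big_ind: _ => [|x y hx hy|i _]; [by left| |by right; exists i].
    by rewrite /Num.max; case: ifP.
    by rewrite expr1n mul1r.
  exact: h.
apply: le_trans (_ : (n.+1%:R * m) ^+ M * a <= _).
  by rewrite ler_wpM2r// lerXn2r ?nnegrE ?(ltW (enorm1_gt0 _))// (le_trans _ e)// ltW// enorm1_gt0.
by rewrite exprMn -mulrA ler_wpM2l// exprn_ge0.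
Qed.

Lemma fourier_rapid f : schwartz f -> rapid (fourier f).
Proof.
move=> sf M; have [C0 h0] : exists C, forall xi, normc (fourier f xi) <= C.
  have [C hC] := schwartz_rapid [::] sf n.*2.
  exists (2 * \int[lebesgue_rV n]_x (C * (1 + enorm x) ^- n.*2)) => xi.
  apply: normc_fourier_le => //; first exact: schwartz_measurable.
  exact: (integrableZl measurableT C (integrable_weight (leqnn _))).
have [C hC] := fourier_coord_decay M sf.
exists (n.+1%:R ^+ M * Num.max C0 C) => xi.
rewrite ler_pdivlMr ?exprn_gt0 ?enorm1_gt0// mulrC; apply: weight_le_coords.
- exact: normc_ge0.
- by rewrite le_max h0.
- by move=> i; rewrite le_max hC orbT.
Qed.

Lemma fourier_partialE f i : schwartz f -> partial i (fourier f) = fourier (mulcoord i f).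
Proof. by move=> sf; apply/funext => xi; exact: (fourier_frechet xi sf).2. Qed.

(** Fourier transforms of Schwartz functions form a class stable under
    derivatives, so rapid decay suffices. *)
Lemma schwartz_fourier f : schwartz f -> schwartz (fourier f).
Proof.
move=> sf; apply: (@schwartz_class _ _ (fun h => exists2 f, schwartz f & h = fourier f)).
- by move=> _ xi [p sp ->]; exact: (fourier_frechet xi sp).1.
- move=> _ i [p sp ->]; exists (mulcoord i p); first exact: schwartz_mulcoord.
  exact: fourier_partialE.
- by move=> _ [p sp ->]; exact: fourier_rapid.
- by exists f.
Qed.

End fourier_schwartz.

(** * Multiplication formula and Fourier inversion *)

Lemma cReMr (R : realType) (z : R[i]) (r : R) : complex.Re (z * r%:C%C) = complex.Re z * r.
Proof. by rewrite cReM /= mulr0 subr0. Qed.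

Lemma cImMr (R : realType) (z : R[i]) (r : R) : complex.Im (z * r%:C%C) = complex.Im z * r.
Proof. by rewrite cImM /= mulr0 add0r. Qed.

Lemma real_complexM (R : realType) (a b : R) : (a * b)%:C%C = a%:C%C * b%:C%C :> R[i].
Proof. by apply: complex_eqP; rewrite ?cReM ?cImM/= ?(mulr0, mul0r, subr0, addr0). Qed.

Section measurable_products.
Context {R : realType} d (T : measurableType d).
Implicit Types F G : T -> R[i].

(** Functions of two vectors live on a product, not on a space of row vectors,
    hence this version of [cmeasurable] on general measurable types. *)
Definition cmeas F := measurable_fun setT (fun z => complex.Re (F z)) /\
  measurable_fun setT (fun z => complex.Im (F z)).

Lemma cmeasM F G : cmeas F -> cmeas G -> cmeas (fun z => F z * G z).
Proof.
move=> [f1 f2] [g1 g2]; split.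
  by under eq_fun do rewrite cReM; apply: measurable_funB; exact: measurable_funM.
by under eq_fun do rewrite cImM; apply: measurable_funD; exact: measurable_funM.
Qed.

Lemma cmeas_expi (h : T -> R) : measurable_fun setT h -> cmeas (fun z => expi (h z)).
Proof.
move=> mh; split => /=.
  apply: (measurableT_comp (f := @cos R)) => //.
  by apply: continuous_measurable_fun; exact: continuous_cos.
apply: (measurableT_comp (f := @sin R)) => //.
by apply: continuous_measurable_fun; exact: continuous_sin.
Qed.

End measurable_products.

Section inversion.
Context {R : realType} {n : nat}.
Implicit Types (f g : 'rV[R]_n -> R[i]) (x y xi a : 'rV[R]_n).
Notation V := 'rV[R]_n.

Lemma cmeas_fst f : cmeasurable f -> cmeas (fun z : V * V => f z.1).
Proof. by move=> [f1 f2]; split; [exact: measurableT_comp f1 _|exact: measurableT_comp f2 _]. Qed.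

Lemma cmeas_snd f : cmeasurable f -> cmeas (fun z : V * V => f z.2).
Proof. by move=> [f1 f2]; split; [exact: measurableT_comp f1 _|exact: measurableT_comp f2 _]. Qed.

Lemma measurable_dotp2 : measurable_fun setT (fun z : V * V => dotp z.1 z.2).
Proof.
rewrite /dotp; apply: measurable_sum => i.
apply: measurable_funM.
  exact: measurableT_comp (measurable_coord i) _.
exact: measurableT_comp (measurable_coord i) _.
Qed.

(** Fubini: both sides are the double integral of [f x * g y * expi (- dotp x
    y)]. *)
Lemma fourier_multiplication f g : cintegrable f -> cintegrable g ->
  cint (fun xi => fourier f xi * g xi) = cint (fun x => f x * fourier g x).
Proof.
move=> If Ig; have [mf mg] := (cintegrable_measurable If, cintegrable_measurable Ig).
pose F (z : V * V) : R[i] := expi (- dotp z.1 z.2) * (f z.2 * g z.1).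
have [m1 m2] : cmeas F.
  apply: cmeasM; last by apply: cmeasM; [exact: cmeas_snd|exact: cmeas_fst].
  by apply: cmeas_expi; apply: measurable_funN; exact: measurable_dotp2.
have H := cint_fubini m1 m2 (cintegrable_normc Ig) (cintegrable_normc If).
transitivity (cint (fun x => cint (fun y => F (x, y)))).
  apply: eq_cint => xi; rewrite /fourier mulrC -cintZ; last exact: cintegrable_phase.
  by apply: eq_cint => x; rewrite /F/= dotpC; ring.
rewrite H; last by move=> x y; rewrite /F/= !normcM normc_expi mul1r mulrC.
apply: eq_cint => x; rewrite /fourier -cintZ; last exact: cintegrable_phase.
by apply: eq_cint => xi; rewrite /F/=; ring.
Qed.

Lemma fourier_shift f a xi : fourier (fun x => expi (dotp a x) * f x) xi = fourier f (xi - a).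
Proof.
apply: eq_cint => x; rewrite mulrA -expiD; congr (expi _ * _).
by rewrite dotpDr dotpNr opprD opprK (dotpC a).
Qed.

Let K x : R[i] := (laplaceV x)%:C%C.

Let measurable_laplaceV : measurable_fun setT (@laplaceV R n).
Proof. exact/measurable_EFinP/measurable_int/integrable_laplaceV. Qed.

Let cintegrable_K : cintegrable K.
Proof. by split; [exact: integrable_laplaceV|exact: integrable0]. Qed.

Let fourier_K z : fourier K z = (2 ^+ n * cauchyV z)%:C%C.
Proof.
have [c1 s1 c2 s2] := fourier_laplaceV z.
apply: complex_eqP.
  rewrite [RHS]/= -c2; apply: eq_Rintegral => x _.
  by rewrite cReMr /= cosN mulrC.
rewrite [RHS]/= -[RHS]oppr0 -s2 -mulN1r -RintegralZl//; apply: eq_Rintegral => x _.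
by rewrite cImMr /= sinN mulN1r mulNr mulrC.
Qed.

Let laplaceVE x : laplaceV x = expR (- \sum_i `|x 0 i|).
Proof. by rewrite -sumrN expR_sum. Qed.

Let laplaceV_ge0 x : 0 <= laplaceV x.
Proof. by rewrite laplaceVE expR_ge0. Qed.

Let laplaceV_le1 x : laplaceV x <= 1.
Proof. by rewrite laplaceVE -expR0 ler_expR oppr_le0 sumr_ge0. Qed.

Let laplaceVZ (e : R) x : 0 <= e -> laplaceV (e *: x) = expR (- (e * \sum_i `|x 0 i|)).
Proof.
move=> e0; rewrite laplaceVE mulr_sumr; congr (expR (- _)).
by apply: eq_bigr => i _; rewrite mxE normrM ger0_norm.
Qed.

Lemma cauchyV_ge0 x : 0 <= cauchyV x.
Proof. by apply: prodr_ge0 => i _; exact/ltW/inv1Dsqr_gt0. Qed.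

Let cauchyV_le1 x : cauchyV x <= 1.
Proof.
rewrite /cauchyV; apply: prodr_ile1 => i _; rewrite ltW ?inv1Dsqr_gt0//=.
by rewrite invf_le1 ?ltr_pwDl ?sqr_ge0// lerDl sqr_ge0.
Qed.

Let measurable_cauchyV : measurable_fun setT (@cauchyV R n).
Proof. exact/measurable_EFinP/measurable_int/integrable_cauchyV. Qed.

Let cintegrable_fourierM f g : schwartz f -> cmeasurable g -> (forall x, normc (g x) <= 1) ->
  cintegrable (fun x => f x * g x).
Proof.
move=> sf mg g1; have If := schwartz_cintegrable sf.
apply: cintegrable_dom (cintegrable_normc If).
  by apply: cmeasurableM => //; exact: schwartz_measurable.
by move=> x; rewrite normcM ler_piMr ?normc_ge0.
Qed.

Let cauchyC x : R[i] := (2 ^+ n * cauchyV x)%:C%C.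

(** Multiplication formula for [f] and the modulated rescaled kernel, whose
    Fourier transform is an approximate identity around [a]. *)
Let inversion_eps f a (e : R) : 0 < e -> schwartz f ->
  cint (fun xi => fourier f xi * (expi (dotp xi a) * K (e *: xi))) =
  cint (fun z => f (a + e *: z) * cauchyC z).
Proof.
move=> e0 sf; have If := schwartz_cintegrable sf.
have mexp : cmeasurable (fun xi => expi (dotp xi a)).
  by apply: cmeasurable_expi; exact: dotp_continuous_l.
have IKe : cintegrable (fun x => K (e *: x)).
  have := cintegrable_affine 0 e0 cintegrable_K.
  by under eq_fun do rewrite add0r.
pose g xi := expi (dotp xi a) * K (e *: xi).
have Ig : cintegrable g.
  apply: cintegrable_dom (cintegrable_normc IKe).
    by apply: cmeasurableM => //; exact: cintegrable_measurable.
  by move=> x; rewrite normcM normc_expi mul1r.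
rewrite (fourier_multiplication If Ig).
have fg x : fourier g x = (e ^- n)%:C%C * cauchyC (e^-1 *: (x - a)).
  rewrite /cauchyC -fourier_K /fourier -(cint_affine 0 e0); last exact: cintegrable_phase.
  apply: eq_cint => xi; rewrite /g add0r mulrA -expiD; congr (expi _ * _).
  rewrite dotpZl dotpZr mulrA divff ?gt_eqF// mul1r dotpDr dotpNr; ring.
(* substituting x = a + e z turns Q into the integrand of the right-hand side *)
pose Q x := f x * ((e ^- n)%:C%C * cauchyC (e^-1 *: (x - a))).
have IQ : cintegrable Q.
  have -> : Q = fun x => (e ^- n * 2 ^+ n)%:C%C * (f x * (cauchyV (e^-1 *: (x - a)))%:C%C).
    by apply/funext => x; rewrite /Q /cauchyC [RHS]mulrCA -!real_complexM !mulrA.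
  apply: cintegrableZ; apply: cintegrable_fourierM => //.
    split => /=; last exact: measurable_cst.
    rewrite (_ : (fun x => _) = @cauchyV R n \o (fun x => - (e^-1 *: a) + e^-1 *: x)).
      exact: measurableT_comp measurable_cauchyV (measurable_affine _ _).
    by apply/funext => x; rewrite /= scalerBr addrC.
  by move=> x; rewrite normcR ger0_norm ?cauchyV_ge0.
have en0 : e ^+ n != 0 by rewrite expf_neq0// gt_eqF.
have -> : cint (fun x => f x * fourier g x) = cint Q by apply: eq_cint => x; rewrite fg.
have H := cint_affine a e0 IQ.
transitivity ((e ^+ n)%:C%C * cint (fun z => Q (a + e *: z))).
  by rewrite H mulrA -real_complexM divff// mul1r.
rewrite -cintZ; last exact: cintegrable_affine.
apply: eq_cint => z; rewrite /Q addrAC subrr add0r scalerA mulVf ?gt_eqF// scale1r.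
by rewrite mulrCA [X in _ * X]mulrA -real_complexM divff// mul1r.
Qed.

(** Both sides of [inversion_eps] converge dominatedly as [e] tends to [0];
    the constant is [2^n] times the integral [pi^n] of [cauchyV]. *)
Lemma fourier_inversion f a : schwartz f ->
  cint (fun xi => expi (dotp a xi) * fourier f xi) = ((2 * pi) ^+ n)%:C%C * f a.
Proof.
move=> sf; have If := schwartz_cintegrable sf.
have sF := schwartz_fourier sf; have IF := schwartz_cintegrable sF.
pose e (k : nat) : R := k.+1%:R^-1.
have e0 k : 0 < e k by rewrite invr_gt0 ltr0Sn.
have ec : e @ \oo --> (0 : R) by exact: cvg_harmonic.
have mexp : cmeasurable (fun xi => expi (dotp xi a)).
  by apply: cmeasurable_expi; exact: dotp_continuous_l.
have C1 : ccvg (fun k => cint (fun xi => fourier f xi * (expi (dotp xi a) * K (e k *: xi))))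
    (cint (fun xi => expi (dotp a xi) * fourier f xi)).
  apply: (cint_dom_cvg _ _ _ (cintegrable_normc IF)).
  - move=> k; apply: cmeasurableM; first exact: schwartz_measurable.
    apply: cmeasurableM => //; split => /=; last exact: measurable_cst.
    rewrite (_ : (fun x => _) = @laplaceV R n \o (fun x => 0 + e k *: x)).
      exact: measurableT_comp measurable_laplaceV (measurable_affine _ _).
    by apply/funext => x; rewrite /= add0r.
  - apply: cmeasurableM; last exact: schwartz_measurable.
    by under eq_fun do rewrite dotpC.
  - move=> xi.
    rewrite (_ : expi (dotp a xi) * _ = fourier f xi * (expi (dotp xi a) * 1)); last first.
      by rewrite mulr1 mulrC dotpC.
    apply: ccvgM; first exact: ccvg_cst.
    apply: ccvgM; first exact: ccvg_cst.
    split => /=; last exact: cvg_cst.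
    under eq_fun do rewrite laplaceVZ ?ltW//.
    have : (fun k => expR (- (e k * \sum_i `|xi 0 i|))) @ \oo --> expR (- (0 * \sum_i `|xi 0 i|)).
      apply: continuous_cvg; first exact: continuous_expR.
      by apply: cvgN; apply: cvgM; [exact: ec|exact: cvg_cst].
    by rewrite mul0r oppr0 expR0.
  - move=> k xi; rewrite !normcM normc_expi mul1r ler_piMr ?normc_ge0//.
    by rewrite normcR ger0_norm.
have [M M0 hM] := rapid_ge0 0 (schwartz_rapid [::] sf).
have Icauchy : cintegrable cauchyC.
  split; last exact: integrable0.
  exact: (integrableZl measurableT (2 ^+ n) (integrable_cauchyV n)).
have C2 : ccvg (fun k => cint (fun z => f (a + e k *: z) * cauchyC z))
    (cint (fun z => f a * cauchyC z)).
  apply: (@cint_dom_cvg _ _ _ _ (fun z => M * normc (cauchyC z))).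
  - move=> k; apply: cmeasurableM; last exact: cintegrable_measurable.
    exact/cintegrable_measurable/cintegrable_affine.
  - by apply: cmeasurableM; [exact: cmeasurable_cst|exact: cintegrable_measurable].
  - move=> z; apply: ccvgM; last exact: ccvg_cst.
    have az : (fun k => a + e k *: z) @ \oo --> a.
      have : (fun k => a + e k *: z) @ \oo --> a + 0 *: z.
        by apply: cvgD; [exact: cvg_cst|apply: cvgZr_tmp; exact: ec].
      by rewrite scale0r addr0.
    have [c1 c2] := smooth_continuous sf.1.
    split.
      exact: (cvg_comp _ _ az (c1 a)).
    exact: (cvg_comp _ _ az (c2 a)).
  - exact: (integrableZl measurableT M (cintegrable_normc Icauchy)).
  - move=> k z; rewrite normcM ler_wpM2r ?normc_ge0//.
    by have := hM (a + e k *: z); rewrite expr0 invr1 mulr1.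
have := ccvg_unique C1; under eq_fun do rewrite inversion_eps//.
move=> /(_ _ C2) ->; rewrite cintZ// mulrC; congr (_ * _).
apply: complex_eqP; last by rewrite /= /Rintegral integral0.
rewrite /= RintegralZl//; last exact: integrable_cauchyV.
by rewrite Rintegral_cauchyV exprMn.
Qed.

Lemma fourier_inj f : schwartz f -> (forall xi, fourier f xi = 0) -> forall x, f x = 0.
Proof.
move=> sf f0 x; have := fourier_inversion x sf.
under eq_cint do rewrite f0 mulr0.
rewrite cint0 => /esym/eqP; rewrite mulf_eq0 => /orP[|/eqP//].
rewrite -normc_eq0 normcR normr_eq0 expf_eq0 mulf_eq0 pnatr_eq0/= => /andP[_].
by rewrite gt_eqF// pi_gt0.
Qed.

(** By inversion, [g] is the transform of the conjugate of the transform of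
    its conjugate, up to the factor [(2 pi)^n]. *)
Lemma fourier_surj g : schwartz g -> exists2 f, schwartz f & fourier f = g.
Proof.
move=> sg; have sc := schwartz_conj sg.
pose c : R[i] := ((2 * pi) ^- n)%:C%C.
have p0 : (2 * pi) ^+ n != 0 :> R by rewrite expf_neq0// mulf_neq0// gt_eqF// pi_gt0.
exists (fun xi => c * conjc (fourier (fun x => conjc (g x)) xi)).
  by apply: schwartzZ; apply: schwartz_conj; exact: schwartz_fourier.
apply/funext => x.
have Iw : cintegrable (fun xi => expi (- dotp xi x) * conjc (fourier (fun x => conjc (g x)) xi)).
  by apply: cintegrable_phase; apply: schwartz_cintegrable; apply: schwartz_conj; exact: schwartz_fourier.
transitivity (c * cint (fun xi => expi (- dotp xi x) * conjc (fourier (fun x => conjc (g x)) xi))).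
  by rewrite -cintZ//; apply: eq_cint => xi; rewrite mulrCA.
have -> : cint (fun xi => expi (- dotp xi x) * conjc (fourier (fun x => conjc (g x)) xi)) =
    conjc (cint (fun xi => expi (dotp x xi) * fourier (fun x => conjc (g x)) xi)).
  rewrite -cint_conj; last first.
    have := cintegrable_phase (- x) (schwartz_cintegrable (schwartz_fourier sc)).
    by under eq_fun do rewrite dotpNr opprK dotpC.
  by apply: eq_cint => xi; rewrite conjcM conj_expi (dotpC x).
rewrite (fourier_inversion x sc) conjcM conjcK conjc_real mulrA /c -real_complexM.
by rewrite mulVf// mul1r.
Qed.

End inversion.

(** * Unique continuation for band-limited functions *)

Section bandlimited.
Context {R : realType} {n : nat}.
Implicit Types (v : 'rV[R]_n -> R[i]) (x y xi a : 'rV[R]_n).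

Variables (v : 'rV[R]_n -> R[i]) (B : R).
Hypotheses (sv : schwartz v) (B0 : 0 < B)
  (suppv : forall xi, fourier v xi != 0 -> enorm xi <= B).

(** Analyticity made quantitative. The function [t |-> v (x0 + t y)] is, up to
    a constant, the integral of [expi (t s) g] with [`|s| <= 1/2] on the
    support of [g], so its Taylor expansion at [0] converges up to [t = 1].
    All its coefficients vanish since the function is zero for small [t]. *)
Let vanish_step x0 (delta : R) y : 0 < delta ->
  (forall x, enorm (x - x0) < delta -> v x = 0) -> enorm y <= (2 * B)^-1 ->
  v (x0 + y) = 0.
Proof.
move=> d0 v0 yB.
have sF := schwartz_fourier sv.
pose g xi : R[i] := expi (dotp x0 xi) * fourier v xi.
have Ig : cintegrable g.
  have := cintegrable_phase (- x0) (schwartz_cintegrable sF).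
  by under eq_fun do rewrite dotpNr opprK dotpC.
pose s xi : R := dotp y xi.
have ms : measurable_fun setT s.
  by rewrite /s; under eq_fun do rewrite dotpC; apply: continuous_measurable_rV; exact: dotp_continuous_l.
have sg xi : g xi != 0 -> `|s xi| <= 2^-1.
  rewrite /g mulf_eq0 negb_or => /andP[_ /suppv xB].
  rewrite (le_trans (normr_dotp _ _))// (le_trans (ler_pM (enorm_ge0 _) (enorm_ge0 _) yB xB))//.
  by rewrite invfM -mulrA mulVf ?mulr1// gt_eqF.
pose T (t : R) : R[i] := cint (fun xi => expi (t * s xi) * g xi).
have TE t : T t = ((2 * pi) ^+ n)%:C%C * v (x0 + t *: y).
  rewrite -(fourier_inversion _ sv); apply: eq_cint => xi.
  by rewrite /g mulrA -expiD dotpDl dotpZl addrC.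
(* the k-th Taylor coefficient at 0 of T *)
pose m k : R[i] := cint (fun xi => (s xi ^+ k)%:C%C * expi_coef k * g xi).
pose J := \int[lebesgue_rV n]_xi normc (g xi).
have J0 : 0 <= J by apply: Rintegral_ge0 => xi _; exact: normc_ge0.
have msk k : cmeasurable (fun xi => (s xi ^+ k)%:C%C * (expi_coef k : R[i])).
  apply: cmeasurableM; last exact: cmeasurable_cst.
  by split => /=; [exact: measurable_funX|exact: measurable_cst].
have sk1 k xi : `|s xi| ^+ k * normc (g xi) <= 2^-1 ^+ k * normc (g xi).
  have [g0|g0] := eqVneq (g xi) 0; first by rewrite g0 normc0 !mulr0.
  by rewrite ler_wpM2r ?normc_ge0// lerXn2r ?nnegrE// sg.
have Ik k : cintegrable (fun xi => (s xi ^+ k)%:C%C * expi_coef k * g xi).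
  apply: cintegrable_dom (_ : forall xi, _ <= normc (expi_coef k : R[i]) * normc (g xi)) _.
  - by apply: cmeasurableM => //; exact: cintegrable_measurable.
  - move=> xi; rewrite (normcM _ (g xi)) (normcM _ (expi_coef k)) normcR normrX.
    rewrite -mulrA mulrCA ler_wpM2l ?normc_ge0//.
    by rewrite (le_trans (sk1 _ _))// ler_piMl ?normc_ge0// exprn_ile1// invf_le1// ler1n.
  - exact: (integrableZl measurableT _ (cintegrable_normc Ig)).
have taylor K t : normc (T t - \sum_(k < K) (t ^+ k)%:C%C * m k) <= 2 * (2 * (`|t| / 2) ^+ K * J).
  have mts : cmeasurable (fun xi => expi (t * s xi)).
    by apply: cmeas_expi; exact: measurable_funM.
  have I1 : cintegrable (fun xi => expi (t * s xi) * g xi).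
    apply: cintegrable_dom (cintegrable_normc Ig).
      by apply: cmeasurableM => //; exact: cintegrable_measurable.
    by move=> xi; rewrite normcM normc_expi mul1r.
  have I2 : cintegrable (fun xi => \sum_(k < K) (t ^+ k)%:C%C * ((s xi ^+ k)%:C%C * expi_coef k * g xi)).
    by apply: cintegrable_sum => k _; exact: cintegrableZ.
  have E : (fun xi => (expi (t * s xi) - expi_poly K (t * s xi)) * g xi) =
      fun xi => expi (t * s xi) * g xi +
        - 1 * \sum_(k < K) (t ^+ k)%:C%C * ((s xi ^+ k)%:C%C * expi_coef k * g xi).
    apply/funext => xi; rewrite mulN1r mulrBl /expi_poly mulr_suml; congr (_ - _).
    by apply: eq_bigr => k _; rewrite exprMn real_complexM !mulrA.
  have -> : T t - \sum_(k < K) (t ^+ k)%:C%C * m k =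
      cint (fun xi => (expi (t * s xi) - expi_poly K (t * s xi)) * g xi).
    have -> : \sum_(k < K) (t ^+ k)%:C%C * m k =
        cint (fun xi => \sum_(k < K) (t ^+ k)%:C%C * ((s xi ^+ k)%:C%C * expi_coef k * g xi)).
      rewrite cint_sum; last by move=> k _; exact: cintegrableZ.
      by apply: eq_bigr => k _; rewrite cintZ.
    by rewrite E (cintD I1 (cintegrableZ _ I2)) (cintZ _ I2) mulN1r.
  apply: le_trans (_ : 2 * \int[lebesgue_rV n]_xi (2 * (`|t| / 2) ^+ K * normc (g xi)) <= _); last first.
    by rewrite RintegralZl//; exact: cintegrable_normc.
  apply: normc_cint_le.
  - by rewrite E; exact: cintegrable_measurable (cintegrableD I1 (cintegrableZ _ I2)).
  - move=> xi; rewrite normcM (le_trans (ler_wpM2r (normc_ge0 _) (expi_taylor K _)))//.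
    rewrite normrM exprMn -!mulrA ler_wpM2l// exprMn -mulrA ler_wpM2l ?exprn_ge0//.
  - exact: (integrableZl measurableT _ (cintegrable_normc Ig)).
have [e e0 Te] : exists2 e : R, 0 < e & forall t, 0 < t -> t < e -> T t = 0.
  exists (delta / (1 + enorm y)); first by rewrite divr_gt0// enorm1_gt0.
  move=> t t0 te; rewrite TE v0 ?mulr0// addrAC subrr add0r enormZ ger0_norm ?ltW//.
  move: te; rewrite ltr_pdivlMr ?enorm1_gt0//; apply: le_lt_trans.
  by rewrite ler_wpM2l ?(ltW t0)// lerDr.
(* T vanishes near 0, so the first nonzero coefficient would dominate the expansion of T for small t *)
have m0 k : m k = 0.
  have [N] := ubnP k; elim: N k => // N IH k; rewrite ltnS => kN.
  have h t : 0 < t -> t < e -> normc (m k) <= 4 * J * t.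
    move=> t0 te; have := taylor k.+1 t; rewrite (Te t t0 te) big_ord_recr/= big1; last first.
      by move=> i _; rewrite IH ?mulr0// (leq_trans (ltn_ord i)).
    rewrite sub0r add0r normc_opp normcM normcR normrX (gtr0_norm t0).
    rewrite exprMn exprSr => H.
    have {H} : t ^+ k * normc (m k) <= t ^+ k * (4 * J * t * 2^-1 ^+ k.+1).
      by apply: le_trans H _; rewrite le_eqVlt; apply/orP; left; apply/eqP; ring.
    rewrite ler_pM2l ?exprn_gt0// => /le_trans; apply.
    apply: ler_piMr; first by rewrite !mulr_ge0// (ltW t0).
    by rewrite exprn_ile1// invf_le1// ler1n.
  apply/eqP; rewrite -normc_eq0 eq_le normc_ge0 andbT; apply/ler_addgt0Pl => eps eps0.
  pose t := Num.min (e / 2) (eps / (4 * J + 1)).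
  have J1 : 0 < 4 * J + 1 by rewrite ltr_wpDl// mulr_ge0.
  have t0 : 0 < t by rewrite lt_min !divr_gt0.
  have te : t < e by rewrite gt_min ltr_pdivrMr// ltr_pMr// ltr1n.
  rewrite addr0 (le_trans (h t t0 te))//.
  have : t <= eps / (4 * J + 1) by rewrite ge_min lexx orbT.
  rewrite ler_pdivlMr// => /(le_trans _); apply.
  by rewrite mulrC ler_wpM2l ?(ltW t0)// lerDl.
(* the Taylor remainder of order K at t = 1 is O(2^-K) *)
have T1 : T 1 = 0.
  apply/eqP; rewrite -normc_eq0 eq_le normc_ge0 andbT.
  have lim0 : (fun K => 2 * (2 * (1 / 2) ^+ K * J)) @ \oo --> (0 : R).
    rewrite (_ : (fun K => _) = (fun K => (4 * J) * (1 / 2) ^+ K)); last first.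
      by apply/funext => K; ring.
    rewrite -(mulr0 (4 * J)); apply: cvgM; first exact: cvg_cst.
    by apply: cvg_expr; rewrite mul1r ger0_norm// invf_lt1// ltr1n.
  rewrite -(cvg_lim (@Rhausdorff R) lim0); apply: limr_ge; first exact: cvgP lim0.
  apply: nearW => K; have := taylor K 1; rewrite normr1 big1 ?subr0// => k _.
  by rewrite m0 mulr0.
move: T1; rewrite TE scale1r => /eqP; rewrite mulf_eq0 => /orP[|/eqP//].
rewrite -normc_eq0 normcR normr_eq0 expf_eq0 mulf_eq0 pnatr_eq0/= => /andP[_].
by rewrite gt_eqF// pi_gt0.
Qed.

(** The region where [v] is known to vanish is extended by a fixed distance at
    each step, along a segment from [x0] to [x]. *)
Lemma bandlimited_unique_continuation x0 (delta : R) : 0 < delta ->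
  (forall x, enorm (x - x0) < delta -> v x = 0) -> forall x, v x = 0.
Proof.
move=> d0 v0 x; pose r := (2 * B)^-1 / 2.
have r0 : 0 < r by rewrite divr_gt0// invr_gt0 mulr_gt0.
have stp y z : (forall x, enorm (x - y) < r -> v x = 0) -> enorm (z - y) <= r ->
    forall x, enorm (x - z) < r -> v x = 0.
  move=> vy zy u uz; rewrite -(subrK y u) addrC; apply: (vanish_step r0 vy).
  rewrite -(subrK z u) -addrA (le_trans (enormD _ _))//.
  have -> : (2 * B)^-1 = r + r by rewrite /r -mulrDr -[2^-1]mul1r -splitr mulr1.
  by rewrite lerD// ltW.
have start : forall x, enorm (x - x0) < r -> v x = 0.
  move=> u ur; rewrite -(subrK x0 u) addrC; apply: (vanish_step d0 v0).
  rewrite (le_trans (ltW ur))// /r ler_pdivrMr// ler_peMr ?invr_ge0 ?mulr_ge0 ?(ltW B0)// ler1n//.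
(* the number of steps of length at most r that lead from x0 to x *)
pose N := (Num.bound (enorm (x - x0) / r)).+1.
have Nr : enorm (x - x0) / N%:R <= r.
  rewrite ler_pdivrMr ?ltr0Sn// mulrC -ler_pdivrMr//.
  rewrite ltW// (lt_le_trans (archi_boundP _))// ?ler_nat// divr_ge0 ?enorm_ge0 ?ltW//.
have chain k : forall u, enorm (u - (x0 + (k%:R / N%:R) *: (x - x0))) < r -> v u = 0.
  elim: k => [|k IH]; first by rewrite mul0r scale0r addr0.
  apply: (stp _ _ IH).
  rewrite opprD addrACA subrr add0r -scalerBl -mulrBl -natrB// subSnn mul1r.
  by rewrite enormZ ger0_norm ?invr_ge0// mulrC.
apply: (chain N); rewrite divff ?pnatr_eq0// scale1r (addrC x0) subrK subrr enorm0.
exact: r0.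
Qed.

End bandlimited.

(** * The lacunary series as a distribution *)

Section wdist_terms.
Context {R : realType} {n : nat}.
Implicit Types (f phi psi : 'rV[R]_n -> R[i]) (x xi : 'rV[R]_n).

Definition wcoef (d : R) (j : nat) : R := 2 `^ (- j%:R * d).

Lemma wcoef_gt0 d j : 0 < wcoef d j.
Proof. by apply: powR_gt0. Qed.

Lemma wcoef_ge0 d j : 0 <= wcoef d j.
Proof. exact/ltW/wcoef_gt0. Qed.

Lemma wcoef_le d : exists m : nat, forall j, wcoef d j <= (2 ^+ j) ^+ m.
Proof.
exists (Num.bound `|d|) => j; rewrite -exprM -powR_mulrn// /wcoef.
apply: ler_powR; first by rewrite ler1n.
rewrite natrM mulNr -mulrN ler_wpM2l// ltW//.
by rewrite (le_lt_trans (ler_norm _))// normrN archi_boundP.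
Qed.

Variables (theta : 'rV[R]_n) (d : R).
Hypothesis theta1 : enorm theta = 1.

Lemma enorm_dyadic j : enorm ((2 ^+ j : R) *: theta) = 2 ^+ j.
Proof. by rewrite enormZ theta1 mulr1 ger0_norm// exprn_ge0. Qed.

(** Rapid decay of order [N + m + 1] in [enorm xi + 2 ^+ j] pays for the
    growth [(2 ^+ j) ^+ m] of the coefficients, for the decay in [xi], and for
    a factor [2 ^- j] that makes the terms summable. *)
Lemma far_terms (G : 'rV[R]_n -> R[i]) (c : R) N : rapid G -> 0 < c ->
  exists2 C, 0 <= C & forall xi j,
    c * (1 + enorm xi + 2 ^+ j) <= 1 + enorm (xi - 2 ^+ j *: theta) ->
    normc ((wcoef d j)%:C%C * G (xi - 2 ^+ j *: theta)) <=
      C * (1 + enorm xi) ^- N * 2 ^- j.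
Proof.
move=> rG c0; have [m hm] := wcoef_le d.
have [C C0 hC] := rapid_ge0 (N + m.+1) rG.
exists (C * c ^- (N + m.+1)); first by rewrite mulr_ge0// invr_ge0 exprn_ge0// ltW.
move=> xi j; set a := 1 + enorm xi; set b := 2 ^+ j; set e := 1 + enorm _ => h.
have a0 : 0 < a by exact: enorm1_gt0.
have b0 : 0 < b by rewrite exprn_gt0.
rewrite normcM normcR (ger0_norm (wcoef_ge0 _ _)).
apply: le_trans (ler_pM (wcoef_ge0 _ _) (normc_ge0 _) (hm j) (hC _)) _.
rewrite -/e -/b.
have [[a0' b0'] c0'] := (ltW a0, ltW b0, ltW c0).
have ab0 : 0 <= a + b by rewrite addr_ge0.
have pw (p q : R) k : 0 <= p -> p <= q -> p ^+ k <= q ^+ k.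
  by move=> p0 pq; rewrite lerXn2r ?nnegrE// (le_trans p0).
have e1 : e ^- (N + m.+1) <= c ^- (N + m.+1) * (a ^- N * b ^- m.+1).
  rewrite -invfM -invfM lef_pV2 ?posrE ?mulr_gt0 ?exprn_gt0 ?enorm1_gt0//.
  apply: le_trans (_ : (c * (a + b)) ^+ (N + m.+1) <= _).
    rewrite exprMn ler_wpM2l ?exprn_ge0// exprD.
    by rewrite ler_pM ?exprn_ge0// pw// ?lerDl ?lerDr.
  by rewrite pw// mulr_ge0.
apply: le_trans (_ : b ^+ m * (C * (c ^- (N + m.+1) * (a ^- N * b ^- m.+1))) <= _).
  by rewrite ler_wpM2l ?exprn_ge0 ?(ltW b0)// ler_wpM2l.
rewrite le_eqVlt; apply/orP; left; apply/eqP.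
rewrite (exprS b) invfM; have : b ^+ m * b ^- m = 1 by rewrite divff// expf_neq0// gt_eqF.
move: (b ^+ m) => u; move: (c ^- _) (a ^- N) (u^-1) (b^-1) => p q r t ur.
by transitivity (C * p * q * t * (u * r)); [ring|rewrite ur mulr1].
Qed.

(** For fixed [xi] the hypothesis of [far_terms] holds for all [j]; the
    constant depends on [xi], which is enough for convergence but not for
    decay. *)
Lemma near_zero_far xi j :
  (1 + enorm xi) ^- 2 * (1 + enorm xi + 2 ^+ j) <= 1 + enorm (xi - 2 ^+ j *: theta).
Proof.
rewrite mulrC ler_pdivrMr ?exprn_gt0 ?enorm1_gt0//.
have := peetre (2 ^+ j *: theta - xi) xi; rewrite subrK enorm_dyadic enorm_distC.
have := enorm_ge0 xi; have : (0 : R) <= 2 ^+ j by rewrite exprn_ge0.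
move: (enorm (xi - _)) => e; move: (enorm xi) (2 ^+ j) => a b b0 a0 h.
apply: le_trans (_ : (1 + a) * (1 + b) <= _).
  by have := mulr_ge0 a0 b0; nra.
by rewrite expr2 mulrA [leRHS]mulrC ler_wpM2l// addr_ge0.
Qed.

(** The contribution of the [j]-th term of the series to the Fourier transform
    of [phi * w], where [f] stands for [v * phi]. *)
Definition wterm f xi j : R[i] := (wcoef d j)%:C%C * fourier f (xi - 2 ^+ j *: theta).

Lemma wterm_summable f xi : schwartz f -> exists B, forall j, normc (wterm f xi j) <= B * 2 ^- j.
Proof.
move=> sf; have c0 : 0 < (1 + enorm xi) ^- 2 by exact: weight_gt0.
have [C C0 hC] := far_terms 0 (fourier_rapid sf) c0.
exists C => j; have := hC xi j (near_zero_far xi j).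
by rewrite expr0 invr1 mulr1.
Qed.

Variable v : 'rV[R]_n -> R[i].
Hypothesis sv : schwartz v.

Definition wpart N x : R[i] := \sum_(1 <= j < N.+1)
    (2 `^ (- j%:R * d))%:C%C * expi (2 ^+ j * dotp theta x) * v x.

Lemma schwartz_wpart N : schwartz (wpart N).
Proof.
apply: schwartz_sum => j; under eq_fun do rewrite -mulrA; apply: schwartzZ.
have := schwartz_expi (2 ^+ j *: theta) 0 sv.
by under eq_fun do rewrite add0r dotpZr dotpC.
Qed.

Lemma schwartz_vM phi : schwartz phi -> schwartz (fun x => v x * phi x).
Proof. by move=> sp; exact: schwartzM sv (schwartz_moderate sp). Qed.

Lemma of_fun_wpart N phi xi : schwartz phi ->
  of_fun (wpart N) (fun x => phi x * expi (- dotp x xi)) =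
  \sum_(1 <= j < N.+1) wterm (fun x => v x * phi x) xi j.
Proof.
move=> sp; have If := schwartz_cintegrable (schwartz_vM sp).
transitivity (cint (fun x => \sum_(1 <= j < N.+1) (wcoef d j)%:C%C *
    (expi (- dotp x (xi - 2 ^+ j *: theta)) * (v x * phi x)))).
  apply: eq_cint => x; rewrite mulr_suml; apply: eq_bigr => j _.
  rewrite dotpDr dotpNr dotpZr opprD opprK expiD (dotpC theta) /wcoef; ring.
rewrite cint_sum; last by move=> j _; apply: cintegrableZ; exact: cintegrable_phase.
by apply: eq_bigr => j _; rewrite cintZ//; exact: cintegrable_phase.
Qed.

(** The test functions [phi * expi (- dotp x xi)] compute the Fourier
    transform of [phi * w] at [xi]. *)
Lemma wdist_ccvg phi xi : schwartz phi ->
  ccvg (fun N => \sum_(1 <= j < N.+1) wterm (fun x => v x * phi x) xi j)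
    (wdist v theta d (fun x => phi x * expi (- dotp x xi))).
Proof.
move=> sp; have [B hB] := wterm_summable xi (schwartz_vM sp).
have [l ul _] := ccvg_geometric (fun j _ => hB j).
suff -> : wdist v theta d (fun x => phi x * expi (- dotp x xi)) = l by [].
rewrite -(ccvg_climn ul) /wdist; congr climn; apply/funext => N.
exact: of_fun_wpart.
Qed.

Lemma phase0 phi : (fun x => phi x * expi (- dotp x 0)) = phi.
Proof. by apply/funext => x; rewrite dotpC dotp0l oppr0 expi0 mulr1. Qed.

Lemma wdist_ccvg0 phi : schwartz phi ->
  ccvg (fun N => \sum_(1 <= j < N.+1) wterm (fun x => v x * phi x) 0 j)
    (wdist v theta d phi).
Proof. by move=> sp; have := wdist_ccvg 0 sp; rewrite phase0. Qed.

Lemma of_fun_wpart0 N phi : schwartz phi ->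
  of_fun (wpart N) phi = \sum_(1 <= j < N.+1) wterm (fun x => v x * phi x) 0 j.
Proof. by move=> sp; have := of_fun_wpart N 0 sp; rewrite phase0. Qed.

Lemma of_fun_wpart_ccvg phi : schwartz phi ->
  ccvg (fun N => of_fun (wpart N) phi) (wdist v theta d phi).
Proof.
move=> sp; have := wdist_ccvg0 sp.
by under eq_fun do rewrite -of_fun_wpart0//.
Qed.

End wdist_terms.

Section tempered_wdist.
Context {R : realType} {n : nat}.
Implicit Types (a phi psi : 'rV[R]_n -> R[i]) (xi : 'rV[R]_n).

Lemma schwartz_norm_fin phi N : schwartz phi -> schwartz_norm N phi \is a fin_num.
Proof. by move=> [_ h]; rewrite ge0_fin_numE ?h// schwartz_norm_ge0. Qed.

Lemma schwartz_norm_le phi N s x : schwartz phi -> (size s <= N)%N ->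
  normc (partials s phi x) <= fine (schwartz_norm N phi).
Proof.
move=> sp sN; rewrite -lee_fin fineK ?schwartz_norm_fin//.
apply: le_trans (le_schwartz_norm phi x sN); rewrite lee_fin.
by rewrite ler_peMl ?normc_ge0// exprn_ege1// enorm1_ge1.
Qed.

Lemma le_schwartz_norm_partial phi N i : schwartz phi ->
  fine (schwartz_norm N (partial i phi)) <= fine (schwartz_norm N.+1 phi).
Proof.
move=> sp; apply: fine_le; [exact/schwartz_norm_fin/schwartz_partial|exact: schwartz_norm_fin|].
apply: ub_ereal_sup => _ [[s x] /= sN <-]; rewrite -partials_rcons.
apply: le_trans (@le_schwartz_norm _ _ phi N.+1 (rcons s i) x _); last by rewrite size_rcons.
by rewrite lee_fin ler_wpM2r ?normc_ge0// ler_weXn2l// enorm1_ge1.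
Qed.

Lemma schwartz_norm_mono phi N M : schwartz phi -> (N <= M)%N ->
  fine (schwartz_norm N phi) <= fine (schwartz_norm M phi).
Proof.
move=> sp NM; apply: fine_le; [exact/schwartz_norm_fin|exact: schwartz_norm_fin|].
apply: ub_ereal_sup => _ [[s x] /= sN <-].
apply: le_trans (@le_schwartz_norm _ _ phi M s x (leq_trans sN NM)).
by rewrite lee_fin ler_wpM2r ?normc_ge0// ler_weXn2l// enorm1_ge1.
Qed.

(** As in [fourier_coord_decay], but with a constant that depends on the
    factor [phi] through a Schwartz seminorm only: this is what continuity of
    functionals requires. *)
Let product_coord_decay a M : schwartz a -> exists2 C, 0 <= C &
  forall phi xi i, schwartz phi ->
    `|xi 0 i| ^+ M * normc (fourier (fun x => a x * phi x) xi) <= C * fine (schwartz_norm M phi).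
Proof.
elim: M a => [|M IH] a sa.
  exists (2 * \int[lebesgue_rV n]_x normc (a x)).
    by rewrite mulr_ge0//; apply: Rintegral_ge0 => x _; exact: normc_ge0.
  move=> phi xi i sp; rewrite expr0 mul1r -mulrA -RintegralZr//; last first.
    exact/cintegrable_normc/schwartz_cintegrable.
  apply: normc_fourier_le.
  - by apply: cmeasurableM; exact: schwartz_measurable.
  - move=> x; rewrite normcM ler_wpM2l ?normc_ge0//.
    exact: (@schwartz_norm_le phi 0 [::] x sp).
  - exact: (integrableZr measurableT _ (cintegrable_normc (schwartz_cintegrable sa))).
have [C1 C10 h1] := IH _ sa.
have H2 i := IH _ (schwartz_partial i sa).
pose C2 i := projT1 (cid2 (H2 i)).
have C2P i : 0 <= C2 i /\ forall phi xi k, schwartz phi ->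
    `|xi 0 k| ^+ M * normc (fourier (fun x => partial i a x * phi x) xi) <= C2 i * fine (schwartz_norm M phi).
  by rewrite /C2; case: (cid2 (H2 i)).
exists (C1 + \sum_i C2 i); first by rewrite addr_ge0// sumr_ge0// => i _; have [] := C2P i.
move=> phi xi i sp.
have sap : schwartz (fun x => a x * phi x) by exact: schwartzM sa (schwartz_moderate sp).
have -> : `|xi 0 i| ^+ M.+1 * normc (fourier (fun x => a x * phi x) xi) =
    `|xi 0 i| ^+ M * normc (fourier (partial i (fun x => a x * phi x)) xi).
  rewrite fourier_partial// normcM exprSr mulrA; congr (_ * _ * _).
  by rewrite /= expr0n/= add0r sqrtr_sqr.
have s1 := schwartzM (schwartz_partial i sa) (schwartz_moderate sp).
have s2 := schwartzM sa (schwartz_moderate (schwartz_partial i sp)).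
rewrite partialM; [|by move=> x; exact: schwartz_cdiff|by move=> x; exact: schwartz_cdiff].
have -> : fourier (fun x => partial i a x * phi x + a x * partial i phi x) xi =
    fourier (fun x => partial i a x * phi x) xi + fourier (fun x => a x * partial i phi x) xi.
  rewrite /fourier -cintD; [|exact/cintegrable_phase/schwartz_cintegrable|exact/cintegrable_phase/schwartz_cintegrable].
  by apply: eq_cint => x; rewrite mulrDr.
apply: le_trans (ler_wpM2l (exprn_ge0 _ (normr_ge0 _)) (ler_normcD _ _)) _.
have S0 : 0 <= fine (schwartz_norm M.+1 phi) by apply: fine_ge0; exact: schwartz_norm_ge0.
rewrite mulrDr addrC mulrDl lerD//.
  apply: le_trans (h1 _ xi i (schwartz_partial i sp)) _.
  by rewrite ler_wpM2l// le_schwartz_norm_partial.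
apply: le_trans ((C2P i).2 _ xi i sp) _.
apply: ler_pM; [by have [] := C2P i|by apply: fine_ge0; exact: schwartz_norm_ge0| |exact: schwartz_norm_mono].
by rewrite (bigD1 i)//= lerDl sumr_ge0// => k _; have [] := C2P k.
Qed.

Lemma product_decay a M : schwartz a -> exists2 C, 0 <= C &
  forall phi xi, schwartz phi ->
    normc (fourier (fun x => a x * phi x) xi) <=
      C * fine (schwartz_norm M phi) * (1 + enorm xi) ^- M.
Proof.
move=> sa; have [C C0 hC] := product_coord_decay M sa.
exists (n.+1%:R ^+ M * (C + 2 * \int[lebesgue_rV n]_x normc (a x))).
  rewrite mulr_ge0 ?exprn_ge0// addr_ge0// mulr_ge0//.
  by apply: Rintegral_ge0 => x _; exact: normc_ge0.
move=> phi xi sp; rewrite ler_pdivlMr ?exprn_gt0 ?enorm1_gt0// mulrC -mulrA.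
have S0 : 0 <= fine (schwartz_norm M phi) by apply: fine_ge0; exact: schwartz_norm_ge0.
have I0 : 0 <= \int[lebesgue_rV n]_x normc (a x) by apply: Rintegral_ge0 => x _; exact: normc_ge0.
apply: weight_le_coords; first exact: normc_ge0.
  rewrite mulrDl (le_trans _ (_ : 2 * \int[lebesgue_rV n]_x normc (a x) * fine (schwartz_norm M phi) <= _))//; last first.
    by rewrite lerDr mulr_ge0.
  rewrite -mulrA -RintegralZr//; last exact/cintegrable_normc/schwartz_cintegrable.
  apply: normc_fourier_le.
  - by apply: cmeasurableM; exact: schwartz_measurable.
  - move=> x; rewrite normcM ler_wpM2l ?normc_ge0//.
    exact: (@schwartz_norm_le phi M [::] x sp).
  - exact: (integrableZr measurableT _ (cintegrable_normc (schwartz_cintegrable sa))).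
move=> i; apply: le_trans (hC phi xi i sp) _.
by rewrite ler_wpM2r// lerDl mulr_ge0.
Qed.

Lemma of_funD a phi psi c : schwartz a -> schwartz phi -> schwartz psi ->
  of_fun a (fun x => c * phi x + psi x) = c * of_fun a phi + of_fun a psi.
Proof.
move=> sa sp ss.
have I1 := schwartz_cintegrable (schwartzM sa (schwartz_moderate sp)).
have I2 := schwartz_cintegrable (schwartzM sa (schwartz_moderate ss)).
rewrite /of_fun -(cintZ c I1) -cintD//; last exact: cintegrableZ.
by apply: eq_cint => x; rewrite mulrDr mulrCA.
Qed.

Lemma tempered_of_fun a : schwartz a -> tempered (of_fun a).
Proof.
move=> sa; split; first by move=> c phi psi sp ss; exact: of_funD.
exists 0%N, (2 * \int[lebesgue_rV n]_x normc (a x)) => phi sp.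
have Ia := cintegrable_normc (schwartz_cintegrable sa).
rewrite -(fineK (schwartz_norm_fin 0 sp)) -EFinM lee_fin -mulrA -RintegralZr//.
apply: normc_cint_le.
- by apply: cmeasurableM; exact: schwartz_measurable.
- move=> x; rewrite normcM ler_wpM2l ?normc_ge0//.
  exact: (@schwartz_norm_le phi 0 [::] x sp).
- exact: (integrableZr measurableT _ Ia).
Qed.

(** [product_decay] at the points [- 2 ^+ j *: theta] beats the growth of the
    coefficients, with a constant proportional to a Schwartz seminorm of
    [phi]. *)
Lemma tempered_wdist (v : 'rV[R]_n -> R[i]) theta d : enorm theta = 1 -> schwartz v ->
  tempered (wdist v theta d).
Proof.
move=> t1 sv; split.
  move=> c phi psi sp ss; have sc := schwartzD (schwartzZ c sp) ss.
  have H := ccvgD (ccvgM (ccvg_cst c) (of_fun_wpart_ccvg d t1 sv sp)) (of_fun_wpart_ccvg d t1 sv ss).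
  apply: (ccvg_unique (of_fun_wpart_ccvg d t1 sv sc)).
  apply: ccvg_near H; apply: nearW => N.
  by rewrite of_funD//; exact: schwartz_wpart.
have [m hm] := wcoef_le d; have [C C0 hC] := product_decay m.+1 sv.
exists m.+1, C => phi sp.
rewrite -(fineK (schwartz_norm_fin _ sp)) -EFinM lee_fin.
set S := fine _.
have hB j : normc (wterm theta d (fun x => v x * phi x) 0 j) <= C * S * 2 ^- j.
  rewrite /wterm normcM normcR (ger0_norm (wcoef_ge0 _ _)).
  apply: le_trans (ler_pM (wcoef_ge0 _ _) (normc_ge0 _) (hm j) (hC phi _ sp)) _.
  rewrite sub0r enormN enorm_dyadic// [leLHS]mulrC -[leLHS]mulrA ler_wpM2l//.
    by rewrite mulr_ge0//; apply: fine_ge0; exact: schwartz_norm_ge0.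
  have b0 : (0 : R) < 2 ^+ j by rewrite exprn_gt0.
  apply: le_trans (_ : (2 ^+ j) ^- m.+1 * (2 ^+ j) ^+ m <= _).
    rewrite ler_wpM2r ?exprn_ge0 ?(ltW b0)// lef_pV2 ?posrE ?exprn_gt0 ?ltr_pwDl ?(ltW b0)//.
    by rewrite lerXn2r ?nnegrE ?addr_ge0 ?(ltW b0)// lerDr.
  by rewrite exprS invfM -mulrA mulVf ?mulr1// expf_neq0// gt_eqF.
have [l ul lB] := ccvg_geometric (fun j _ => hB j).
by rewrite (ccvg_unique (wdist_ccvg0 d t1 sv sp) ul).
Qed.

End tempered_wdist.

(** * Cut-off functions *)

Section bumps.
Context {R : realType} {n : nat}.
Implicit Types (f : 'rV[R]_n -> R[i]) (x a xi : 'rV[R]_n).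

Lemma smooth_translate f a : smooth f -> smooth (fun x => f (x + a)).
Proof.
move=> sf; apply: (@smooth_class _ _ (fun h => exists2 f, smooth f & h = fun x => f (x + a))).
- by move=> _ x [p sp ->]; apply: cdiff_translate; exact: smooth_cdiff.
- move=> _ i [p sp ->]; exists (partial i p); first exact: smooth_partial.
  by rewrite partial_translate.
- by exists f.
Qed.

(** Cut-offs around arbitrary points are obtained as translates of a single
    one. *)
Lemma test_translate f a : test_function f -> test_function (fun x => f (x + a)).
Proof.
move=> [sf cf]; split; first exact: smooth_translate.
pose A := (fun y : 'rV[R]_n => y - a) @` supp f.
have cA : compact A.
  apply: continuous_compact => //; apply: continuous_subspaceT => y.
  by apply: continuousB; [exact: cvg_id|exact: cst_continuous].
have clA : closed A by apply: compact_closed => //; exact: norm_hausdorff.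
apply: (subclosed_compact _ cA); first exact: closed_closure.
rewrite (closure_id A).1//; apply: closure_subset => x /= fx.
exists (x + a); last by rewrite addrK.
exact: subset_closure.
Qed.

Lemma near_neq0 f x0 : smooth f -> f x0 != 0 ->
  exists2 delta : R, 0 < delta & forall x, enorm (x - x0) < delta -> f x != 0.
Proof.
move=> sf f0; have [c1 c2] := smooth_continuous sf.
have cf : continuous (fun x => complex.Re (f x) ^+ 2 + complex.Im (f x) ^+ 2).
  have n1 : continuous (fun x => complex.Re (f x) ^+ 2).
    move=> x; apply: (@continuous_comp _ _ _ _ (fun r : R => r ^+ 2)); first exact: c1.
    exact: exprn_continuous.
  have n2 : continuous (fun x => complex.Im (f x) ^+ 2).
    move=> x; apply: (@continuous_comp _ _ _ _ (fun r : R => r ^+ 2)); first exact: c2.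
    exact: exprn_continuous.
  by move=> x; exact: (continuousD (n1 x) (n2 x)).
have p0 : 0 < complex.Re (f x0) ^+ 2 + complex.Im (f x0) ^+ 2.
  rewrite lt_neqAle addr_ge0 ?sqr_ge0// andbT eq_sym paddr_eq0 ?sqr_ge0//.
  rewrite !sqrf_eq0; apply: contra f0 => /andP[/eqP r0 /eqP i0].
  by apply/eqP/complex_eqP.
have : \forall x \near x0, 0 < complex.Re (f x) ^+ 2 + complex.Im (f x) ^+ 2.
  by apply: (cvgr_gt _ (cf x0)).
move=> /nbhs_ballP[delta /= d0 h]; exists delta => // x xd.
have : 0 < complex.Re (f x) ^+ 2 + complex.Im (f x) ^+ 2.
  apply: h; rewrite -ball_normE /ball_/= distrC.
  exact: le_lt_trans (norm_le_enorm _) xd.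
by apply: contraTneq => ->; rewrite /= expr0n/= addr0 ltxx.
Qed.

End bumps.

(** * The wavefront set of the lacunary series *)

Section wavefront.
Context {R : realType} {n : nat}.
Implicit Types (x xi eta : 'rV[R]_n).
Variables (theta : 'rV[R]_n) (d : R).
Hypothesis theta1 : enorm theta = 1.
Variable v : 'rV[R]_n -> R[i].
Hypothesis sv : schwartz v.

(** Equality in the Cauchy-Schwarz inequality would put [xi] on the ray. *)
Lemma ray_dotp xi : xi != 0 -> ~ open_ray theta xi -> dotp xi theta < enorm xi.
Proof.
move=> xi0 hray; have e0 : 0 < enorm xi.
  rewrite lt_neqAle enorm_ge0 andbT eq_sym; apply: contra xi0 => /eqP h.
  by apply/eqP/enorm_eq0.
rewrite lt_neqAle; apply/andP; split; last first.
  by have := cauchy_schwarz xi theta; rewrite theta1 mulr1.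
apply/eqP => h; apply: hray; exists (enorm xi) => //=.
apply/esym/eqP; rewrite -subr_eq0; apply/eqP/dotp_eq0.
rewrite !(dotpDl, dotpDr, dotpNl, dotpNr, dotpZl, dotpZr) (dotpC theta xi) h -!enorm_sqr theta1.
by ring.
Qed.

(** The difference between [enorm (xi - r *: theta) ^ 2] and [(1 - mu) / 2 *
    (enorm xi + r) ^ 2] is at least [(1 + mu) / 2 * (enorm xi - r) ^ 2]. *)
Lemma cone_far (mu : R) xi (r : R) : 0 <= mu -> mu < 1 -> 0 < r ->
  dotp xi theta < mu * enorm xi ->
  (1 - mu) / 2 * (1 + enorm xi + r) <= 1 + enorm (xi - r *: theta).
Proof.
move=> mu0 mu1 r0 h; set c := (1 - mu) / 2.
have c0 : 0 < c by rewrite divr_gt0// subr_gt0.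
have c1 : c <= 1 by rewrite /c; lra.
rewrite -addrA mulrDr lerD ?mulr1//.
have e0 := enorm_ge0 xi.
have cer : 0 <= c * (enorm xi + r).
  by apply: mulr_ge0; [exact: ltW|rewrite addr_ge0// ltW].
rewrite -ler_sqr ?nnegrE ?enorm_ge0//.
rewrite enorm_sqr !(dotpDl, dotpDr, dotpNl, dotpNr, dotpZl, dotpZr) (dotpC theta xi) -!enorm_sqr theta1.
have h' : r * dotp xi theta <= r * (mu * enorm xi) by rewrite ler_wpM2l ?(ltW r0) ?(ltW h).
move: (dotp xi theta) h' => p h'; clear h; move: (enorm xi) e0 h' => e e0 h'.
apply: le_trans (_ : c * (e + r) ^+ 2 <= _).
  by rewrite exprMn ler_wpM2r ?sqr_ge0// expr2 ler_piMr ?(ltW c0).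
apply: le_trans (_ : e ^+ 2 - 2 * (r * (mu * e)) + r ^+ 2 <= _); last by lra.
rewrite /c -subr_ge0.
have -> : e ^+ 2 - 2 * (r * (mu * e)) + r ^+ 2 - (1 - mu) / 2 * (e + r) ^+ 2 =
   (1 + mu) / 2 * (e - r) ^+ 2 by field.
by rewrite mulr_ge0 ?sqr_ge0// divr_ge0// addr_ge0.
Qed.

Variable chi : 'rV[R]_n -> R[i].
Hypotheses (chi_test : test_function chi) (p0 : 'rV[R]_n) (chi0 : chi p0 != 0).

(** The cone [dotp xi theta < mu * enorm xi] contains [xi0] for some [mu < 1],
    and [cone_far] feeds [far_terms] uniformly on it. *)
Lemma microlocally_smooth_off_ray x0 xi0 : xi0 != 0 -> ~ open_ray theta xi0 ->
  microlocally_smooth (wdist v theta d) x0 xi0.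
Proof.
move=> xi00 hray; have hd := ray_dotp xi00 hray.
have e0 : 0 < enorm xi0.
  rewrite lt_neqAle enorm_ge0 andbT eq_sym; apply: contra xi00 => /eqP h.
  by apply/eqP/enorm_eq0.
pose q := dotp xi0 theta / enorm xi0.
have q1 : q < 1 by rewrite ltr_pdivrMr// mul1r.
(* any number between the cosine q of the angle to theta and 1; the maximum keeps it nonnegative *)
pose mu := (Num.max q 0 + 1) / 2.
have m1 : Num.max q 0 < 1 by rewrite gt_max q1 ltr01.
have m0 : 0 <= Num.max q 0 by rewrite le_max lexx orbT.
have mq : q <= Num.max q 0 by rewrite le_max lexx.
have mu0 : 0 <= mu by rewrite /mu; lra.
have mu1 : mu < 1 by rewrite /mu; lra.
pose phi x := chi (x + (p0 - x0)).
have tphi : test_function phi by exact: test_translate.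
have sphi := test_schwartz tphi.
exists phi, [set xi | dotp xi theta < mu * enorm xi]; split => //.
- by rewrite /phi addrC subrK.
- split.
    rewrite (_ : mkset _ = (fun xi => mu * enorm xi - dotp xi theta) @^-1` [set r : R | 0 < r]).
      apply: open_comp; last exact: open_gt.
      move=> xi _; exact: (continuousB (continuousM (@cst_continuous _ _ mu xi)
        (@enorm_continuous _ _ xi)) (@dotp_continuous_l _ _ theta xi)).
    by apply/seteqP; split => xi /=; rewrite subr_gt0.
  rewrite /= -ltr_pdivrMr//; apply: le_lt_trans mq _.
  by rewrite /mu; move: m1; move: (Num.max q 0) => z; lra.
- move=> t xi t0 /=; rewrite dotpZl enormZ (gtr0_norm t0) mulrCA.
  by rewrite ltr_pM2l.
- move=> N; have c0 : 0 < (1 - mu) / 2 by rewrite divr_gt0// subr_gt0.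
  have [C C0 hC] := far_terms theta d N (fourier_rapid (schwartz_vM sv sphi)) c0.
  exists C => xi Vxi.
  have hB j : (0 < j)%N -> normc (wterm theta d (fun x => v x * phi x) xi j) <=
      C * (1 + enorm xi) ^- N * 2 ^- j.
    by move=> _; apply: hC; apply: cone_far => //; rewrite exprn_gt0.
  have [l ul lB] := ccvg_geometric hB.
    by rewrite (ccvg_unique (wdist_ccvg d theta1 sv xi sphi) ul).
Qed.

Lemma dyadic_gap (j k : nat) : j != k -> (2 ^+ k + 2 ^+ j) / 3 <= `|2 ^+ k - 2 ^+ j| :> R.
Proof.
wlog jk : j k / (j < k)%N => [h|_].
  rewrite neq_ltn => /orP[jk|kj]; first by apply: h => //; rewrite neq_ltn jk.
  by rewrite distrC addrC; apply: h => //; rewrite neq_ltn kj.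
have h : (2 : R) * 2 ^+ j <= 2 ^+ k by rewrite -exprS ler_weXn2l// ler1n.
have : (0 : R) <= 2 ^+ j by rewrite exprn_ge0.
move: h; move: (2 ^+ j) (2 ^+ k) => a b h a0.
by rewrite ger0_norm; lra.
Qed.

(** Near [2 ^+ k *: theta], all frequencies [2 ^+ j *: theta] with [j != k]
    are at a distance comparable to [2 ^+ k + 2 ^+ j]; the loss is polynomial
    in [eta]. *)
Lemma resonant_far (k j : nat) eta : j != k ->
  (3 * (1 + enorm eta) ^+ 2)^-1 * (1 + enorm (2 ^+ k *: theta + eta) + 2 ^+ j) <=
  1 + enorm (2 ^+ k *: theta + eta - 2 ^+ j *: theta).
Proof.
move=> jk; rewrite mulrC ler_pdivrMr ?mulr_gt0 ?exprn_gt0 ?enorm1_gt0//.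
have := peetre (2 ^+ k *: theta + eta - 2 ^+ j *: theta) (- eta).
rewrite addrAC addrK -scalerBl enormZ theta1 mulr1 enormN.
have := enormD (2 ^+ k *: theta) eta; rewrite enorm_dyadic//.
have := dyadic_gap jk; have := enorm_ge0 eta.
have : (0 : R) <= 2 ^+ j by rewrite exprn_ge0.
have : (0 : R) <= 2 ^+ k by rewrite exprn_ge0.
move: (`|_ - _|) => g; move: (enorm (_ + _ - _)) (enorm (_ + _)) => e s.
move: (enorm eta) (2 ^+ j) (2 ^+ k) => t a b b0 a0 t0 gap hs hp.
apply: le_trans (_ : 3 * (1 + t) * (1 + g) <= _).
  have : 0 <= t * (b + a) by rewrite mulr_ge0// addr_ge0.
  have : 0 <= t * (g - (b + a) / 3) by rewrite mulr_ge0// subr_ge0.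
  nra.
rewrite expr2 [leRHS](_ : _ = 3 * (1 + t) * ((1 + e) * (1 + t))); last by ring.
by rewrite ler_wpM2l// mulr_ge0// addr_ge0.
Qed.

(** At [2 ^+ k *: theta + eta] the [k]-th term is [wcoef d k * fourier f eta].
    The other terms and, by hypothesis, the total are [O((2 ^+ k) ^- m.+1)]
    with [m] larger than the growth exponent of [1 / wcoef d k], so [fourier f
    eta] is [O(2 ^- k)] for every large [k]. *)
Lemma ray_fourier_eq0 (phi : 'rV[R]_n -> R[i]) (V : set 'rV[R]_n) (t : R) eta :
  schwartz phi -> open V -> 0 < t -> V (t *: theta) ->
  (forall (t : R) xi, 0 < t -> V xi -> V (t *: xi)) ->
  (forall N : nat, exists C : R, forall xi, V xi ->
     normc (wdist v theta d (fun x => phi x * expi (- dotp x xi))) <= C * (1 + enorm xi) ^- N) ->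
  fourier (fun x => v x * phi x) eta = 0.
Proof.
move=> sphi oV t0 Vt Vcone hN.
set f := fun x => v x * phi x.
(* m bounds the growth of 1 / wcoef d k, which has to be compensated below *)
have [m hm] := wcoef_le (- d).
have [C1 hC1] := hN m.+1.
have c0 : 0 < (3 * (1 + enorm eta) ^+ 2)^-1.
  by rewrite invr_gt0 mulr_gt0// exprn_gt0// enorm1_gt0.
have [C2 C20 hC2] := far_terms theta d m.+1 (fourier_rapid (schwartz_vM sv sphi)) c0.
have Vtheta : V theta.
  by have := Vcone t^-1 _ _ Vt; rewrite invr_gt0 scalerA mulVf ?gt_eqF// scale1r; apply.
have [k0 hk0] : exists k0 : nat, forall k, (k0 <= k)%N -> V (2 ^+ k *: theta + eta).
  have /nbhs_ballP[e /= e0 eV] := oV _ Vtheta.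
  pose N := Num.bound (enorm eta / e); exists N => k Nk.
  have b0 : (0 : R) < 2 ^+ k by rewrite exprn_gt0.
  rewrite (_ : _ + eta = 2 ^+ k *: (theta + 2 ^- k *: eta)); last first.
    by rewrite scalerDr scalerA divff ?gt_eqF// scale1r.
  apply: Vcone => //; apply: eV.
  rewrite -ball_normE /ball_/= opprD addrA subrr sub0r normrN.
  apply: le_lt_trans (norm_le_enorm _) _.
  rewrite enormZ ger0_norm ?invr_ge0 ?(ltW b0)// mulrC ltr_pdivrMr//.
  rewrite -ltr_pdivrMl// mulrC; apply: lt_le_trans (archi_boundP _) _.
    by rewrite divr_ge0 ?enorm_ge0 ?ltW.
  rewrite -/N (le_trans (_ : _ <= k%:R)) ?ler_nat//.
  by rewrite -natrX ler_nat ltnW// ltn_expl.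
pose D := (C1 + C2) * (1 + enorm eta) ^+ m.+1.
have key k : (k0 <= k)%N -> (0 < k)%N -> normc (fourier f eta) <= D * 2 ^- k.
  move=> kk0 k_gt0; set xi := 2 ^+ k *: theta + eta.
  (* the non-resonant terms *)
  pose a j := if j == k then 0 else wterm theta d f xi j.
  have ha j : (0 < j)%N -> normc (a j) <= C2 * (1 + enorm xi) ^- m.+1 * 2 ^- j.
    move=> _; rewrite /a; case: eqVneq => [_|jk].
      by rewrite normc0 !mulr_ge0 ?weight_ge0// invr_ge0 exprn_ge0.
    by apply: hC2; exact: resonant_far.
  have [l ul lB] := ccvg_geometric ha.
  have H : ccvg (fun N => \sum_(1 <= j < N.+1) wterm theta d f xi j)
      (l + (wcoef d k)%:C%C * fourier f eta).
    apply: (ccvg_near _ (ccvgD ul (ccvg_cst _))).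
    near=> N; have kN : (k < N.+1)%N.
      by rewrite ltnS; near: N; exact: nbhs_infty_ge.
    have kin : k \in index_iota 1 N.+1 by rewrite mem_index_iota k_gt0.
    rewrite (bigD1_seq k)//= ?iota_uniq// [in RHS](bigD1_seq k)//= ?iota_uniq//.
    rewrite /a eqxx add0r addrC /wterm /xi addrAC subrr add0r; congr (_ + _).
    by apply: eq_bigr => j jk; rewrite (negbTE jk).
  have E := ccvg_unique (wdist_ccvg d theta1 sv xi sphi) H.
  have := hC1 xi (hk0 k kk0); rewrite E => h.
  have {h} : normc ((wcoef d k)%:C%C * fourier f eta) <= (C1 + C2) * (1 + enorm xi) ^- m.+1.
    rewrite (_ : _ * _ = (l + (wcoef d k)%:C%C * fourier f eta) + - l); last by ring.
    by apply: le_trans (ler_normcD _ _) _; rewrite normc_opp mulrDl lerD.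
  rewrite normcM normcR (ger0_norm (wcoef_ge0 _ _)) => h.
  have w1 : wcoef (- d) k * wcoef d k = 1.
    rewrite /wcoef -powRD ?pnatr_eq0 ?implybT//.
    by rewrite mulrN addrC addrN powRr0.
  have -> : normc (fourier f eta) = wcoef (- d) k * (wcoef d k * normc (fourier f eta)).
    by rewrite mulrA w1 mul1r.
  have b0 : (0 : R) < 2 ^+ k by rewrite exprn_gt0.
  have CC : 0 <= C1 + C2.
    have := le_trans (mulr_ge0 (wcoef_ge0 d k) (normc_ge0 (fourier f eta))) h.
    by rewrite pmulr_lge0// weight_gt0.
  apply: le_trans (ler_pM (wcoef_ge0 _ _) _ (hm k) h) _; first by rewrite mulr_ge0 ?wcoef_ge0 ?normc_ge0.
  rewrite /D mulrCA -mulrA ler_wpM2l//.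
  have e1 : (1 + enorm xi) ^- m.+1 <= (1 + enorm eta) ^+ m.+1 * (2 ^+ k) ^- m.+1.
    rewrite -ler_pdivrMl ?exprn_gt0 ?enorm1_gt0// -invfM lef_pV2 ?posrE ?mulr_gt0 ?exprn_gt0 ?enorm1_gt0//.
    rewrite -exprMn lerXn2r ?nnegrE ?mulr_ge0 ?(ltW b0) ?(ltW (enorm1_gt0 _))//.
    have := peetre xi (- eta); rewrite /xi addrK enorm_dyadic// enormN [leRHS]mulrC.
    by apply: le_trans; rewrite lerDr.
  apply: le_trans (ler_wpM2l (exprn_ge0 _ (ltW b0)) e1) _.
  rewrite mulrCA ler_wpM2l ?exprn_ge0 ?(ltW (enorm1_gt0 _))//.
  by rewrite exprS invfM mulrCA divff ?mulr1// expf_neq0// gt_eqF.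
apply/eqP; rewrite -normc_eq0 eq_le normc_ge0 andbT.
have lim0 : (fun k : nat => D * 2 ^- (k + k0).+1) @ \oo --> (0 : R).
  rewrite -(mulr0 D); apply: cvgM; first exact: cvg_cst.
  under eq_fun do rewrite -exprVn.
  rewrite (_ : (fun k => _) = (fun k : nat => 2^-1 ^+ k0.+1 * 2^-1 ^+ k)); last first.
    by apply/funext => k; rewrite -exprD addSn addnC.
  rewrite -(mulr0 (2^-1 ^+ k0.+1)); apply: cvgM; first exact: cvg_cst.
  by apply: cvg_expr; rewrite ger0_norm// invf_lt1// ltr1n.
rewrite -(cvg_lim (@Rhausdorff R) lim0); apply: limr_ge; first exact: cvgP lim0.
by apply: nearW => k; apply: key => //; exact: leq_trans (leq_addl k k0) (leqnSn _).
Unshelve. all: by end_near. Qed.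

Variable B : R.
Hypotheses (B0 : 0 < B) (suppv : forall xi, fourier v xi != 0 -> enorm xi <= B)
  (v_neq0 : v <> (fun=> 0)).

(** The auxiliary function [chi] only serves to provide cut-offs around
    arbitrary points. *)
Lemma WF_wdist : WF (wdist v theta d) = setT `*` open_ray theta.
Proof.
apply/seteqP; split => [[x0 xi0] [/= xi00 hml]|[x0 _] [_ /= [t t0 <-]]].
  split => //=; apply: contra_notP hml => hray.
  exact: microlocally_smooth_off_ray.
split => /=.
  rewrite scaler_eq0 negb_or gt_eqF//=; apply: contra_eq_neq theta1 => ->.
  by rewrite enorm0 eq_sym oner_neq0.
move=> [phi [V [tphi phi0 [oV Vt] Vcone hN]]].
have sphi := test_schwartz tphi.
have F0 eta : fourier (fun x => v x * phi x) eta = 0.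
  exact: (@ray_fourier_eq0 phi V t eta).
have vphi0 := fourier_inj (schwartz_vM sv sphi) F0.
have [delta d0 hd] := near_neq0 tphi.1 phi0.
apply: v_neq0; apply/funext.
apply: (bandlimited_unique_continuation sv B0 suppv d0 (x0 := x0)) => x xd.
have /eqP := vphi0 x; rewrite mulf_eq0 => /orP[/eqP//|].
by rewrite (negbTE (hd x xd)).
Qed.

End wavefront.

(** * Sobolev norms and duality *)

Section sobolev_norms.
Context {R : realType} {n : nat}.
Implicit Types (g phi : 'rV[R]_n -> R[i]) (x xi : 'rV[R]_n) (s M : R) (u : functional R n).
Notation mu := (lebesgue_rV n).

Definition bracket s xi : R := (1 + enorm xi ^+ 2) `^ s.

Lemma bracket_gt0 s xi : 0 < bracket s xi.
Proof. by apply: powR_gt0; rewrite ltr_pwDl// sqr_ge0. Qed.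

Lemma bracket_half s xi : bracket (s / 2) xi ^+ 2 = bracket s xi.
Proof.
rewrite /bracket -powR_mulrn ?powR_ge0// -powRrM divfK//.
Qed.

Lemma bracketN s xi : bracket (- s) xi = (bracket s xi)^-1.
Proof. by rewrite /bracket powRN. Qed.

Lemma measurable_bracket s : measurable_fun setT (bracket s).
Proof.
apply: (measurableT_comp (f := @powR R ^~ s)); first exact: measurable_powR.
apply: continuous_measurable_rV => xi.
apply: (@continuous_comp _ _ _ (@enorm R n) (fun r : R => 1 + r ^+ 2)).
  exact: enorm_continuous.
apply: continuousD; first exact: cst_continuous.
exact: exprn_continuous.
Qed.

Lemma cmeasurable_normc_sq g : cmeasurable g -> measurable_fun setT (fun x => normc (g x) ^+ 2).
Proof. by move=> mg; apply: measurable_funX; exact: cmeasurable_normc. Qed.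

(** The square of the [H^s] norm of a distribution whose Fourier transform is
    [g]; it is additive over functions with disjoint supports. *)
Definition energy s g : \bar R := (\int[mu]_xi (bracket s xi * normc (g xi) ^+ 2)%:E)%E.

Lemma energy_ge0 s g : (0 <= energy s g)%E.
Proof.
apply: integral_ge0 => xi _; rewrite lee_fin mulr_ge0 ?sqr_ge0//.
exact/ltW/bracket_gt0.
Qed.

Lemma Lnorm_energy s g : (Lnorm mu 2%:E (fun xi => (bracket (s / 2) xi * normc (g xi))%:E) =
  energy s g `^ 2^-1)%E.
Proof.
rewrite unlock; congr (_ `^ _)%E; apply: eq_integral => xi _.
rewrite abse_EFin poweR_EFin powR_mulrn// real_normK ?num_real//.
by rewrite exprMn bracket_half.
Qed.

Lemma Lnorm_energy_le s g M : 0 <= M -> (energy s g <= (M ^+ 2)%:E)%E ->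
  (Lnorm mu 2%:E (fun xi => (bracket (s / 2) xi * normc (g xi))%:E) <= M%:E)%E.
Proof.
move=> M0 h; rewrite Lnorm_energy.
apply: (@le_trans _ _ ((M ^+ 2)%:E `^ 2^-1)%E).
  by apply: gt0_ler_poweR => //; rewrite in_itv/= ?energy_ge0 ?leey// lee_fin sqr_ge0.
by rewrite poweR_EFin powR12_sqrt ?sqr_ge0// sqrtr_sqr ger0_norm.
Qed.

Lemma sobolev_norm_le s u g M : cmeasurable g -> deq (dfourier u) (of_fun g) ->
  0 <= M -> (energy s g <= (M ^+ 2)%:E)%E -> (sobolev_norm s u <= M%:E)%E.
Proof.
move=> mg ug M0 h; apply: le_trans (Lnorm_energy_le M0 h).
by apply: ereal_inf_lbound; exists g.
Qed.

(** Hoelder's inequality with the weights [bracket (s / 2)] and [bracket (- s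
    / 2)]. Stated for the infimum, it bounds [u] whatever representative of
    its Fourier transform is taken. *)
Lemma sobolev_dual s u phi M K : schwartz phi -> 0 <= K ->
  (sobolev_norm s u < M%:E)%E -> (energy (- s) phi <= (K ^+ 2)%:E)%E ->
  normc (u (fourier phi)) <= 2 * (M * K).
Proof.
move=> sp K0 /ereal_inf_lt [_ [g [mg ug] <-]] gM phiK.
have mp := schwartz_measurable sp.
have -> : u (fourier phi) = cint (fun x => g x * phi x) by exact: ug.
pose G xi := normc (g xi * phi xi).
have mG : measurable_fun setT G by apply: cmeasurable_normc; exact: cmeasurableM.
pose a xi := bracket (s / 2) xi * normc (g xi).
pose b xi := bracket (- s / 2) xi * normc (phi xi).
have ma : measurable_fun setT a.
  by apply: measurable_funM; [exact: measurable_bracket|exact: cmeasurable_normc].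
have mb : measurable_fun setT b.
  by apply: measurable_funM; [exact: measurable_bracket|exact: cmeasurable_normc].
have ab xi : a xi * b xi = G xi.
  rewrite /a /b /G normcM mulNr bracketN.
  by rewrite mulrACA divff ?mul1r// gt_eqF// bracket_gt0.
have h2 : 2^-1 + 2^-1 = 1 :> R by field.
have p2 : 0 < 2 :> R by [].
have H := @hoelder _ _ _ mu a b 2 2 ma mb p2 p2 h2.
rewrite Lnorm1 in H.
have IG : (\int[mu]_xi (G xi)%:E <= M%:E * K%:E)%E.
  apply: le_trans (_ : (_ <= Lnorm mu 2%:E (EFin \o a) * Lnorm mu 2%:E (EFin \o b))%E) _.
    apply: le_trans H; rewrite le_eqVlt; apply/orP; left; apply/eqP.
    by apply: eq_integral => xi _; rewrite /= ab ger0_norm// normc_ge0.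
  apply: lee_pmul; [exact: Lnorm_ge0|exact: Lnorm_ge0|exact: ltW|].
  exact: Lnorm_energy_le.
have iG : mu.-integrable setT (EFin \o G).
  apply: integrable_ge0_lty => //; first by move=> xi; exact: normc_ge0.
  by apply: le_lt_trans IG _; rewrite -EFinM ltry.
apply: le_trans (normc_cint_le (cmeasurableM mg mp) (fun x => lexx _) iG) _.
rewrite ler_wpM2l// -lee_fin fineK; last exact: integrable_fin_num iG.
exact: IG.
Qed.
End sobolev_norms.

(** * The frequency bumps and their Sobolev energy *)

Section dyadic_bands.
Context {R : realType} {n : nat}.
Implicit Types (phi : 'rV[R]_n -> R[i]) (x xi : 'rV[R]_n) (s : R).
Notation mu := (lebesgue_rV n).
Variables (theta : 'rV[R]_n) (v : 'rV[R]_n -> R[i]).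
Hypotheses (theta1 : enorm theta = 1) (sv : schwartz v)
  (suppv : forall xi, fourier v xi != 0 -> enorm xi < 1 / 20).

Definition vhat (j : nat) xi : R[i] := fourier v (xi - 2 ^+ j *: theta).

Lemma schwartz_vhat j : schwartz (vhat j).
Proof. by rewrite /vhat; apply: schwartz_translate; exact: schwartz_fourier. Qed.

Lemma band_enorm j xi : vhat j xi != 0 -> 2 ^+ j - 1 / 20 < enorm xi < 2 ^+ j + 1 / 20.
Proof.
move=> /suppv h.
have h1 := enormD (xi - 2 ^+ j *: theta) (2 ^+ j *: theta).
have h2 := enormD (2 ^+ j *: theta - xi) xi.
rewrite subrK enorm_dyadic// in h1; rewrite subrK enorm_dyadic// enorm_distC in h2.
by clear -h h1 h2; move: h h1 h2; set a := enorm (_ - _); move: a => a h h1 h2;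
  apply/andP; split; lra.
Qed.

Lemma band_unique j k xi : vhat j xi != 0 -> vhat k xi != 0 -> j = k.
Proof.
wlog jk : j k / (j < k)%N => [h|].
  by case: (ltngtP j k) => // jk hj hk; [exact: h|apply/esym; exact: h].
move=> /band_enorm/andP[_ h1] /band_enorm/andP[h2 _]; exfalso.
have a : (2 : R) * 2 ^+ j <= 2 ^+ k by rewrite -exprS ler_weXn2l// ler1n.
have b : (1 : R) <= 2 ^+ j by rewrite exprn_ege1// ler1n.
move: h1 h2 a b; move: (enorm xi) (2 ^+ j) (2 ^+ k) => e p q h1 h2 a b.
lra.
Qed.

Lemma band_single xi : exists j0, forall j, j != j0 -> vhat j xi = 0.
Proof.
have [[j0 h]|h] := pselect (exists j, vhat j xi != 0).
  exists j0 => j jj0; apply/eqP; apply: contraT => /band_unique /(_ h) jE.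
  by rewrite jE eqxx in jj0.
by exists 0%N => j _; apply/eqP; apply: contraT => hj; exfalso; apply: h; exists j.
Qed.

Let powR_le4 (y s : R) : 4^-1 <= y -> y <= 4 -> y `^ s <= 4 `^ `|s|.
Proof.
move=> y1 y2; have y0 : 0 < y by apply: lt_le_trans y1.
have [s0|s0] := leP 0 s.
  by rewrite ger0_norm// ge0_ler_powR// nnegrE ltW.
have -> : y `^ s = (y^-1) `^ (- s) by rewrite -powR_inv1 ?(ltW y0)// -powRrM mulN1r opprK.
rewrite ltr0_norm// ge0_ler_powR ?oppr_ge0 ?(ltW s0)// ?nnegrE ?invr_ge0 ?(ltW y0)//.
by rewrite -[leRHS]invrK lef_pV2 ?posrE.
Qed.

(** On the [j]-th bump [1 + enorm xi ^ 2] lies between [4 ^ j / 4] and [4 * 4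
    ^ j]; the sign of [s] decides which bound is used, whence the absolute
    value. *)
Lemma bracket_band s j xi : (0 < j)%N -> vhat j xi != 0 ->
  bracket s xi <= 4 `^ `|s| * (4 ^+ j) `^ s.
Proof.
move=> j0 /band_enorm/andP[h1 h2]; have e0 := enorm_ge0 xi.
have b2 : (2 : R) <= 2 ^+ j.
  by rewrite -[leLHS]expr1 ler_weXn2l// ler1n.
have b4 : (4 : R) ^+ j = 2 ^+ j * 2 ^+ j.
  by rewrite -exprMn; congr (_ ^+ _); ring.
have p4 : (0 : R) < 4 ^+ j by rewrite exprn_gt0.
pose y := (1 + enorm xi ^+ 2) / 4 ^+ j.
have yE : 1 + enorm xi ^+ 2 = 4 ^+ j * y by rewrite /y mulrCA divff ?mulr1// gt_eqF.
have y0 : 0 <= y by rewrite divr_ge0 ?addr_ge0 ?sqr_ge0 ?(ltW p4).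
rewrite /bracket yE powRM ?(ltW p4)// mulrC ler_wpM2r ?powR_ge0//.
apply: powR_le4.
  rewrite /y ler_pdivlMr// b4; move: h1 h2 b2; move: (enorm xi) e0 (2 ^+ j) => e e0 b h1 h2 b2.
  by rewrite expr2; nra.
rewrite /y ler_pdivrMr// b4; move: h1 h2 b2; move: (enorm xi) e0 (2 ^+ j) => e e0 b h1 h2 b2.
by rewrite expr2; nra.
Qed.

Definition mass : R := \int[mu]_xi (normc (fourier v xi) ^+ 2).

Lemma mass_ge0 : 0 <= mass.
Proof. by apply: Rintegral_ge0 => xi _; exact: sqr_ge0. Qed.

Lemma integrable_normc2 phi : schwartz phi -> mu.-integrable setT (EFin \o (fun xi => normc (phi xi) ^+ 2)).
Proof.
move=> sp; have [C C0 hC] := rapid_ge0 0 (schwartz_rapid [::] sp).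
have Ip := cintegrable_normc (schwartz_cintegrable sp).
apply: integrable_dom (integrableZl measurableT C Ip).
  by apply: cmeasurable_normc_sq; exact: schwartz_measurable.
move=> x; rewrite ger0_norm ?sqr_ge0// expr2 ler_wpM2r ?normc_ge0//.
by have := hC x; rewrite expr0 invr1 mulr1.
Qed.

Lemma mass_vhat j : (\int[mu]_xi (normc (vhat j xi) ^+ 2)%:E = mass%:E)%E.
Proof.
have sF := schwartz_fourier sv.
have mF : measurable_fun setT (fun xi => (normc (fourier v xi) ^+ 2)%:E).
  by apply/measurable_EFinP; apply: cmeasurable_normc_sq; exact: schwartz_measurable.
rewrite /mass /Rintegral fineK; last exact: integrable_fin_num (integrable_normc2 sF).
rewrite -[RHS]mul1e.
have -> : 1%E = ((1 : R) ^- n)%:E by rewrite expr1n invr1.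
rewrite -(ge0_integral_affine (- (2 ^+ j *: theta)) ltr01 mF); last first.
  by move=> xi; rewrite lee_fin sqr_ge0.
by apply: eq_integral => xi _; rewrite scale1r addrC.
Qed.

(** If [fourier v] is almost everywhere zero, the inversion formula gives [v =
    0]. *)
Lemma mass_gt0 : v <> (fun=> 0) -> 0 < mass.
Proof.
move=> v0; rewrite lt_neqAle mass_ge0 andbT; apply/negP => /eqP m0; apply: v0.
have sF := schwartz_fourier sv; have I2 := integrable_normc2 sF.
have mF := schwartz_measurable sF.
have Z : (\int[mu]_xi `|(normc (fourier v xi) ^+ 2)%:E| = 0)%E.
  transitivity (mass%:E); last by rewrite -m0.
  rewrite /mass /Rintegral fineK; last exact: integrable_fin_num I2.
  by apply: eq_integral => xi _; rewrite /= ger0_norm// sqr_ge0.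
have /ae_eq_integral_abs := Z => /(_ measurableT) ae0.
have mf2 : measurable_fun setT (fun xi => (normc (fourier v xi) ^+ 2)%:E).
  by apply/measurable_EFinP; exact: cmeasurable_normc_sq.
have {ae0} := (ae0 mf2).
move=> ae0; apply/funext => x.
have N0 : (\int[mu]_xi (normc (fourier v xi))%:E = 0)%E.
  have mN : measurable_fun setT (fun xi => (normc (fourier v xi))%:E).
    by apply/measurable_EFinP; exact: cmeasurable_normc.
  rewrite (ae_eq_integral (cst 0%E))//; first by rewrite integral0.
  apply: filterS ae0 => xi /= h _; have := h I => -[] /eqP.
  by rewrite sqrf_eq0 => /eqP ->.
have : normc (cint (fun xi => expi (dotp x xi) * fourier v xi)) <= 0.
  have mexp : cmeasurable (fun xi => expi (dotp x xi)).
    by under eq_fun do rewrite dotpC; apply: cmeasurable_expi; exact: dotp_continuous_l.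
  apply: le_trans (normc_cint_le (G := fun xi => normc (fourier v xi)) _ _ _) _.
  - exact: cmeasurableM.
  - by move=> xi; rewrite normcM normc_expi mul1r.
  - exact/cintegrable_normc/schwartz_cintegrable.
  - by rewrite /Rintegral N0 mulr0.
rewrite fourier_inversion// normcM normcR => h.
apply/eqP; rewrite -normc_eq0 eq_le normc_ge0 andbT.
by move: h; rewrite pmulr_rle0// normr_gt0 expf_neq0// mulf_neq0// gt_eqF// pi_gt0.
Qed.

Lemma energy_band s (c : R[i]) j : (0 < j)%N ->
  (energy s (fun xi => c * vhat j xi)%R <=
   (normc c ^+ 2 * (4 `^ `|s| * (4 ^+ j) `^ s) * mass)%R%:E)%E.
Proof.
move=> j0; have mF := schwartz_measurable (schwartz_vhat j).
have D0 : 0 <= normc c ^+ 2 * (4 `^ `|s| * (4 ^+ j) `^ s).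
  by rewrite mulr_ge0 ?sqr_ge0// mulr_ge0 ?powR_ge0.
rewrite EFinM -(mass_vhat j) -ge0_integralZl_EFin//; last 2 first.
- by move=> xi _; rewrite lee_fin sqr_ge0.
- by apply/measurable_EFinP; exact: cmeasurable_normc_sq.
apply: ge0_le_integral => //.
- by move=> xi _; rewrite lee_fin mulr_ge0 ?sqr_ge0// ltW// bracket_gt0.
- apply/measurable_EFinP; apply: measurable_funM; first exact: measurable_bracket.
  by apply: cmeasurable_normc_sq; apply: cmeasurableM => //; exact: cmeasurable_cst.
- apply/measurable_EFinP; apply: measurable_funM; first exact: measurable_cst.
  exact: cmeasurable_normc_sq.
move=> xi _; rewrite -EFinM lee_fin normcM exprMn.
have [->|h] := eqVneq (vhat j xi) 0; first by rewrite normc0 expr0n/= !mulr0.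
rewrite mulrCA -[leRHS]mulrA ler_wpM2l ?sqr_ge0//.
by rewrite ler_wpM2r ?sqr_ge0// bracket_band.
Qed.

Implicit Types c : nat -> R[i].

Definition bandsum c (N M : nat) xi : R[i] := \sum_(N.+1 <= j < M.+1) c j * vhat j xi.

Lemma schwartz_bandsum c N M : schwartz (bandsum c N M).
Proof. by apply: schwartz_sum => j; apply: schwartzZ; exact: schwartz_vhat. Qed.

(** The same index [j0] serves for all coefficients and all ranges, since it
    only depends on the disjoint supports of the bumps. *)
Lemma bandsumE xi : exists j0, forall c N M,
  bandsum c N M xi = if (N < j0 <= M)%N then c j0 * vhat j0 xi else 0.
Proof.
have [j0 h] := band_single xi; exists j0 => c N M; rewrite /bandsum.
case: ifP => [jin|jout].
  have jin' : j0 \in index_iota N.+1 M.+1 by rewrite mem_index_iota ltnS.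
  rewrite (bigD1_seq j0)//= ?iota_uniq// big1 ?addr0// => j jj0.
  by rewrite h// mulr0.
rewrite big_nat_cond big1// => j; rewrite andbT ltnS => jNM.
rewrite h ?mulr0//; apply: contraFneq jout => <-; exact: jNM.
Qed.

Lemma normc_bandsum_sq c N M xi :
  normc (bandsum c N M xi) ^+ 2 = \sum_(N.+1 <= j < M.+1) normc (c j * vhat j xi) ^+ 2.
Proof.
have [j0 h] := band_single xi; rewrite /bandsum.
have h0 j : j != j0 -> c j * vhat j xi = 0 by move=> /h ->; rewrite mulr0.
have [jin|jout] := boolP (j0 \in index_iota N.+1 M.+1).
  rewrite (bigD1_seq j0)//= ?iota_uniq// big1 ?addr0//.
  rewrite [RHS](bigD1_seq j0)//= ?iota_uniq// big1 ?addr0//.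
  by move=> j /h0 ->; rewrite normc0 expr0n.
have jn j : j \in index_iota N.+1 M.+1 -> j != j0 by apply: contraTneq => ->.
rewrite big_seq big1 ?normc0 ?expr0n/=; last by move=> j /jn/h0.
by rewrite big_seq big1// => j /jn/h0 ->; rewrite normc0 expr0n.
Qed.

Lemma energy_bandsum s c N M :
  (energy s (bandsum c N M) <=
   (\sum_(N.+1 <= j < M.+1) normc (c j) ^+ 2 * (4 `^ `|s| * (4 ^+ j) `^ s) * mass)%R%:E)%E.
Proof.
rewrite -sumEFin.
have -> : energy s (bandsum c N M) =
    (\sum_(N.+1 <= j < M.+1) energy s (fun xi => c j * vhat j xi)%R)%E.
  rewrite /energy -ge0_integral_sum//.
  - apply: eq_integral => xi _; rewrite normc_bandsum_sq mulr_sumr sumEFin.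
    by [].
  - move=> j; apply/measurable_EFinP; apply: measurable_funM; first exact: measurable_bracket.
    apply: cmeasurable_normc_sq; apply: cmeasurableM; first exact: cmeasurable_cst.
    exact/schwartz_measurable/schwartz_vhat.
  - by move=> j xi _; rewrite lee_fin mulr_ge0 ?sqr_ge0// ltW// bracket_gt0.
rewrite big_seq [leRHS]big_seq; apply: lee_sum => j; rewrite mem_index_iota => /andP[jN _].
by apply: energy_band; apply: leq_ltn_trans jN.
Qed.

End dyadic_bands.

(** * The Fourier transform of the lacunary series *)

Section frequency_side.
Context {R : realType} {n : nat}.
Implicit Types (phi : 'rV[R]_n -> R[i]) (x xi : 'rV[R]_n) (s : R).
Notation mu := (lebesgue_rV n).
Variables (theta : 'rV[R]_n) (d : R) (v : 'rV[R]_n -> R[i]).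
Hypotheses (theta1 : enorm theta = 1) (sv : schwartz v)
  (suppv : forall xi, fourier v xi != 0 -> enorm xi < 1 / 20).

Let cw (j : nat) : R[i] := (wcoef d j)%:C%C.

(** The Fourier transform of the part of the series with indices from [N + 1]
    to [M]. *)
Definition wband (N M : nat) : 'rV[R]_n -> R[i] := bandsum theta v cw N M.

(** The Fourier transform of the remainder of the series after the index [N];
    [N = 0] gives that of [w]. *)
Definition wtail (N : nat) xi : R[i] := climn (fun M => wband N M xi).

Lemma schwartz_wband N M : schwartz (wband N M).
Proof. exact: schwartz_bandsum. Qed.

(** At each point the partial sums are eventually constant. *)
Lemma wband_ccvg N xi : ccvg (fun M => wband N M xi) (wtail N xi).
Proof.
have [j0 h] := bandsumE theta1 suppv xi.
pose l := if (N < j0)%N then cw j0 * vhat theta v j0 xi else 0.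
suff H : ccvg (fun M => wband N M xi) l by rewrite /wtail (ccvg_climn H).
apply: (ccvg_near _ (ccvg_cst l)); exists j0 => // M /= j0M.
by rewrite /wband h j0M andbT.
Qed.

(** Only one bump contributes, with [2 ^+ j <= 1 + enorm xi], so its
    coefficient is polynomially bounded in [xi]. *)
Lemma wband_bound : exists m C, 0 <= C /\
  forall N M xi, normc (wband N M xi) <= C * (1 + enorm xi) ^+ m.
Proof.
have [m hm] := wcoef_le d.
have [C C0 hC] := rapid_ge0 0 (fourier_rapid sv).
exists m, C; split=> // N M xi.
have [j0 h] := bandsumE theta1 suppv xi.
have R0 : 0 <= C * (1 + enorm xi) ^+ m.
  by rewrite mulr_ge0// exprn_ge0// ltW// enorm1_gt0.
rewrite /wband h; case: ifP => _; last by rewrite normc0.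
have [->|hv] := eqVneq (vhat theta v j0 xi) 0; first by rewrite mulr0 normc0.
have /andP[hj _] := band_enorm theta1 suppv hv.
rewrite normcM normcR (ger0_norm (wcoef_ge0 _ _)) mulrC.
apply: ler_pM; rewrite ?normc_ge0 ?wcoef_ge0//.
  by have := hC (xi - 2 ^+ j0 *: theta); rewrite expr0 invr1 mulr1.
apply: le_trans (hm j0) _; rewrite lerXn2r ?nnegrE ?exprn_ge0 ?(ltW (enorm1_gt0 _))//.
by move: hj; move: (2 ^+ j0) (enorm xi) => a b hj; lra.
Qed.

Lemma wtail_bound : exists m C, 0 <= C /\
  forall N xi, normc (wtail N xi) <= C * (1 + enorm xi) ^+ m.
Proof.
have [m [C [C0 h]]] := wband_bound; exists m, C; split=> // N xi.
by apply: ccvg_le (wband_ccvg N xi) => M.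
Qed.

Lemma cmeasurable_wtail N : cmeasurable (wtail N).
Proof.
have mb M := schwartz_measurable (schwartz_wband N M).
split.
  apply: (measurable_fun_cvg (h := fun M xi => complex.Re (wband N M xi))) => [M|xi _].
    by have [] := mb M.
  by have [] := wband_ccvg N xi.
apply: (measurable_fun_cvg (h := fun M xi => complex.Im (wband N M xi))) => [M|xi _].
  by have [] := mb M.
by have [] := wband_ccvg N xi.
Qed.

(** A common integrable majorant for polynomially bounded functions against a
    Schwartz function. *)
Lemma growth_dominated (C : R) m phi : schwartz phi -> 0 <= C ->
  exists2 G : 'rV[R]_n -> R, mu.-integrable setT (EFin \o G) &
    forall z xi, normc z <= C * (1 + enorm xi) ^+ m -> normc (z * phi xi) <= G xi.
Proof.
move=> sp C0; have [K K0 hK] := rapid_ge0 (m + n.*2) (schwartz_rapid [::] sp).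
eexists; first exact: (integrableZl measurableT (C * K) (integrable_weight (R := R) (leqnn n.*2))).
move=> z xi h; rewrite normcM.
apply: le_trans (ler_pM (normc_ge0 _) (normc_ge0 _) h (hK xi)) _.
rewrite exprD invfM le_eqVlt; apply/orP; left; apply/eqP.
have : (1 + enorm xi) ^+ m * (1 + enorm xi) ^- m = 1.
  by rewrite divff// expf_neq0// gt_eqF// enorm1_gt0.
move: (_ ^+ m) => a; move: (a^-1) ((1 + enorm xi) ^- n.*2) => b c ab.
by transitivity (C * K * c * (a * b)); [ring|rewrite ab mulr1].
Qed.

Lemma cintegrable_wtail N phi : schwartz phi -> cintegrable (fun xi => wtail N xi * phi xi).
Proof.
move=> sp; have [m [C [C0 h]]] := wtail_bound.
have [G IG hG] := growth_dominated m sp C0.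
apply: cintegrable_dom IG; last by move=> xi; exact: hG.
by apply: cmeasurableM; [exact: cmeasurable_wtail|exact: schwartz_measurable].
Qed.

Lemma wtail_pairing_ccvg N phi : schwartz phi ->
  ccvg (fun M => cint (fun xi => wband N M xi * phi xi)) (cint (fun xi => wtail N xi * phi xi)).
Proof.
move=> sp; have mp := schwartz_measurable sp.
have [m [C [C0 h]]] := wband_bound.
have [G IG hG] := growth_dominated m sp C0.
apply: cint_dom_cvg IG _; last by move=> M xi; apply: hG.
- by move=> M; apply: cmeasurableM => //; exact/schwartz_measurable/schwartz_wband.
- exact: cmeasurableM (cmeasurable_wtail N) mp.
- by move=> xi; apply: ccvgM; [exact: wband_ccvg|exact: ccvg_cst].
Qed.

Lemma schwartz_modulated j : schwartz (fun x => expi (dotp (2 ^+ j *: theta) x) * v x).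
Proof.
have := schwartz_expi (2 ^+ j *: theta) 0 sv.
by under eq_fun do rewrite add0r dotpC.
Qed.

Lemma fourier_modulated j :
  fourier (fun x => expi (dotp (2 ^+ j *: theta) x) * v x) = vhat theta v j.
Proof. by apply/funext => xi; rewrite fourier_shift. Qed.

(** Shift and multiplication formulas move the Fourier transform from [phi] to
    the modulated [v]. *)
Lemma wterm_pairing j phi : schwartz phi ->
  wterm theta d (fun x => v x * fourier phi x) 0 j =
  cint (fun xi => cw j * vhat theta v j xi * phi xi).
Proof.
move=> sp; rewrite /wterm -fourier_shift.
under [RHS]eq_cint do rewrite -mulrA.
have sh := schwartzM (schwartz_vhat theta sv j) (schwartz_moderate sp).
rewrite cintZ; last exact: schwartz_cintegrable.
congr (_ * _); rewrite -fourier_modulated fourier_multiplication; last 2 first.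
- exact/schwartz_cintegrable/schwartz_modulated.
- exact: schwartz_cintegrable.
apply: eq_cint => x; rewrite dotpC dotp0l oppr0 expi0 mul1r mulrA; by [].
Qed.

Lemma of_fun_wpart_fourier N phi : schwartz phi ->
  of_fun (wpart theta d v N) (fourier phi) = cint (fun xi => wband 0 N xi * phi xi).
Proof.
move=> sp; rewrite of_fun_wpart0//; last exact: schwartz_fourier.
under [RHS]eq_cint do rewrite mulr_suml.
rewrite cint_sum; last first.
  move=> j _; apply: schwartz_cintegrable; apply: schwartzM; last exact: schwartz_moderate.
  by apply: schwartzZ; exact: schwartz_vhat.
by apply: eq_bigr => j _; rewrite wterm_pairing.
Qed.

Lemma wtail_pairing N phi : schwartz phi ->
  wdist v theta d (fourier phi) - of_fun (wpart theta d v N) (fourier phi) =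
  cint (fun xi => wtail N xi * phi xi).
Proof.
move=> sp; have sF := schwartz_fourier sp.
have H := ccvgD (of_fun_wpart_ccvg d theta1 sv sF) (ccvg_cst (- of_fun (wpart theta d v N) (fourier phi))).
apply: (ccvg_unique H); apply: (ccvg_near _ (wtail_pairing_ccvg N sp)).
exists N => // M /= NM; rewrite !of_fun_wpart_fourier//.
have I N' M' : cintegrable (fun xi => wband N' M' xi * phi xi).
  apply: schwartz_cintegrable; apply: schwartzM (schwartz_moderate sp).
  exact: schwartz_wband.
have -> : (fun xi => wband 0 M xi * phi xi) =
    (fun xi => wband 0 N xi * phi xi + wband N M xi * phi xi).
  apply/funext => xi; rewrite -mulrDl; congr (_ * _).
  by rewrite /wband /bandsum (big_cat_nat (n := N.+1)).
by rewrite cintD// addrAC subrr add0r.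
Qed.

Lemma wpart0 : wpart theta d v 0 = fun=> 0.
Proof. by apply/funext => x; rewrite /wpart big_geq. Qed.

Lemma wdist_fourier phi : schwartz phi ->
  wdist v theta d (fourier phi) = cint (fun xi => wtail 0 xi * phi xi).
Proof.
move=> sp; rewrite -(wtail_pairing 0 sp) wpart0 /of_fun.
by under eq_cint do rewrite mul0r; rewrite cint0 subr0.
Qed.

(** The ratio of the geometric series that decides between [s < d] and [d <=
    s]. *)
Lemma wcoef_bracket s j : wcoef d j ^+ 2 * (4 ^+ j) `^ s = (4 `^ (s - d)) ^+ j.
Proof.
have e4 : (4 : R) = 2 `^ 2%:R by rewrite powR_mulrn//; ring.
have -> : ((4 : R) ^+ j) `^ s = 4 `^ (j%:R * s).
  by rewrite -powR_mulrn// -powRrM.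
have -> : wcoef d j ^+ 2 = 4 `^ (- j%:R * d).
  rewrite /wcoef -powR_mulrn ?powR_ge0// -powRrM [in RHS]e4 -powRrM.
  by congr (_ `^ _); rewrite mulrC.
rewrite -powRD; last by apply/implyP => _; rewrite pnatr_eq0.
by rewrite -powR_mulrn ?powR_ge0// -powRrM; congr (_ `^ _); ring.
Qed.

Lemma energy_wband s N M :
  (energy s (wband N M) <=
    (4 `^ `|s| * mass v * \sum_(N.+1 <= j < M.+1) (4 `^ (s - d)) ^+ j)%R%:E)%E.
Proof.
apply: le_trans (energy_bandsum theta1 sv suppv s _ N M) _.
rewrite lee_fin le_eqVlt; apply/orP; left; apply/eqP; rewrite mulr_sumr.
apply: eq_bigr => j _; rewrite /cw normcR (ger0_norm (wcoef_ge0 _ _)) -wcoef_bracket; ring.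
Qed.

(** Monotone convergence, the squared moduli of the partial sums being
    nondecreasing. *)
Lemma energy_wtail s N (B : R) :
  (forall M, (energy s (wband N M) <= B%:E)%E) -> (energy s (wtail N) <= B%:E)%E.
Proof.
move=> hB.
have b0 xi : 0 <= bracket s xi by exact/ltW/bracket_gt0.
pose g M xi := (bracket s xi * normc (wband N M xi) ^+ 2)%:E.
have := @cvg_monotone_convergence _ _ _ mu setT measurableT g.
have -> : (fun xi => limn (g ^~ xi)) = (fun xi => (bracket s xi * normc (wtail N xi) ^+ 2)%:E).
  apply/funext => xi; apply/cvg_lim => //; apply: cvg_EFin; first exact: nearW.
  apply: cvgM; first exact: cvg_cst.
  have h := ccvg_normc (wband_ccvg N xi).
  by rewrite expr2; under eq_fun do rewrite expr2; exact: cvgM.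
move=> H; have {}H := H _ _ _.
have cv : (\int[mu]_x g M x)%E @[M --> \oo] --> energy s (wtail N).
  apply: H => [M|M xi _|xi _ M1 M2 M12].
  - apply/measurable_EFinP; apply: measurable_funM; first exact: measurable_bracket.
    by apply: cmeasurable_normc_sq; apply: schwartz_measurable; exact: schwartz_wband.
  - by rewrite lee_fin mulr_ge0 ?sqr_ge0.
  rewrite lee_fin ler_wpM2l// /wband !normc_bandsum_sq//.
  have [M1N|NM1] := leqP M1 N.
    by rewrite [leLHS]big_geq ?ltnS// sumr_ge0// => j _; exact: sqr_ge0.
  rewrite [leRHS](big_cat_nat (n := M1.+1))/= ?ltnS ?(ltnW NM1)//.
  by rewrite lerDl sumr_ge0// => j _; exact: sqr_ge0.
rewrite -(cvg_lim (@ereal_hausdorff R) cv).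
by apply: lime_le; [apply/cvg_ex; eexists; exact: cv|apply: nearW => M; exact: hB].
Qed.

Lemma geometric_tail_le (q : R) N M : 0 < q -> q < 1 ->
  \sum_(N.+1 <= j < M.+1) q ^+ j <= q ^+ N.+1 / (1 - q).
Proof.
move=> q0 q1; have q1' : 0 < 1 - q by rewrite subr_gt0.
rewrite ler_pdivlMr// mulr_suml.
under eq_bigr do rewrite mulrBr mulr1 -exprSr.
have [MN|NM] := leqP M N.
  by rewrite big_geq ?exprn_ge0 ?(ltW q0)// ltnS.
rewrite (@telescope_sumr_eq _ N.+1 M.+1 (fun j => - q ^+ j)) ?ltnS ?(ltnW NM)//; last first.
  by move=> j _; rewrite opprK addrC.
by rewrite opprK addrC lerBlDr lerDl exprn_ge0// ltW.
Qed.

Lemma energy_wtail_lt s N : s < d ->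
  (energy s (wtail N) <=
   (4 `^ `|s| * mass v / (1 - 4 `^ (s - d)) * (4 `^ (s - d)) ^+ N.+1)%R%:E)%E.
Proof.
move=> sd; set q := 4 `^ (s - d).
have q0 : 0 < q by rewrite powR_gt0.
have q1 : q < 1.
  have ds : 0 < d - s by rewrite subr_gt0.
  rewrite /q -opprB powRN invf_lt1 ?powR_gt0//.
  apply: le_lt_trans (_ : 1 `^ (d - s) < _); first by rewrite powR1.
  by rewrite gt0_ltr_powR// ?nnegrE// ltr1n.
apply: energy_wtail => M; apply: le_trans (energy_wband s N M) _.
rewrite lee_fin -[leRHS]mulrA ler_wpM2l//.
  by rewrite mulr_ge0 ?powR_ge0 ?mass_ge0.
by rewrite [leRHS]mulrC geometric_tail_le.
Qed.

End frequency_side.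

(** * Sobolev regularity of the lacunary series *)

Section sobolev_regularity.
Context {R : realType} {n : nat}.
Implicit Types (phi : 'rV[R]_n -> R[i]) (x xi : 'rV[R]_n) (s : R).
Notation mu := (lebesgue_rV n).
Variables (theta : 'rV[R]_n) (d : R) (v : 'rV[R]_n -> R[i]).
Hypotheses (theta1 : enorm theta = 1) (sv : schwartz v)
  (suppv : forall xi, fourier v xi != 0 -> enorm xi < 1 / 20).

Lemma sobolev_norm_energy s (u : functional R n) g (B : R) : cmeasurable g -> deq (dfourier u) (of_fun g) ->
  (energy s g <= B%:E)%E -> (sobolev_norm s u <= (Num.sqrt B)%:E)%E.
Proof.
move=> mg ug gB; have B0 : 0 <= B by rewrite -lee_fin (le_trans (energy_ge0 s g)).
by apply: (sobolev_norm_le mg ug); rewrite ?sqrtr_ge0// sqr_sqrtr.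
Qed.

Lemma energy_opp s (g : 'rV[R]_n -> R[i]) : energy s (fun xi => - g xi) = energy s g.
Proof. by apply: eq_integral => xi _; rewrite normc_opp. Qed.

Lemma sobolev_wpart s N : sobolev s (of_fun (wpart theta d v N)).
Proof.
split; first exact/tempered_of_fun/schwartz_wpart.
apply: le_lt_trans (ltry _).
apply: (sobolev_norm_energy (g := wband theta d v 0 N)); last exact: energy_wband.
  exact/schwartz_measurable/schwartz_wband.
by move=> phi sp; exact: of_fun_wpart_fourier.
Qed.

Lemma sobolev_wdist_lt s : s < d -> sobolev s (wdist v theta d).
Proof.
move=> sd; split; first exact: tempered_wdist.
apply: le_lt_trans (ltry _).
apply: (sobolev_norm_energy (g := wtail theta d v 0)); last exact: energy_wtail_lt.
  exact: cmeasurable_wtail.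
by move=> phi sp; exact: wdist_fourier.
Qed.

(** Written as a combination [c * u1 + u2], the form in which linearity is
    assumed for extensions of the operator. *)
Definition wremainder N : functional R n := fun phi =>
  - 1 * wdist v theta d phi + of_fun (wpart theta d v N) phi.

Lemma sobolev_norm_remainder s N : s < d ->
  (sobolev_norm s (wremainder N) <=
   (Num.sqrt (4 `^ `|s| * mass v / (1 - 4 `^ (s - d)) * (4 `^ (s - d)) ^+ N.+1))%R%:E)%E.
Proof.
move=> sd.
apply: (sobolev_norm_energy (g := fun xi => - wtail theta d v N xi)).
- have -> : (fun xi => - wtail theta d v N xi) = (fun xi => (-1) * wtail theta d v N xi).
    by apply/funext => xi; rewrite mulN1r.
  by apply: cmeasurableM; [exact: cmeasurable_cst|exact: cmeasurable_wtail].
- move=> phi sp; transitivity (- 1 * cint (fun xi => wtail theta d v N xi * phi xi)).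
    by rewrite -wtail_pairing// /dfourier /wremainder !mulN1r opprB addrC.
  rewrite -cintZ; last exact: cintegrable_wtail.
  by apply: eq_cint => xi; rewrite mulN1r mulNr.
by rewrite energy_opp; exact: energy_wtail_lt.
Qed.

Lemma bandsum_pairing (a b : nat -> R[i]) J M xi : (J <= M)%N ->
  bandsum theta v a 0 M xi * conjc (bandsum theta v b 0 J xi) =
  \sum_(1 <= j < J.+1) a j * conjc (b j) * (vhat theta v j xi * conjc (vhat theta v j xi)).
Proof.
move=> JM; have [j0 h] := bandsumE theta1 suppv xi.
have -> : \sum_(1 <= j < J.+1) a j * conjc (b j) * (vhat theta v j xi * conjc (vhat theta v j xi)) =
    bandsum theta v (fun j => a j * conjc (b j) * conjc (vhat theta v j xi)) 0 J xi.
  by rewrite /bandsum; apply: eq_bigr => j _; ring.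
rewrite !h; case: ifP => [/andP[j1 j2]|h1].
  rewrite j1; case: ifP => j3; last by rewrite conjc0 mulr0.
  by rewrite conjcM; ring.
case: ifP => [/andP[j1 j2]|_]; last by rewrite mul0r.
by move: h1; rewrite j1 (leq_trans j2 JM).
Qed.

Lemma cint_real (h : 'rV[R]_n -> R) : cint (fun x => (h x)%:C%C) = (\int[mu]_x h x)%:C%C.
Proof.
rewrite /cint [X in Complex _ X](_ : _ = 0)//.
by rewrite /Rintegral integral0.
Qed.

Lemma cint_vhat_sq j :
  cint (fun xi => vhat theta v j xi * conjc (vhat theta v j xi)) = (mass v)%:C%C.
Proof.
under eq_cint do rewrite mulc_conj.
rewrite (cint_real (fun xi => normc (vhat theta v j xi) ^+ 2)).
have -> : \int[mu]_xi (normc (vhat theta v j xi) ^+ 2) = mass v.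
  by rewrite {1}/Rintegral (mass_vhat theta sv j).
by [].
Qed.

(** The coefficients [1 / wcoef d j] cancel those of [w], so each index
    contributes [mass v]. *)
Lemma wdist_test J :
  wdist v theta d (fourier (fun xi => conjc (bandsum theta v (fun j => ((wcoef d j)^-1)%:C%C) 0 J xi))) =
  (J%:R * mass v)%:C%C.
Proof.
have sb := schwartz_conj (schwartz_bandsum theta sv (fun j => ((wcoef d j)^-1)%:C%C) 0 J).
rewrite (wdist_fourier d theta1 sv suppv sb).
apply: (ccvg_unique (wtail_pairing_ccvg d theta1 sv suppv 0 sb)).
apply: (ccvg_near _ (ccvg_cst _)); exists J => // M /= JM.
under [RHS]eq_cint do rewrite bandsum_pairing//.
rewrite cint_sum; last first.
  move=> j _; apply: schwartz_cintegrable; apply: schwartzZ.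
  have sh := schwartz_vhat theta sv j.
  exact: schwartzM sh (schwartz_moderate (schwartz_conj sh)).
rewrite (eq_bigr (fun=> (mass v)%:C%C)); last first.
  move=> j _; rewrite cintZ; last first.
    have sh := schwartz_vhat theta sv j.
    exact: schwartz_cintegrable (schwartzM sh (schwartz_moderate (schwartz_conj sh))).
  rewrite cint_vhat_sq conjc_real -real_complexM divff ?mul1r// gt_eqF//.
  exact: wcoef_gt0.
rewrite big_const_nat iter_addr_0 subn1/=.
by elim: J {sb JM} => [|J IH]; rewrite ?mulr0n ?mul0r// mulrS -IH -natr1 mulrDl mul1r addrC raddfD.
Qed.

Lemma energy_test s J : d <= s ->
  (energy (- s) (fun xi => conjc (bandsum theta v (fun j => ((wcoef d j)^-1)%:C%C) 0 J xi)) <=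
   (4 `^ `|s| * mass v * J%:R)%R%:E)%E.
Proof.
move=> ds.
have -> : energy (- s) (fun xi => conjc (bandsum theta v (fun j => ((wcoef d j)^-1)%:C%C) 0 J xi)) =
   energy (- s) (bandsum theta v (fun j => ((wcoef d j)^-1)%:C%C) 0 J).
  by apply: eq_integral => xi _; rewrite normc_conj.
apply: le_trans (energy_bandsum theta1 sv suppv _ _ 0 J) _.
rewrite lee_fin.
have -> : J%:R = \sum_(1 <= j < J.+1) (1 : R) by rewrite big_const_nat iter_addr_0 subn1.
rewrite mulr_sumr; apply: ler_sum => j _.
rewrite normcR ger0_norm ?invr_ge0 ?wcoef_ge0// normrN.
rewrite mulrCA mulr1 ler_wpM2r ?mass_ge0// -[leRHS]mulr1 ler_wpM2l ?powR_ge0//.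
rewrite powRN exprVn -invfM wcoef_bracket invf_le1; last by rewrite exprn_gt0// powR_gt0.
rewrite exprn_ege1//.
apply: le_trans (_ : 4 `^ 0 <= _); first by rewrite powRr0.
by apply: ler_powR; [rewrite ler1n|rewrite subr_ge0].
Qed.

(** For [d <= s], [wdist_test] and [energy_test] in [sobolev_dual] bound [J *
    mass v] independently of [J], which is absurd. *)
Lemma sobolev_wdist (v_neq0 : v <> (fun=> 0)) s : sobolev s (wdist v theta d) <-> s < d.
Proof.
split; last exact: sobolev_wdist_lt.
move=> [_ fin]; rewrite ltNge; apply/negP => ds.
have [M M0 hM] : exists2 M : R, 0 <= M & (sobolev_norm s (wdist v theta d) < M%:E)%E.
  move: fin; case: (sobolev_norm _ _) => [r| |]// _.
    by exists (`|r| + 1); rewrite ?addr_ge0// lte_fin ltr_pwDr// ler_norm.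
  by exists 0 => //; rewrite ltNyr.
have m0 : 0 < mass v by exact: mass_gt0.
set C : R := 4 `^ `|s|; have C0 : 0 <= C by exact: powR_ge0.
(* the square of the duality estimate J * mass <= 2 M sqrt (C * mass * J), divided by J * mass *)
have key J : J%:R * mass v <= 4 * M ^+ 2 * C.
  case: J => [|J]; first by rewrite mul0r !mulr_ge0// sqr_ge0.
  have J0 : (0 : R) < J.+1%:R by rewrite ltr0n.
  have B0 : 0 <= C * mass v * J.+1%:R by rewrite !mulr_ge0// ltW.
  have sb := schwartz_conj (schwartz_bandsum theta sv (fun j => ((wcoef d j)^-1)%:C%C) 0 J.+1).
  have E : (energy (- s) (fun xi => conjc (bandsum theta v (fun j => ((wcoef d j)^-1)%:C%C) 0 J.+1 xi)) <=
      (Num.sqrt (C * mass v * J.+1%:R) ^+ 2)%:E)%E.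
    by rewrite sqr_sqrtr//; exact: energy_test.
  have := sobolev_dual sb (sqrtr_ge0 _) hM E.
  rewrite wdist_test normcR ger0_norm; last by rewrite mulr_ge0 ?(ltW m0)// ltW.
  have := sqr_sqrtr B0; have := sqrtr_ge0 (C * mass v * J.+1%:R).
  move: J0 m0; move: (Num.sqrt _) => r; move: (mass v) => m J0 m0; move: (J.+1%:R : R) J0 => j j0 r0 r2 h.
  have jm : 0 < j * m by rewrite mulr_gt0.
  have h2 : (j * m) ^+ 2 <= (2 * (M * r)) ^+ 2.
    by rewrite lerXn2r// nnegrE ?(ltW jm)// !mulr_ge0.
  rewrite -(ler_pM2r jm) -expr2; apply: le_trans h2 _.
  rewrite !exprMn r2 le_eqVlt; apply/orP; left; apply/eqP; ring.
have [J hJ] : exists J : nat, 4 * M ^+ 2 * C < J%:R * mass v.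
  exists (Num.bound (4 * M ^+ 2 * C / mass v)); rewrite -ltr_pdivrMr//.
  by apply: archi_boundP; rewrite divr_ge0 ?(ltW m0)// !mulr_ge0// sqr_ge0.
by have := key J; rewrite leNgt hJ.
Qed.

End sobolev_regularity.

(** * Further facts on tempered functionals *)

Section tempered_functionals.
Context {R : realType} {n : nat}.
Implicit Types (phi : 'rV[R]_n -> R[i]) (x xi : 'rV[R]_n) (s : R) (u : functional R n).
Notation mu := (lebesgue_rV n).

(** Microlocal smoothness only involves the values on products of test
    functions and imaginary exponentials, which are Schwartz functions. *)
Lemma WF_deq (u1 u2 : functional R n) : deq u1 u2 -> WF u1 = WF u2.
Proof.
move=> u12; apply/seteqP.
suff sub (u u' : functional R n) : deq u u' -> WF u `<=` WF u'.
  by split; apply: sub => // phi sp; rewrite u12.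
move=> uu' [x0 xi0] [xi00 nsm]; split=> //; apply: contra_not nsm.
move=> [phi [V [tphi phi0 oV cV h]]]; exists phi, V; split=> // N.
have [C hC] := h N; exists C => xi Vxi; rewrite uu'; first exact: hC.
have := schwartz_fourier_phase xi (test_schwartz tphi).
by under eq_fun do rewrite mulrC.
Qed.

Lemma tempered_lin (c : R[i]) (u1 u2 : functional R n) : tempered u1 -> tempered u2 ->
  tempered (fun phi => c * u1 phi + u2 phi).
Proof.
move=> [l1 [N1 [C1 h1]]] [l2 [N2 [C2 h2]]]; split.
  move=> b phi psi sp ss; rewrite l1// l2//; ring.
(* absolute values, since nothing is known about the signs of C1 and C2 *)
exists (maxn N1 N2), (normc c * `|C1| + `|C2|) => phi sp.
have F N : (schwartz_norm N phi = (fine (schwartz_norm N phi))%:E)%E.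
  by rewrite fineK// schwartz_norm_fin.
have S0 N : 0 <= fine (schwartz_norm N phi) by apply: fine_ge0; exact: schwartz_norm_ge0.
have {}h1 : normc (u1 phi) <= C1 * fine (schwartz_norm N1 phi).
  by rewrite -lee_fin EFinM -F; exact: h1.
have {}h2 : normc (u2 phi) <= C2 * fine (schwartz_norm N2 phi).
  by rewrite -lee_fin EFinM -F; exact: h2.
rewrite (F (maxn N1 N2)) -EFinM lee_fin.
apply: le_trans (ler_normcD _ _) _; rewrite normcM mulrDl -mulrA.
have b (C : R) N M : (N <= M)%N -> C * fine (schwartz_norm N phi) <= `|C| * fine (schwartz_norm M phi).
  move=> NM; apply: (le_trans (ler_wpM2r (S0 N) (ler_norm C))).
  by rewrite ler_wpM2l// schwartz_norm_mono.
apply: lerD; last exact: le_trans h2 (b _ _ _ (leq_maxr _ _)).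
by rewrite ler_wpM2l ?normc_ge0//; exact: le_trans h1 (b _ _ _ (leq_maxl _ _)).
Qed.

Lemma sobolev_norm_ge0 s u : (0 <= sobolev_norm s u)%E.
Proof. by apply: le_ereal_inf_tmp => _ [g _ <-]; exact: Lnorm_ge0. Qed.

Lemma bracket_le s xi : bracket s xi <= (1 + enorm xi) ^+ (Num.bound `|s|).*2.
Proof.
have e0 := enorm_ge0 xi.
have b1 : 1 <= 1 + enorm xi ^+ 2 by rewrite lerDl sqr_ge0.
apply: le_trans (_ : (1 + enorm xi ^+ 2) `^ (Num.bound `|s|)%:R <= _).
  apply: ler_powR => //; rewrite (le_trans (ler_norm s))// ltW// .
  by have := archi_boundP (normr_ge0 s).
rewrite powR_mulrn ?(le_trans ler01)// -mul2n exprM lerXn2r ?nnegrE ?sqr_ge0 ?(le_trans ler01)//.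
by rewrite sqrrD; nra.
Qed.

Lemma energy_schwartz s phi : schwartz phi ->
  exists2 K : R, 0 <= K & (energy s phi <= (K ^+ 2)%:E)%E.
Proof.
move=> sp; set m := Num.bound `|s|.
have [C C0 hC] := rapid_ge0 (m + n) (schwartz_rapid [::] sp).
have I : mu.-integrable setT (EFin \o (fun xi => bracket s xi * normc (phi xi) ^+ 2)).
  apply: integrable_dom (integrableZl measurableT (C ^+ 2) (integrable_weight (R := R) (leqnn n.*2))).
    apply: measurable_funM; first exact: measurable_bracket.
    by apply: cmeasurable_normc_sq; exact: schwartz_measurable.
  move=> xi; rewrite ger0_norm; last by rewrite mulr_ge0 ?sqr_ge0// ltW// bracket_gt0.
  have a0 := enorm1_gt0 xi.
  have h : normc (phi xi) ^+ 2 <= (C * (1 + enorm xi) ^- (m + n)) ^+ 2.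
    by rewrite lerXn2r ?nnegrE ?normc_ge0 ?(le_trans (normc_ge0 _) (hC xi)).
  apply: le_trans (ler_pM (ltW (bracket_gt0 _ _)) (sqr_ge0 _) (bracket_le s xi) h) _.
  rewrite -/m exprMn exprVn -exprM muln2 doubleD exprD invfM.
  rewrite le_eqVlt; apply/orP; left; apply/eqP.
  have : (1 + enorm xi) ^+ m.*2 * (1 + enorm xi) ^- m.*2 = 1.
    by rewrite divff// expf_neq0// gt_eqF.
  move: (_ ^+ m.*2) => a; move: (a^-1) (_ ^- _) => b c ab.
  by transitivity (C ^+ 2 * c * (a * b)); [ring|rewrite ab mulr1].
exists (Num.sqrt (fine (energy s phi))); first exact: sqrtr_ge0.
rewrite sqr_sqrtr; last by apply: fine_ge0; exact: energy_ge0.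
by rewrite fineK//; exact: integrable_fin_num I.
Qed.

End tempered_functionals.

(** * The operator of type 1,1 *)

Section operator.
Context {R : realType} {n : nat}.
Implicit Types (phi : 'rV[R]_n -> R[i]) (x xi : 'rV[R]_n) (s : R).
Variables (theta : 'rV[R]_n) (d : R) (v chi : 'rV[R]_n -> R[i]).
Hypotheses (theta1 : enorm theta = 1) (sv : schwartz v)
  (suppv : forall xi, fourier v xi != 0 -> enorm xi < 1 / 20)
  (supp_chi : supp chi `<=` [set eta | 3 / 4 <= enorm eta <= 5 / 4])
  (chi1 : forall eta, 9 / 10 <= enorm eta <= 11 / 10 -> chi eta = 1).

(** For [xi] in the [k]-th bump, [2 ^- j *: xi] has norm within [1/40] of [1]
    if [j = k], at least [2 - 1/20] if [j < k], and at most [1/2 + 1/20] if [j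
    > k]. *)
Lemma chi_band j k xi : (0 < k)%N -> vhat theta v k xi != 0 ->
  chi (2 ^- j *: xi) = (j == k)%:R.
Proof.
move=> k0 /(band_enorm theta1 suppv)/andP[h1 h2].
have p0 m : (0 : R) < 2 ^+ m by rewrite exprn_gt0.
have e1 : enorm (2 ^- j *: xi) = enorm xi / 2 ^+ j.
  by rewrite enormZ ger0_norm ?invr_ge0 ?(ltW (p0 _))// mulrC.
have k2 : (2 : R) <= 2 ^+ k by rewrite -[leLHS]expr1 ler_weXn2l// ler1n.
have [jk|jk] := eqVneq j k.
  by apply: chi1; rewrite e1 jk ler_pdivlMr// ler_pdivrMr//; apply/andP; split; lra.
apply: supp_eq0 => /supp_chi /=; rewrite e1 ler_pdivlMr// ler_pdivrMr// => /andP[].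
move: jk; rewrite neq_ltn => /orP[jk|kj].
  have : (2 : R) * 2 ^+ j <= 2 ^+ k by rewrite -exprS ler_weXn2l// ler1n.
  have : (1 : R) <= 2 ^+ j by rewrite exprn_ege1// ler1n.
  move: (2 ^+ j) => a a1 ab _ ae; lra.
have : (2 : R) * 2 ^+ k <= 2 ^+ j by rewrite -exprS ler_weXn2l// ler1n.
move: (2 ^+ j) => a ab ae _; lra.
Qed.

(** A single term of the symbol survives on each bump. *)
Lemma a2theta_band k x xi : (0 < k)%N -> vhat theta v k xi != 0 ->
  a2theta d theta chi x xi = (2 `^ (k%:R * d))%:C%C * expi (- (2 ^+ k * dotp x (2 *: theta))).
Proof.
move=> k0 hk; apply: ccvg_climn; apply: (ccvg_near _ (ccvg_cst _)).
exists k => // N /= kN.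
have kin : k \in index_iota 1 N.+1 by rewrite mem_index_iota ltnS k0.
rewrite (bigD1_seq k)//= ?iota_uniq// (chi_band k k0 hk) eqxx mulr1 big1 ?addr0// => j jk.
by rewrite (chi_band j k0 hk) (negbTE jk) mulr0.
Qed.

Lemma fourier_wpart N : fourier (wpart theta d v N) = wband theta d v 0 N.
Proof.
apply/funext => xi; rewrite /fourier.
transitivity (cint (fun x => \sum_(1 <= j < N.+1) (wcoef d j)%:C%C *
    (expi (- dotp x xi) * (expi (dotp (2 ^+ j *: theta) x) * v x)))).
  apply: eq_cint => x; rewrite mulr_sumr; apply: eq_bigr => j _.
  rewrite dotpZl /wcoef; ring.
have I j : cintegrable (fun x => expi (- dotp x xi) * (expi (dotp (2 ^+ j *: theta) x) * v x)).
  by apply: cintegrable_phase; apply: schwartz_cintegrable; exact: schwartz_modulated.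
rewrite cint_sum; last by move=> j _; exact: cintegrableZ.
apply: eq_bigr => j _; rewrite cintZ// -fourier_modulated; by [].
Qed.

(** Each modulation is inverted separately: [a(x, D)] replaces [2^(-jd) expi
    (2^j theta . x)] by [expi (2^j theta . x - 2 * 2^j theta . x)]. *)
Lemma pseudo_wpart N : pseudo_diff (a2theta d theta chi) (wpart theta d v N) =
  wpart (- theta) 0 v N.
Proof.
apply/funext => x; rewrite /pseudo_diff fourier_wpart.
transitivity (((2 * pi) ^- n)%:C%C * cint (fun xi => \sum_(1 <= j < N.+1)
    expi (- (2 ^+ j * dotp x (2 *: theta))) * (expi (dotp x xi) * vhat theta v j xi))).
  congr (_ * _); apply: eq_cint => xi; rewrite /wband /bandsum mulr_sumr.
  rewrite big_nat_cond [RHS]big_nat_cond; apply: eq_bigr => j; rewrite andbT => /andP[j0 _].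
  have [->|hj] := eqVneq (vhat theta v j xi) 0; first by rewrite !mulr0.
  rewrite (a2theta_band x j0 hj).
  have e : (2 `^ (j%:R * d))%:C%C * (wcoef d j)%:C%C = 1 :> R[i].
    by rewrite -real_complexM /wcoef mulNr powRN divff// gt_eqF// powR_gt0.
  move: e; move: (_%:C%C) (_%:C%C) => a b ab.
  transitivity (a * b * (expi (- (2 ^+ j * dotp x (2 *: theta))) * (expi (dotp x xi) * vhat theta v j xi))).
    ring.
  by rewrite (mulrC a) ab mul1r.
have I j : cintegrable (fun xi => expi (dotp x xi) * vhat theta v j xi).
  apply: schwartz_cintegrable; have := schwartz_expi x 0 (schwartz_vhat theta sv j).
  by under eq_fun do rewrite add0r dotpC.
rewrite cint_sum; last by move=> j _; exact: cintegrableZ.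
rewrite mulr_sumr; apply: eq_bigr => j _; rewrite cintZ//.
rewrite -fourier_modulated fourier_inversion; last exact: schwartz_modulated.
rewrite mulr0 powRr0 mul1r.
have pe : ((2 * pi) ^- n)%:C%C * ((2 * pi) ^+ n)%:C%C = 1 :> R[i].
  by rewrite -real_complexM mulVf// expf_neq0// mulf_neq0// gt_eqF// pi_gt0.
have ee : expi (2 ^+ j * dotp (- theta) x) =
    expi (- (2 ^+ j * dotp x (2 *: theta))) * expi (dotp (2 ^+ j *: theta) x).
  rewrite -expiD; congr expi; rewrite dotpNl dotpZr dotpZl (dotpC x); ring.
rewrite ee; move: pe; move: (_%:C%C) (_%:C%C) => a b ab.
transitivity (a * b * (expi (- (2 ^+ j * dotp x (2 *: theta))) * expi (dotp (2 ^+ j *: theta) x) * v x)).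
  ring.
by rewrite (mulrC a) ab mul1r.
Qed.

(** Both [A w] and [w(-theta, 0)] are limits of the distributions given by the
    partial sums of the latter: the difference to [A w] is [A] of the
    remainder, whose [H^s] norm tends to [0], and surjectivity of the Fourier
    transform lets [sobolev_dual] test it against every Schwartz function. *)
Lemma extension_wdist s A : continuous_extension d s (a2theta d theta chi) A ->
  s < 0 -> deq (A (wdist v theta d)) (wdist v (- theta) 0).
Proof.
move=> [AS Alin [C AC] Aext] s0 psi spsi.
have sd : s + d < d by rewrite gtrDr.
have theta1' : enorm (- theta) = 1 by rewrite enormN.
have hw := sobolev_wdist_lt theta1 sv suppv sd.
have hr N : sobolev (s + d) (wremainder theta d v N).
  split; first by apply: tempered_lin; [case: hw|apply: tempered_of_fun; exact: schwartz_wpart].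
  by apply: le_lt_trans (ltry _); exact: sobolev_norm_remainder.
have AE N : A (wremainder theta d v N) psi =
    of_fun (wpart (- theta) 0 v N) psi - A (wdist v theta d) psi.
  rewrite (Alin (- 1) _ _ hw (sobolev_wpart d theta1 sv suppv (s + d) N) psi spsi).
  by rewrite Aext ?pseudo_wpart//; [rewrite mulN1r addrC|exact: schwartz_wpart].
apply: (ccvg_unique _ (of_fun_wpart_ccvg 0 theta1' sv spsi)).
have [phi sphi phiE] := fourier_surj spsi.
have [K K0 hK] := energy_schwartz (- s) sphi.
set D := 4 `^ `|s + d| * mass v / (1 - 4 `^ (s + d - d)).
set q := 4 `^ (s + d - d).
pose b N := Num.sqrt (D * q ^+ N.+1).
(* the summand 2^-N provides the strict inequality required by sobolev_dual *)
apply: (ccvg_squeeze (e := fun N => 2 * ((`|C| * b N + 2^-1 ^+ N) * K))).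
  move=> N; rewrite -AE -phiE; apply: sobolev_dual hK => //.
  have hb := sobolev_norm_remainder theta1 sv suppv N sd.
  apply: (@le_lt_trans _ _ (`|C| * b N)%:E); last by rewrite lte_fin ltrDl exprn_gt0.
  apply: le_trans (AC _ (hr N)) _.
  apply: le_trans (_ : (`|C|%:E * sobolev_norm (s + d) (wremainder theta d v N) <= _)%E).
    by rewrite lee_wpmul2r ?sobolev_norm_ge0// lee_fin ler_norm.
  by rewrite EFinM lee_wpmul2l ?lee_fin.
have q0 : 0 < q by rewrite powR_gt0.
have q1 : q < 1.
  rewrite /q addrK -[s]opprK powRN invf_lt1 ?powR_gt0//.
  apply: le_lt_trans (_ : 1 `^ (- s) < _); first by rewrite powR1.
  by rewrite gt0_ltr_powR ?oppr_gt0// ?nnegrE// ltr1n.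
have qc : q ^+ N @[N --> \oo] --> 0 by apply: cvg_expr; rewrite ger0_norm// ltW.
have bc : b N @[N --> \oo] --> 0.
  rewrite /b -[X in _ --> X]sqrtr0; apply: continuous_cvg; first exact: sqrt_continuous.
  rewrite -[X in _ --> X](mulr0 D); apply: cvgM; first exact: cvg_cst.
  by rewrite (cvg_shiftS (fun N => q ^+ N)).
have hc : (2^-1 : R) ^+ N @[N --> \oo] --> 0.
  by apply: cvg_expr; rewrite ger0_norm// invf_lt1// ltr1n.
have z : (0 : R) = 2 * ((`|C| * 0 + 0) * K) by ring.
rewrite [X in _ --> X]z; apply: cvgM; first exact: cvg_cst.
apply: cvgM; last exact: cvg_cst.
by apply: cvgD hc; apply: cvgM bc; exact: cvg_cst.
Qed.

End operator.

(** * The counterexample *)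

Theorem proposition3p3 (R : realType) (n : nat) (d : R) (theta : 'rV[R]_n)
    (v chi : 'rV[R]_n -> R[i])
    (theta1 : enorm theta = 1)
    (v_schwartz : schwartz v) (v_neq0 : v <> (fun=> 0))
    (supp_v : supp (fourier v) `<=` [set xi | enorm xi < 1 / 20])
    (chi_test : test_function chi)
    (supp_chi : supp chi `<=` [set eta | 3 / 4 <= enorm eta <= 5 / 4])
    (chi1 : forall eta, 9 / 10 <= enorm eta <= 11 / 10 -> chi eta = 1) :
  let w := wdist v theta d in
  [/\ forall s : R, sobolev s w <-> s < d,
      WF w = setT `*` open_ray theta
    & forall (s : R) (A : functional R n -> functional R n),
        continuous_extension d s (a2theta d theta chi) A ->
        sobolev (s + d) w ->
        [/\ deq (A w) (wdist v (- theta) 0),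
            WF (A w) = setT `*` open_ray (- theta)
          & WF w `&` WF (A w) = set0]].
Proof.
move=> w.
have suppv xi : fourier v xi != 0 -> enorm xi < 1 / 20.
  by move=> h; apply: supp_v; exact: subset_closure.
have suppv' xi : fourier v xi != 0 -> enorm xi <= 1 / 20 by move=> /suppv /ltW.
have chi0 : chi theta != 0.
  by rewrite chi1 ?oner_neq0// theta1; apply/andP; split; lra.
have B0 : 0 < 1 / 20 :> R by rewrite divr_gt0.
have WFw := WF_wdist d theta1 v_schwartz chi_test chi0 B0 suppv' v_neq0.
have theta1' : enorm (- theta) = 1 by rewrite enormN.
split=> // [s|s A extA sw]; first exact: sobolev_wdist.
have s0 : s < 0.
  by move/(sobolev_wdist d theta1 v_schwartz suppv v_neq0): sw; rewrite gtrDr.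
have Aw := extension_wdist theta1 v_schwartz suppv supp_chi chi1 extA s0.
have WFAw : WF (A w) = setT `*` open_ray (- theta).
  rewrite (WF_deq Aw).
  exact: (WF_wdist 0 theta1' v_schwartz chi_test chi0 B0 suppv' v_neq0).
split=> //; rewrite WFw WFAw -subset0 => -[x xi] [[_ [t t0 /= tE]] [_ [r r0 /= rE]]].
have : (t + r) *: theta = 0 by rewrite scalerDl tE -rE scalerN addNr.
move=> /eqP; rewrite scaler_eq0 gt_eqF ?addr_gt0//= => /eqP z.
by move: theta1; rewrite z enorm0 => /eqP; rewrite eq_sym oner_eq0.
Qed.
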